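(* Let $\gamma>0$ and $\theta_n=\dfrac{\Gamma(n+\gamma+1)}{n!}$ for $n\ge1$ (equivalently $\sum_{n\ge1}\theta_nz^n=\Gamma(\gamma+1)(1-z)^{-\gamma-1}-\Gamma(\gamma+1)$; note $\theta_n=n^\gamma(1+o(1))$). Let $a=\Gamma(\gamma+1)^{\frac1{\gamma+1}}$. Then, under $\mathbb{P}_n$: (a) $L_1/n^{\frac1{1+\gamma}}$ converges weakly to the Gamma distribution with shape $\gamma+1$ and rate $a$, i.e. for all $s>0$, \[ \lim_{n\to\infty}\mathbb{P}_n\Bigl(\frac{L_1}{n^{1/(1+\gamma)}}<s\Bigr)=\int_0^s x^\gamma e^{-ax}\,dx; \] (b) $\displaystyle\lim_{n\to\infty}n^{-\frac{\gamma}{\gamma+1}}\mathbb{E}_n(K)=\bigl(\Gamma(\gamma)/\gamma^\gamma\bigr)^{\frac1{\gamma+1}}$; (c) $R_1,R_2,\dots$ converge weakly to independent Poisson random variables with means $\theta_1,\frac{\theta_2}2,\frac{\theta_3}{3},\dots$.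
   Context: For $\sigma\in\mathcal{S}_n$ (permutations of $\{1,\dots,n\}$), $R_j(\sigma)$ is the number of cycles of length $j$, $L_1(\sigma)$ the length of the cycle containing $1$, $K(\sigma)=\sum_jR_j(\sigma)$. Given parameters $\theta_j\ge0$, $h_n=\frac1{n!}\sum_{\sigma\in\mathcal{S}_n}\prod_j\theta_j^{R_j(\sigma)}$ and $\mathbb{P}_n(\sigma)=\frac1{n!h_n}\prod_j\theta_j^{R_j(\sigma)}$, with expectation $\mathbb{E}_n$. *)

(* Defs.v *)
From Stdlib Require Import Reals ClassicalEpsilon.
From mathcomp Require Import all_boot all_fingroup.

Set Implicit Arguments.
Unset Strict Implicit.
Unset Printing Implicit Defensive.

(* Euler--Gauss product limit: Gamma(x) = lim_m m! m^x / (x (x+1) ... (x+m)), x > 0. *)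
Definition gauss_seq (x : R) (m : nat) : R :=
  Rdiv (Rmult (INR (factorial m)) (Rpower (INR m) x))
       (\big[Rmult/R1]_(0 <= k < m.+1) (Rplus x (INR k))).

(* The Gamma function (meaningful for x > 0, where the limit exists). *)
Definition Gamma (x : R) : R :=
  epsilon (inhabits R0) (fun l => Un_cv (gauss_seq x) l).

Definition theta (g : R) (j : nat) : R :=
  Rdiv (Gamma (Rplus (Rplus (INR j) g) R1)) (INR (factorial j)).

Definition Rcyc (n : nat) (j : nat) (s : {perm 'I_n}) : nat :=
  #|[set C in porbits s | #|C| == j]|.

Definition Kcyc (n : nat) (s : {perm 'I_n}) : nat := #|porbits s|.

Definition L1 (n : nat) (s : {perm 'I_n.+1}) : nat := #|porbit s ord0|.

(* weight prod_j theta_j^{R_j(sigma)}; R_j = 0 for j > n *)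
Definition weight (th : nat -> R) (n : nat) (s : {perm 'I_n}) : R :=
  \big[Rmult/R1]_(1 <= j < n.+1) pow (th j) (Rcyc j s).

Definition hn (th : nat -> R) (n : nat) : R :=
  Rmult (Rinv (INR (factorial n))) (\big[Rplus/R0]_(s : {perm 'I_n}) weight th s).

Definition Pn (th : nat -> R) (n : nat) (s : {perm 'I_n}) : R :=
  Rdiv (weight th s) (Rmult (INR (factorial n)) (hn th n)).

Definition Prob (th : nat -> R) (n : nat) (A : pred {perm 'I_n}) : R :=
  \big[Rplus/R0]_(s : {perm 'I_n} | A s) Pn th s.

Definition Expect (th : nat -> R) (n : nat) (X : {perm 'I_n} -> R) : R :=
  \big[Rplus/R0]_(s : {perm 'I_n}) Rmult (X s) (Pn th s).

Definition gamma_dens (g a : R) (x : R) : R :=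
  if Rlt_dec 0 x then Rmult (Rpower x g) (exp (Ropp (Rmult a x))) else R0.

Definition poisson (mu : R) (k : nat) : R :=
  Rdiv (Rmult (exp (Ropp mu)) (pow mu k)) (INR (factorial k)).

(* Main.v *)
(* The weights satisfy n h_n = sum_j theta_j h_(n-j), P(L_1 = j) = theta_j h_(n-j) / (n h_n),
   E(K) = sum_j (theta_j / j) h_(n-j) / h_n, and fixing R_1, ..., R_m amounts to setting
   theta_1, ..., theta_m to zero; so everything rests on the quotients h_(n-j) / h_n.
   If (1, theta_1, theta_2, ...) is log-concave, so is h (Bender and Canfield), hence
   r_n = h_n / h_(n+1) is nondecreasing, and the recursion sandwiches n between partial sums of
   sum_j theta_j r_n^j ~ Gamma(g+1) (1 - r_n)^(-g-1), which gives 1 - r_n ~ a n^(-1/(g+1)).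
   Changing one theta_p by y multiplies the generating function by exp(y z^p / p), hence h_n by
   exp(y / p) asymptotically.  This handles the failure of log-concavity at theta_1 for small g, and
   gives (c).  (a) is then a Riemann sum, and (b) is the binomial series at exp(-a n^(-1/(g+1))). *)
Require Import Defs.
From Stdlib Require Import Reals.
From mathcomp Require Import all_boot all_fingroup.
From HB Require Import structures.
From Stdlib Require Import Lra FunctionalExtensionality ClassicalEpsilon.
From Coquelicot Require Import Coquelicot.

Set Implicit Arguments.
Unset Strict Implicit.
Unset Printing Implicit Defensive.

#[local] Arguments INR _ : simpl never.
Local Open Scope nat_scope.

(** * Cycle types under insertion of a point *)

(** What is needed is h_(n-j) / h_n uniformly for j up to a multiple of n^(1/(g+1)), not just the
    size of h_n. Monotone quotients give this directly: h_(n-j) / h_n is a product of j of them, so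
    it lies between r_(n-j)^j and r_(n-1)^j. This takes the place of a saddle-point analysis. The
    two halves of the sandwich are not symmetric. That the series at r_n is at least about n is
    immediate. In the other direction the recursion only bounds a partial sum of length m, by n + m,
    so m must be a small multiple of n and the tail beyond m must be negligible. By Markov's
    inequality this holds once n (1 - r_n) tends to infinity, and the superlinear growth of theta_1
    + ... + theta_n forces that. The log-concave sequence with a modified theta_1 is a common
    yardstick: each solution used later arises from it by finitely many changes of single weights,
    so its quotient by the yardstick converges, and the constant coming from theta_1 cancels in the
    probabilities and expectations. *)

HB.instance Definition _ := Monoid.isComLaw.Build R R0 Rplus
  (fun x y z => esym (Rplus_assoc x y z)) Rplus_comm Rplus_0_l.
HB.instance Definition _ := Monoid.isComLaw.Build R R1 Rmult
  (fun x y z => esym (Rmult_assoc x y z)) Rmult_comm Rmult_1_l.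
HB.instance Definition _ := Monoid.isMulLaw.Build R R0 Rmult Rmult_0_l Rmult_0_r.
HB.instance Definition _ := Monoid.isAddLaw.Build R Rmult Rplus
  (fun x y z => Rmult_plus_distr_r x y z) Rmult_plus_distr_l.

Lemma sumR_const (I : finType) (c : R) :
  \big[Rplus/R0]_(i : I) c = Rmult (INR #|I|) c.
Proof.
rewrite big_const; elim: #|I| => [|n IHn]; first by rewrite Rmult_0_l.
by rewrite iterS IHn S_INR; lra.
Qed.

Section Porbits.
Variable T : finType.
Implicit Types (s t : {perm T}) (x y : T) (A : {set T}).

Lemma porbit_step s x : s x \in porbit s x.
Proof. exact: (mem_porbit s 1 x). Qed.

Lemma porbit_trans s x y z :
  y \in porbit s x -> z \in porbit s y -> z \in porbit s x.
Proof. by rewrite -eq_porbit_mem => /eqP ->. Qed.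

Lemma porbit_sub_stable s x A :
  x \in A -> {in A, forall y, s y \in A} -> porbit s x \subset A.
Proof.
move=> xA sA; apply/subsetP=> y /porbitP[i ->].
elim: i => [|i IHi]; first by rewrite expg0 perm1.
by rewrite expgSr permM; apply: sA.
Qed.

Lemma card_porbit_mem s x y : y \in porbit s x -> #|porbit s y| = #|porbit s x|.
Proof. by rewrite -eq_porbit_mem => /eqP ->. Qed.

Lemma mem_porbitJ s t x y : (t y \in porbit (s ^ t)%g (t x)) = (y \in porbit s x).
Proof.
apply/porbitP/porbitP=> -[i].
  by rewrite -conjXg conjgE !permM permK => /perm_inj->; exists i.
by move=> ->; exists i; rewrite -conjXg conjgE !permM permK.
Qed.

Lemma card_porbitJ s t x : #|porbit (s ^ t)%g (t x)| = #|porbit s x|.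
Proof.
rewrite -(card_imset (mem (porbit s x)) (@perm_inj _ t)); apply: eq_card => y.
rewrite -[y](permKV t) mem_porbitJ.
by rewrite (mem_imset _ _ (@perm_inj _ t)).
Qed.

Lemma partition_porbits s : partition (porbits s) [set: T].
Proof.
have -> : porbits s = [set orbit 'P <[s]> x | x in [set: T]].
  apply/setP=> C; apply/imsetP/imsetP=> -[x _ ->]; exists x; rewrite ?porbitE ?inE //.
by apply: orbit_partition; apply/actsP=> a _ x; rewrite !inE.
Qed.

(** The points whose cycle has length j are a union of blocks of size j. Counting points instead of
    cycles lets later bijections act on elements of T rather than on sets. *)
Lemma card_porbit_eq s j :
  #|[set x | #|porbit s x| == j]| = #|[set C in porbits s | #|C| == j]| * j.
Proof.
apply: card_uniform_partition => [A|]; first by rewrite inE => /andP[_ /eqP].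
have /and3P[_ trivP P0] := partition_porbits s.
apply/and3P; split.
- rewrite eqEsubset; apply/andP; split; apply/subsetP=> x.
    case/bigcupP=> C; rewrite !inE => /andP[] /imsetP[y _ ->] yj xy.
    by rewrite (card_porbit_mem xy).
  rewrite inE => xj; apply/bigcupP; exists (porbit s x); last exact: porbit_id.
  by rewrite inE xj andbT; apply: imset_f.
- by apply: trivIsetS trivP; apply/subsetP=> C; rewrite inE => /andP[].
- by rewrite inE (negPf P0).
Qed.

End Porbits.

Section Rcyc.
Variables (n : nat) (s : {perm 'I_n}).

Lemma Rcyc_mul j : #|[set x | #|porbit s x| == j]| = Rcyc j s * j.
Proof. exact: card_porbit_eq. Qed.

Lemma Rcyc0 : Rcyc 0 s = 0.
Proof.
apply/eqP; rewrite cards_eq0; apply/eqP/setP=> C; rewrite !inE.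
apply/negP=> /andP[] /imsetP[x _ ->].
by rewrite (negPf (card_porbit_neq0 s x)).
Qed.

Lemma Rcyc_gt j : n < j -> Rcyc j s = 0.
Proof.
move=> nj; apply/eqP; rewrite cards_eq0; apply/eqP/setP=> C; rewrite !inE.
apply/negP=> /andP[_ /eqP Cj].
by have := max_card (mem C); rewrite Cj card_ord leqNgt nj.
Qed.

(* [j] times the number of [j]-cycles of [s] not containing [x] *)
Definition away x j := #|[set y | (y \notin porbit s x) && (#|porbit s y| == j)]|.

(** The division is exact, because the points counted by [away] fill whole cycles; the boolean
    restores the cycle of x. At j = 0 both sides vanish, division by zero being zero. *)
Lemma Rcyc_away x j : Rcyc j s = away x j %/ j + (j == #|porbit s x|).
Proof.
have [->|j0] := posnP j.
  by rewrite Rcyc0 divn0 eq_sym (negPf (card_porbit_neq0 s x)).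
apply/eqP; rewrite -(eqn_pmul2r j0) mulnDl -Rcyc_mul; apply/eqP.
pose B := [set y | #|porbit s y| == j].
have -> : away x j = #|B :\: porbit s x| by apply: eq_card => y; rewrite !inE.
rewrite -[X in X = _](cardsID (porbit s x)) addnC.
have IB : #|B :&: porbit s x| = (j == #|porbit s x|) * j.
  have [ej|ej] := eqVneq j #|porbit s x|.
    rewrite mul1n ej; apply: eq_card => y; rewrite !inE ej.
    case yx: (y \in porbit s x); rewrite ?andbF // andbT.
    by rewrite (card_porbit_mem yx) eqxx.
  apply/eqP; rewrite mul0n cards_eq0; apply/eqP/setP=> y; rewrite !inE.
  apply/negP=> /andP[/eqP yj yx]; move: ej; rewrite -yj (card_porbit_mem yx).
  by rewrite eqxx.
rewrite -/B IB; congr (_ + _); rewrite divnK //.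
have : j %| #|B :\: porbit s x| + #|B :&: porbit s x|.
  by rewrite addnC cardsID Rcyc_mul dvdn_mull.
by rewrite dvdn_addl // IB dvdn_mull.
Qed.

End Rcyc.

Lemma RcycJ n (s t : {perm 'I_n}) j : Rcyc j (s ^ t)%g = Rcyc j s.
Proof.
have [->|j0] := posnP j; first by rewrite !Rcyc0.
apply/eqP; rewrite -(eqn_pmul2r j0) -!Rcyc_mul; apply/eqP.
rewrite -[RHS](card_imset _ (@perm_inj _ t)); apply: eq_card => x.
rewrite -[x](permKV t) (mem_imset _ _ (@perm_inj _ t)) !inE.
by rewrite card_porbitJ.
Qed.

Lemma awayJ n (s t : {perm 'I_n}) x j : away (s ^ t)%g (t x) j = away s x j.
Proof.
rewrite /away -[RHS](card_imset _ (@perm_inj _ t)); apply: eq_card => y.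
rewrite -[y](permKV t) (mem_imset _ _ (@perm_inj _ t)) !inE.
by rewrite card_porbitJ mem_porbitJ.
Qed.

Section Insertion.
Variable n : nat.
Implicit Types (s : {perm 'I_n}) (y : 'I_n.+1) (i x : 'I_n).

(* [insert y s] is [s] acting on the nonzero indices, with [0] put just before [y] in its cycle. *)
Definition insert y s : {perm 'I_n.+1} := (lift_perm ord0 ord0 s * tperm ord0 y)%g.

Lemma insert0 y s : insert y s ord0 = y.
Proof. by rewrite permM lift_perm_id tpermL. Qed.

Lemma insert_lift y s x :
  insert y s (lift ord0 x) = if lift ord0 (s x) == y then ord0 else lift ord0 (s x).
Proof.
rewrite permM (lift_perm_lift _ _ _ x); case: eqP => [->|ne]; first by rewrite tpermR.
by rewrite tpermD ?neq_lift // eq_sym; apply/eqP.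
Qed.

(** The image of 0 gives back y, and cancelling the transposition gives back s. Surjectivity then
    follows from (n+1) n! = (n+1)!. *)
Lemma insert_bij : bijective (fun p : 'I_n.+1 * {perm 'I_n} => insert p.1 p.2).
Proof.
apply: inj_card_bij => [[y s] [y' s'] /= e|].
  have ey : y = y' by rewrite -(insert0 y s) e insert0.
  subst y'; congr (_, _); apply/permP=> x.
  have /permP/(_ (lift ord0 x)) : lift_perm ord0 ord0 s = lift_perm ord0 ord0 s'.
    by apply: (mulIg (tperm ord0 y)); exact: e.
  by rewrite !(lift_perm_lift _ _ _ x) => /lift_inj.
by rewrite card_prod card_ord !card_Sn factS.
Qed.

Lemma sum_insert (F : {perm 'I_n.+1} -> R) (P : pred {perm 'I_n.+1}) :
  \big[Rplus/R0]_(s | P s) F s =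
  \big[Rplus/R0]_(y : 'I_n.+1) \big[Rplus/R0]_(s : {perm 'I_n} | P (insert y s)) F (insert y s).
Proof.
rewrite (reindex _ (onW_bij _ insert_bij)) /=.
by rewrite pair_big_dep.
Qed.

Lemma mem_insert_lift s y x z :
  (lift ord0 z \in porbit (insert y s) (lift ord0 x)) = (z \in porbit s x).
Proof.
have step w : lift ord0 (s w) \in porbit (insert y s) (lift ord0 w).
  have := porbit_step (insert y s) (lift ord0 w); rewrite insert_lift.
  case: eqP => // e h0; apply: porbit_trans h0 _.
  by have := porbit_step (insert y s) ord0; rewrite insert0 e.
apply/idP/idP => [h|].
  (* A stable set that contains the orbit: the lifted orbit of x, together with 0 if y lies in it.
     When y = 0 the point 0 is fixed, so adding it does no harm. *)
  pose A := [set w | if unlift ord0 w is Some w' then w' \in porbit s x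
                     else if unlift ord0 y is Some y' then y' \in porbit s x else true].
  have : porbit (insert y s) (lift ord0 x) \subset A.
    apply: porbit_sub_stable; first by rewrite inE liftK porbit_id.
    move=> w; rewrite !inE; case: (unliftP ord0 w) => [w' ->|->].
      move=> w'x; rewrite insert_lift.
      have sx : s w' \in porbit s x by apply: porbit_trans w'x (porbit_step _ _).
      by case: eqP => [<-|_]; rewrite ?unlift_none liftK.
    by rewrite insert0; case: (unliftP ord0 y) => [y' _|_].
  by move/subsetP/(_ _ h); rewrite inE liftK.
case/porbitP=> i ->; elim: i => [|i IHi]; first by rewrite expg0 perm1 porbit_id.
by rewrite expgSr permM; apply: porbit_trans IHi (step _).
Qed.

Lemma mem_insert0_lift s i z :
  (lift ord0 z \in porbit (insert (lift ord0 i) s) ord0) = (z \in porbit s i).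
Proof.
rewrite -(mem_insert_lift s (lift ord0 i)) -!eq_porbit_mem; congr (_ == _).
apply/eqP; rewrite eq_porbit_mem porbit_sym.
by have := porbit_step (insert (lift ord0 i) s) ord0; rewrite insert0.
Qed.

Lemma porbit_insert00 s : porbit (insert ord0 s) ord0 = [set ord0].
Proof.
apply/eqP; rewrite eqEsubset sub1set porbit_id andbT.
by apply: porbit_sub_stable => [|w]; rewrite !inE // => /eqP ->; rewrite insert0.
Qed.

Lemma card_ord0_lift (A : {set 'I_n.+1}) :
  #|A| = (ord0 \in A) + #|[set x | lift ord0 x \in A]|.
Proof.
rewrite (cardsD1 ord0); congr (_ + _).
rewrite -[RHS](card_imset _ (@lift_inj _ ord0)); apply: eq_card => x.
case: (unliftP ord0 x) => [x' ->|->].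
  by rewrite (mem_imset _ _ (@lift_inj _ ord0)) !inE eq_sym neq_lift.
rewrite !inE; symmetry; apply/negP=> /imsetP[z _ /eqP].
by apply/negP; rewrite neq_lift.
Qed.

Lemma card_porbit_insert s i :
  #|porbit (insert (lift ord0 i) s) ord0| = #|porbit s i|.+1.
Proof.
rewrite card_ord0_lift porbit_id add1n; congr (_.+1).
by apply: eq_card => x; rewrite inE mem_insert0_lift.
Qed.

Lemma card_porbit_insert_notin s y x :
  ord0 \notin porbit (insert y s) (lift ord0 x) ->
  #|porbit (insert y s) (lift ord0 x)| = #|porbit s x|.
Proof.
move=> h; rewrite card_ord0_lift (negPf h) add0n.
by apply: eq_card => z; rewrite inE mem_insert_lift.
Qed.

(** This invariance is the reason for leaving out the cycle of the base point in [away]: splicing 0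
    in front of i lengthens that cycle and touches no other. *)
Lemma away_insert s i j : away (insert (lift ord0 i) s) ord0 j = away s i j.
Proof.
rewrite /away card_ord0_lift inE porbit_id add0n; apply: eq_card => x.
rewrite !inE mem_insert0_lift; case: (boolP (x \in porbit s i)) => //= h.
rewrite card_porbit_insert_notin //; apply: contra h.
by rewrite porbit_sym mem_insert0_lift.
Qed.

Lemma away_insert0 s j : away (insert ord0 s) ord0 j = Rcyc j s * j.
Proof.
rewrite -Rcyc_mul /away card_ord0_lift inE porbit_id add0n; apply: eq_card => x.
have h : lift ord0 x \notin porbit (insert ord0 s) ord0.
  by rewrite porbit_insert00 inE eq_sym neq_lift.
by rewrite !inE h card_porbit_insert_notin // porbit_sym.
Qed.

End Insertion.

(** Conjugation by the transposition of 0 and x exchanges the two base points and preserves cycle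
    lengths. *)
Lemma sum_away_base n l (x : 'I_n.+1) (Phi : (nat -> nat) -> R) :
  \big[Rplus/R0]_(s : {perm 'I_n.+1} | #|porbit s x| == l) Phi (away s x) =
  \big[Rplus/R0]_(s : {perm 'I_n.+1} | #|porbit s ord0| == l) Phi (away s ord0).
Proof.
rewrite (reindex_inj (@conjg_inj _ (tperm ord0 x))).
have e0 : tperm ord0 x ord0 = x by rewrite tpermL.
apply: eq_big => s; rewrite -{2}e0 card_porbitJ // => _; congr Phi.
by apply: functional_extensionality => j; rewrite -{2}e0 awayJ.
Qed.

(** Induction by deleting 0. If 0 is fixed, its cycle has length 1 and all of s is away from it.
    Otherwise 0 sits in front of one of n points i, whose cycle is one shorter, and [sum_away_base]
    makes the n choices equal. The falling factorial thus counts the ordered choices of the other l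
    points of the cycle. *)
Lemma sum_away n l (Phi : (nat -> nat) -> R) : l <= n ->
  \big[Rplus/R0]_(s : {perm 'I_n.+1} | #|porbit s ord0| == l.+1) Phi (away s ord0) =
  Rmult (INR (n ^_ l))
    (\big[Rplus/R0]_(s : {perm 'I_(n - l)}) Phi (fun j => Rcyc j s * j)).
Proof.
elim: l n => [|l IHl] n ln; rewrite sum_insert big_ord_recl.
  rewrite [X in Rplus _ X]big1 => [|i _]; last first.
    rewrite big_pred0 // => s; rewrite card_porbit_insert eqSS.
    exact/negbTE/card_porbit_neq0.
  rewrite ffactn0 Rmult_1_l Rplus_0_r subn0.
  apply: eq_big => [s|s _]; first by rewrite porbit_insert00 cards1.
  by congr Phi; apply: functional_extensionality => j; rewrite away_insert0.
case: n ln => // n ln.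
rewrite big_pred0 => [|s]; last by rewrite porbit_insert00 cards1.
rewrite Rplus_0_l subSS.
under eq_bigr => i _.
  under eq_big => [s|s _].
    rewrite card_porbit_insert eqSS; over.
    rewrite (_ : away _ _ = away s i); last first.
      by apply: functional_extensionality => j; rewrite away_insert.
    over.
  rewrite (sum_away_base l.+1 i Phi); over.
by rewrite sumR_const IHl // card_ord ffactSS mult_INR Rmult_assoc.
Qed.

Lemma sum_cycle0 n l (Phi : (nat -> nat) -> R) : l <= n ->
  \big[Rplus/R0]_(s : {perm 'I_n.+1} | #|porbit s ord0| == l.+1) Phi (fun j => Rcyc j s) =
  Rmult (INR (n ^_ l))
    (\big[Rplus/R0]_(s : {perm 'I_(n - l)}) Phi (fun j => Rcyc j s + (j == l.+1))).
Proof.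
(* Psi turns numbers of points away from 0 into cycle counts, as in [Rcyc_away], the cycle of 0
   having length l + 1. *)
move=> ln; pose Psi c := Phi (fun j => c j %/ j + (j == l.+1)).
have := sum_away Psi ln; rewrite /Psi => e.
transitivity (Rmult (INR (n ^_ l))
    (\big[Rplus/R0]_(s : {perm 'I_(n - l)}) Psi (fun j => Rcyc j s * j))).
  rewrite -e; apply: eq_bigr => s /eqP sl; congr Phi.
  by apply: functional_extensionality => j; rewrite (Rcyc_away s ord0) sl.
congr Rmult; apply: eq_bigr => s _; congr Phi.
apply: functional_extensionality => j; congr (_ + _).
by have [->|j0] := posnP j; rewrite ?Rcyc0 // mulnK.
Qed.

(** Double counting of pairs of a permutation and a point in one of its cycles of length l + 1: each
    such cycle has l + 1 points, and by conjugation all n + 1 points contribute what 0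
    contributes. *)
Lemma sum_Rcyc n l (Phi : (nat -> nat) -> R) : l <= n ->
  \big[Rplus/R0]_(s : {perm 'I_n.+1})
     Rmult (INR (Rcyc l.+1 s)) (Phi (fun j => Rcyc j s)) =
  Rmult (Rdiv (INR (n.+1 ^_ l.+1)) (INR l.+1))
    (\big[Rplus/R0]_(s : {perm 'I_(n - l)}) Phi (fun j => Rcyc j s + (j == l.+1))).
Proof.
move=> ln.
have l0 : INR l.+1 <> R0 by apply: not_0_INR.
transitivity (Rmult (Rinv (INR l.+1)) (\big[Rplus/R0]_(x : 'I_n.+1)
   \big[Rplus/R0]_(s : {perm 'I_n.+1} | #|porbit s x| == l.+1) Phi (fun j => Rcyc j s))).
  rewrite (exchange_big_dep predT) // big_distrr; apply: eq_bigr => s _.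
  rewrite big_const.
  have -> : #|[pred x | true && (#|porbit s x| == l.+1)]| = Rcyc l.+1 s * l.+1.
    by rewrite -Rcyc_mul; apply: eq_card => x; rewrite !inE.
  have it m c : iter m (Rplus c) R0 = Rmult (INR m) c.
    elim: m => [|m IHm]; first by rewrite Rmult_0_l.
    by rewrite iterS IHm S_INR; lra.
  rewrite it mult_INR; move: l0; generalize (INR l.+1) => c c0 /=; by field.
under eq_bigr => x _.
  have -> : \big[Rplus/R0]_(s : {perm 'I_n.+1} | #|porbit s x| == l.+1) Phi (fun j => Rcyc j s)
      = \big[Rplus/R0]_(s : {perm 'I_n.+1} | #|porbit s ord0| == l.+1) Phi (fun j => Rcyc j s).
    rewrite (reindex_inj (@conjg_inj _ (tperm ord0 x))).
    have e0 : tperm ord0 x ord0 = x by rewrite tpermL.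
    apply: eq_big => s; rewrite -{2}e0 card_porbitJ // => _; congr Phi.
    by apply: functional_extensionality => j; rewrite RcycJ.
  over.
rewrite sumR_const card_ord (sum_cycle0 _ ln) ffactSS mult_INR.
by move: l0; generalize (INR l.+1) => c c0; by field.
Qed.

(** * Recursions for the weights *)

Section Weight.
Variable th : nat -> R.

Lemma weight_widen n N (s : {perm 'I_n}) : n <= N ->
  weight th s = \big[Rmult/R1]_(1 <= j < N.+1) pow (th j) (Rcyc j s).
Proof.
move=> nN; rewrite [RHS](@big_cat_nat _ _ _ n.+1) //= [X in Rmult _ X]big_nat.
by rewrite [X in Rmult _ X]big1 ?Rmult_1_r // => j /andP[nj _]; rewrite Rcyc_gt.
Qed.

Lemma weight_add_cycle n l (s : {perm 'I_(n - l)}) : l <= n ->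
  \big[Rmult/R1]_(1 <= j < n.+2) pow (th j) (Rcyc j s + (j == l.+1)) =
  Rmult (th l.+1) (weight th s).
Proof.
move=> ln; rewrite (@weight_widen _ n.+1) ?(leq_trans (leq_subr _ _)) //.
under eq_bigr => j _ do rewrite pow_add.
rewrite big_split /= Rmult_comm; congr Rmult.
rewrite (bigD1_seq l.+1) ?mem_index_iota ?iota_uniq //= eqxx pow_1.
by rewrite big1 ?Rmult_1_r // => j /negPf ->.
Qed.

Lemma sum_weight n :
  \big[Rplus/R0]_(s : {perm 'I_n}) weight th s = Rmult (INR n`!) (hn th n).
Proof.
have n0 : INR n`! <> R0 by apply: not_0_INR; apply/eqP; rewrite -lt0n fact_gt0.
by rewrite /hn; move: n0; generalize (INR n`!) => c c0; field.
Qed.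

Lemma sum_weight_cycle0 n l : l <= n ->
  \big[Rplus/R0]_(s : {perm 'I_n.+1} | #|porbit s ord0| == l.+1) weight th s =
  Rmult (INR n`!) (Rmult (th l.+1) (hn th (n - l))).
Proof.
move=> ln; rewrite (sum_cycle0 (fun c => \big[Rmult/R1]_(1 <= j < n.+2) pow (th j) (c j)) ln).
under eq_bigr => s _ do rewrite weight_add_cycle //.
by rewrite -big_distrr /= sum_weight -(ffact_fact ln) mult_INR; ring.
Qed.

Lemma sum_by_cycle0 n (P : pred nat) (F : {perm 'I_n.+1} -> R) :
  \big[Rplus/R0]_(s : {perm 'I_n.+1} | P #|porbit s ord0|) F s =
  \big[Rplus/R0]_(l < n.+1 | P l.+1)
    \big[Rplus/R0]_(s : {perm 'I_n.+1} | #|porbit s ord0| == l.+1) F s.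
Proof.
(* Cycle lengths run from 1 to n + 1, so the predecessor of a length is a valid index and [inord]
   takes no default value. *)
have cE (s : {perm 'I_n.+1}) :
    (inord #|porbit s ord0|.-1 : 'I_n.+1).+1 = #|porbit s ord0|.
  rewrite inordK ?prednK // ?lt0n ?card_porbit_neq0 //.
  by rewrite (leq_trans (max_card _)) ?card_ord.
rewrite (partition_big (fun s => inord #|porbit s ord0|.-1 : 'I_n.+1)
  (fun l : 'I_n.+1 => P l.+1)) => [|s Ps] /=; last by rewrite cE.
apply: eq_bigr => l Pl; apply: eq_bigl => s.
move: (cE s); set i := (inord _ : 'I__) => <-; rewrite eqSS [RHS]eq_sym.
rewrite -[i == l](inj_eq val_inj) /= eq_sym; case: eqP => [<-|_]; last by rewrite andbF.
by rewrite Pl.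
Qed.

Lemma hn_0 : hn th 0 = R1.
Proof.
rewrite /hn (eq_bigr (fun=> R1)) => [|s _]; last by rewrite /weight big_nil.
by rewrite sumR_const card_Sn fact0 INR_1 Rinv_1; lra.
Qed.

(** Split the sum of the weights by the length of the cycle of 0; the falling factorial counting
    such cycles combines with (n-l)! to n!. *)
Lemma hn_rec n :
  Rmult (INR n.+1) (hn th n.+1) = \big[Rplus/R0]_(l < n.+1) Rmult (th l.+1) (hn th (n - l)).
Proof.
have n0 : INR n`! <> R0 by apply: not_0_INR; apply/eqP; rewrite -lt0n fact_gt0.
apply: (Rmult_eq_reg_l _ _ _ _ n0).
have := sum_weight n.+1; rewrite factS mult_INR => e.
transitivity (\big[Rplus/R0]_(s : {perm 'I_n.+1}) weight th s); first by rewrite e; lra.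
rewrite (sum_by_cycle0 predT) big_distrr /=; apply: eq_bigr => l _.
by rewrite sum_weight_cycle0 // -ltnS.
Qed.

Lemma Prob_L1 n (A : pred nat) : hn th n.+1 <> R0 ->
  Prob th (fun s : {perm 'I_n.+1} => A (L1 s)) =
  Rdiv (\big[Rplus/R0]_(l < n.+1 | A l.+1) Rmult (th l.+1) (hn th (n - l)))
       (Rmult (INR n.+1) (hn th n.+1)).
Proof.
move=> h0; rewrite /Prob /Pn /L1.
have n0 : INR n`! <> R0 by apply: not_0_INR; apply/eqP; rewrite -lt0n fact_gt0.
have n1 : INR n.+1 <> R0 by apply: not_0_INR.
rewrite -big_distrl (sum_by_cycle0 A) /=.
under eq_bigr => l _.
  rewrite sum_weight_cycle0; last by rewrite -ltnS.
  over.
rewrite -big_distrr factS mult_INR /=; move: n0 n1.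
by generalize (INR n`!) (INR n.+1) => c d c0 d0; field.
Qed.

Lemma Kcyc_sum n (s : {perm 'I_n}) :
  INR (Kcyc s) = \big[Rplus/R0]_(l < n) INR (Rcyc l.+1 s).
Proof.
have <- : (\sum_(l < n) Rcyc l.+1 s)%N = Kcyc s.
  rewrite /Kcyc -sum1_card.
  rewrite (eq_bigr (fun l : 'I_n => \sum_(C in porbits s | #|C| == l.+1) 1)%N).
    rewrite (exchange_big_dep (mem (porbits s))) /= => [|l C _ /andP[]] //.
    apply: eq_bigr => C Cs.
    have C0 : 0 < #|C|.
      by case/imsetP: Cs => x _ ->; rewrite lt0n card_porbit_neq0.
    have Cn : #|C|.-1 < n by rewrite prednK // -[X in _ <= X]card_ord max_card.
    rewrite (big_pred1 (Ordinal Cn)) // => l; rewrite Cs /=.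
    by rewrite -[RHS](inj_eq val_inj) /= eq_sym -[RHS]eqSS prednK.
  by move=> l _; rewrite /Rcyc -sum1_card; apply: eq_bigl => C; rewrite !inE.
elim: n s => [|n _] s; first by rewrite !big_ord0.
by apply: (big_morph INR) => // x y; rewrite plus_INR.
Qed.

Lemma Expect_K n : hn th n <> R0 ->
  Expect th (fun s : {perm 'I_n} => INR (Kcyc s)) =
  Rdiv (\big[Rplus/R0]_(l < n) Rmult (Rdiv (th l.+1) (INR l.+1)) (hn th (n - l.+1)))
       (hn th n).
Proof.
case: n => [|n] h0.
  rewrite /Expect big1 => [|s _]; first by rewrite big_ord0 /Rdiv Rmult_0_l.
  by rewrite Kcyc_sum big_ord0 Rmult_0_l.
have n0 : INR n.+1`! <> R0 by apply: not_0_INR; apply/eqP; rewrite -lt0n fact_gt0.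
transitivity (Rdiv (\big[Rplus/R0]_(s : {perm 'I_n.+1}) Rmult (INR (Kcyc s)) (weight th s))
               (Rmult (INR n.+1`!) (hn th n.+1))).
  rewrite /Expect /Pn /Rdiv big_distrl; apply: eq_bigr => s _ /=.
  by rewrite Rmult_assoc.
under eq_bigr => s _ do rewrite Kcyc_sum big_distrl /=.
rewrite exchange_big /=.
under eq_bigr => l _.
  have ln : (l <= n)%N by rewrite -ltnS.
  rewrite (sum_Rcyc (fun c => \big[Rmult/R1]_(1 <= j < n.+2) pow (th j) (c j)) ln).
  under eq_bigr => s _ do rewrite weight_add_cycle //.
  rewrite -big_distrr sum_weight.
  have -> : Rmult (INR (n.+1 ^_ l.+1) / INR l.+1) (th l.+1 * (INR (n - l)`! * hn th (n - l))) =
    Rmult (INR n.+1`!) (Rmult (Rdiv (th l.+1) (INR l.+1)) (hn th (n.+1 - l.+1))).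
    by rewrite subSS -(@ffact_fact n.+1 l.+1) // subSS (mult_INR _ (n - l)`!) /Rdiv; ring.
  over.
rewrite -big_distrr /=; move: n0; generalize (INR n.+1`!) => c c0.
by field.
Qed.

End Weight.

(** * Prescribed numbers of short cycles *)

(** The n-th coefficient of the product over j <= m of (theta_j z^j / j)^(k_j) / k_j!, times the
    exponential of the sum over j > m of theta_j z^j / j. Dividing by n! alone makes it comparable
    with [hn]. *)
Definition hfix th m (k : nat -> nat) n : R :=
  Rdiv (\big[Rplus/R0]_(s : {perm 'I_n} | [forall j : 'I_m, Rcyc j.+1 s == k j.+1]) weight th s)
       (INR n`!).

Lemma Prob_hfix th m k n :
  Prob th (fun s : {perm 'I_n} => [forall j : 'I_m, Rcyc j.+1 s == k j.+1]) =
  Rdiv (hfix th m k n) (hn th n).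
Proof.
by rewrite /Prob /Pn /hfix /Rdiv -big_distrl Rinv_mult /= Rmult_assoc.
Qed.

Lemma hfix_ext th m k k' n : (forall j, 0 < j <= m -> k j = k' j) ->
  hfix th m k n = hfix th m k' n.
Proof.
move=> kk'; congr Rdiv; apply: eq_bigl => s.
by apply/forallP/forallP => h j; move: (h j); rewrite kk' //=.
Qed.

(** A zero weight kills every permutation with a cycle of that length, while 0^0 = 1 leaves the
    others unchanged. *)
Lemma hfix0 th m n :
  hfix th m (fun=> 0) n = hn (fun j => if j <= m then R0 else th j) n.
Proof.
rewrite /hfix /hn /Rdiv Rmult_comm; congr Rmult; rewrite big_mkcond.
apply: eq_bigr => s _; case: forallP => [h|h].
  apply: eq_big_nat => j /andP[j0 _]; case: leqP => // jm.
  have jm' : j.-1 < m by rewrite prednK.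
  by have := h (Ordinal jm'); rewrite /= prednK // => /eqP ->.
suff [j /andP[j0 jm] Rj] : exists2 j, 0 < j <= m & Rcyc j s != 0.
  have jn : j <= n by rewrite leqNgt; apply: contra Rj => /Rcyc_gt ->.
  rewrite /weight (bigD1_seq j) ?mem_index_iota ?iota_uniq ?j0 //= jm.
  by rewrite pow_i ?Rmult_0_l //; apply/ltP; rewrite lt0n.
case: (pickP (fun j : 'I_m => Rcyc j.+1 s != 0)) => [j hj|h']; first by exists j.+1; rewrite /= ?ltn_ord.
by case: h => j; have /negbFE := h' j.
Qed.

(** On the event, k (l + 1) is the number of cycles of length l + 1, so multiplying by it marks one
    such cycle, which [sum_Rcyc] removes. The alternative k (l + 1) = 0 is kept apart because there
    the truncated subtraction would not lower the count. *)
Lemma hfix_step th m k n l : l < m -> l < n ->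
  Rmult (INR (k l.+1)) (hfix th m k n) =
  Rmult (Rdiv (th l.+1) (INR l.+1))
    (hfix th m (fun j => k j - (j == l.+1)) (n - l.+1)) \/ k l.+1 = 0.
Proof.
case: n => // n lm ln; have [->|k0] := posnP (k l.+1); first by right.
left; rewrite subSS.
(* The event is put into the summand, as a function of the cycle counts only, which is the form that
   [sum_Rcyc] accepts. *)
pose Phi (c : nat -> nat) := if [forall j : 'I_m, c j.+1 == k j.+1]
   then \big[Rmult/R1]_(1 <= j < n.+2) pow (th j) (c j) else R0.
have n0 : INR n.+1`! <> R0 by apply: not_0_INR; apply/eqP; rewrite -lt0n fact_gt0.
have e : Rmult (INR (k l.+1)) (\big[Rplus/R0]_(s : {perm 'I_n.+1} |
      [forall j : 'I_m, Rcyc j.+1 s == k j.+1]) weight th s) =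
   \big[Rplus/R0]_(s : {perm 'I_n.+1}) Rmult (INR (Rcyc l.+1 s)) (Phi (fun j => Rcyc j s)).
  rewrite big_distrr big_mkcond; apply: eq_bigr => s _ /=; rewrite /Phi.
  case: forallP => [h|_]; last by rewrite Rmult_0_r.
  by have /eqP -> := h (Ordinal lm).
rewrite /hfix -[LHS]/(Rmult _ (Rmult _ _)) -Rmult_assoc e sum_Rcyc //.
have -> : \big[Rplus/R0]_(s : {perm 'I_(n - l)}) Phi (fun j => Rcyc j s + (j == l.+1)) =
   Rmult (th l.+1) (\big[Rplus/R0]_(s : {perm 'I_(n - l)} |
      [forall j : 'I_m, Rcyc j.+1 s == k j.+1 - (j.+1 == l.+1)]) weight th s).
  rewrite big_distrr [RHS]big_mkcond; apply: eq_bigr => s _ /=; rewrite /Phi.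
  rewrite weight_add_cycle //; congr (if _ then _ else _).
  apply: eq_forallb => j; case: (j.+1 =P l.+1) => [->|_]; last by rewrite addn0 subn0.
  by rewrite addn1 -[X in _ == X](prednK k0) subn1 eqSS.
rewrite -(@ffact_fact n.+1 l.+1) // subSS (mult_INR _ (n - l)`!).
have c0 : INR (n.+1 ^_ l.+1) <> R0.
  by apply: not_0_INR; apply/eqP; rewrite -lt0n ffact_gt0.
have d0 : INR (n - l)`! <> R0 by apply: not_0_INR; apply/eqP; rewrite -lt0n fact_gt0.
have l0 : INR l.+1 <> R0 by apply: not_0_INR.
move: c0 d0 l0; generalize (INR (n.+1 ^_ l.+1)) (INR (n - l)`!) (INR l.+1) => a b c a0 b0 c0.
by field.
Qed.

Lemma hfix_one th m k n l i : l < m -> l.+1 * i <= n -> k l.+1 = i ->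
  hfix th m k n =
  Rmult (Rdiv (pow (Rdiv (th l.+1) (INR l.+1)) i) (INR i`!))
    (hfix th m (fun j => if j == l.+1 then 0 else k j) (n - l.+1 * i)).
Proof.
move=> lm; elim: i k n => [|i IHi] k n ln ki.
  rewrite muln0 subn0 /= /Rdiv Rinv_1 !Rmult_1_l; apply: hfix_ext => j _.
  by case: eqP => // ->.
have ln1 : l < n by apply: leq_trans ln; rewrite leq_pmulr.
case: (hfix_step th k lm ln1); last by rewrite ki.
rewrite ki (IHi _ (n - l.+1)); first last.
- by rewrite eqxx ki subn1.
- by rewrite leq_subRL // -mulnS.
rewrite -subnDA -mulnS factS mult_INR (@hfix_ext _ _ (fun j => if j == l.+1 then 0 else k j - (j == l.+1))
  (fun j => if j == l.+1 then 0 else k j)).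
  have i0 : INR i.+1 <> R0 by apply: not_0_INR.
  have f0 : INR i`! <> R0 by apply: not_0_INR; apply/eqP; rewrite -lt0n fact_gt0.
  move: i0 f0; rewrite -tech_pow_Rmult; generalize (INR i.+1) (INR i`!) (Rdiv (th l.+1) (INR l.+1)) => c d x c0 d0 e.
  by apply: (Rmult_eq_reg_l _ _ _ _ c0); rewrite e; field.
by move=> j _; case: eqP => // _; rewrite subn0.
Qed.

Lemma hfix_full th m k n : \sum_(1 <= j < m.+1) j * k j <= n ->
  hfix th m k n =
  Rmult (\big[Rmult/R1]_(1 <= j < m.+1) Rdiv (pow (Rdiv (th j) (INR j)) (k j)) (INR (k j)`!))
    (hn (fun j => if j <= m then R0 else th j) (n - \sum_(1 <= j < m.+1) j * k j)).
Proof.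
(* Induction on i, the largest length whose prescribed count is still kept; lengths from i + 1 to m
   are forbidden, and i = 0 is [hfix0]. *)
pose kt i j := if j <= i then k j else 0.
suff H i : i <= m -> \sum_(1 <= j < i.+1) j * k j <= n -> hfix th m (kt i) n =
  Rmult (\big[Rmult/R1]_(1 <= j < i.+1) Rdiv (pow (Rdiv (th j) (INR j)) (k j)) (INR (k j)`!))
    (hn (fun j => if j <= m then R0 else th j) (n - \sum_(1 <= j < i.+1) j * k j)).
  by move=> /(H _ (leqnn m)) <-; apply: hfix_ext => j /andP[_ jm]; rewrite /kt jm.
elim: i n => [|i IHi] n im sn.
  rewrite !big_nil subn0 Rmult_1_l -hfix0; apply: hfix_ext => j.
  by rewrite /kt; case: j.
move: sn; rewrite [in X in X -> _]big_nat_recr //= => sn.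
rewrite (@hfix_one _ _ _ _ i (k i.+1)) //; last by rewrite /kt leqnn.
  rewrite (@hfix_ext _ _ _ (kt i)) => [|j _]; last first.
    by rewrite /kt (leq_eqVlt j) ltnS; case: eqP => // ->; rewrite ltnn.
  rewrite IHi ?(ltnW im) //; last first.
    by rewrite leq_subRL 1?addnC //; apply: leq_trans sn; rewrite leq_addl.
  rewrite [in RHS]big_nat_recr // [in X in hn _ (n - X)]big_nat_recr //= subnDA subnAC.
  by ring.
by apply: leq_trans sn; rewrite leq_addl.
Qed.

(** * The Gamma function *)

Local Open Scope R_scope.

Lemma INR_S_gt0 n : 0 < INR n.+1.
Proof. exact/lt_0_INR/ltP. Qed.

Lemma INR_gt0 n : (0 < n)%N -> 0 < INR n.
Proof. by case: n => // n _; apply: INR_S_gt0. Qed.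

Lemma INR_fact_gt0 n : 0 < INR n`!.
Proof. exact/INR_gt0/fact_gt0. Qed.

Lemma leq_INR m n : (m <= n)%N -> INR m <= INR n.
Proof. by move=> /leP; apply: le_INR. Qed.

Lemma exp_le x y : x <= y -> exp x <= exp y.
Proof. by case=> [/exp_increasing|->]; [left|right]. Qed.

Lemma ln_le_sub1 y : 0 < y -> ln y <= y - 1.
Proof. by move=> y0; have := exp_ineq1_le (ln y); rewrite exp_ln //; lra. Qed.

Lemma ln_ge_1sub y : 0 < y -> 1 - / y <= ln y.
Proof.
move=> y0; have := ln_le_sub1 (Rinv_0_lt_compat _ y0); rewrite ln_Rinv //; lra.
Qed.

(* [risp x m = Gamma(x + m + 1) / (m! Gamma(x + 1))], the coefficient of [z^m] in [(1 - z)^(-x-1)] *)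
Definition risp (x : R) (m : nat) : R := \big[Rmult/R1]_(k < m) (1 + x / INR k.+1).

Lemma risp0 x : risp x 0 = 1.
Proof. by rewrite /risp big_ord0. Qed.

Lemma rispS x m : risp x m.+1 = risp x m * (1 + x / INR m.+1).
Proof. by rewrite /risp big_ord_recr. Qed.

Lemma risp_gt0 x m : -1 < x -> 0 < risp x m.
Proof.
move=> x0; elim: m => [|m IHm]; first by rewrite risp0; lra.
rewrite rispS; apply: Rmult_lt_0_compat => //.
have m0 := INR_S_gt0 m; have m1 : 1 <= INR m.+1 by rewrite S_INR; have := pos_INR m; lra.
have -> : 1 + x / INR m.+1 = (INR m.+1 + x) / INR m.+1 by field; lra.
by apply: Rdiv_lt_0_compat; lra.
Qed.

Lemma gauss_seq_risp x m : 0 < x -> gauss_seq x m = Rpower (INR m) x / risp x m / x.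
Proof.
move=> x0; rewrite /gauss_seq.
have -> : \big[Rmult/R1]_(0 <= k < m.+1) (x + INR k) = x * (INR m`! * risp x m).
  elim: m => [|m IHm].
    by rewrite big_nat1 risp0 fact0 INR_1; change (INR 0) with 0; ring.
  rewrite big_nat_recr //= IHm rispS factS mult_INR; have := INR_S_gt0 m.
  by move=> m0; field; lra.
have r0 : 0 < risp x m by apply: risp_gt0; lra.
have f0 := INR_fact_gt0 m.
by field; lra.
Qed.

Section Growth.
Variables (x : R) (x0 : 0 < x).
Let A m := Rpower (INR m) x / risp x m.

Let r_gt0 m : 0 < risp x m. Proof. by apply: risp_gt0; lra. Qed.

(** The new factor satisfies ln (1 + x / (m+2)) <= x / (m+2) <= x (ln (m+2) - ln (m+1)). The index
    starts at 1 because [Rpower] at base 0 takes the value 1. *)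
Lemma growth_incr m : A m.+1 <= A m.+2.
Proof.
have m1 := INR_S_gt0 m; have m2 := INR_S_gt0 m.+1.
rewrite /A (rispS _ m.+1); set u := x / _.
have u0 : 0 < u by apply: Rdiv_lt_0_compat.
have r0 := r_gt0 m.+1.
apply: (Rmult_le_reg_r (risp x m.+1 * (1 + u))); first by apply: Rmult_lt_0_compat; lra.
have -> : Rpower (INR m.+1) x / risp x m.+1 * (risp x m.+1 * (1 + u)) =
   Rpower (INR m.+1) x * (1 + u) by field; lra.
have -> : Rpower (INR m.+2) x / (risp x m.+1 * (1 + u)) * (risp x m.+1 * (1 + u)) =
   Rpower (INR m.+2) x by field; lra.
rewrite /Rpower -[1 + u]exp_ln; last by lra.
rewrite -exp_plus; apply: exp_le.
have h1 : ln (1 + u) <= u by have := @ln_le_sub1 (1 + u); lra.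
have h2 : / INR m.+2 <= ln (INR m.+2) - ln (INR m.+1).
  rewrite -ln_div //; have := @ln_ge_1sub (INR m.+2 / INR m.+1) (Rdiv_lt_0_compat _ _ m2 m1).
  suff -> : 1 - / (INR m.+2 / INR m.+1) = / INR m.+2 by [].
  by move: m1 m2; rewrite (S_INR m.+1) => m1 m2; field; lra.
have : x * / INR m.+2 <= x * (ln (INR m.+2) - ln (INR m.+1)).
  by apply: Rmult_le_compat_l => //; lra.
by rewrite -/(x / _) -/u; lra.
Qed.

Lemma growth_bound m : A m.+1 <= Rpower (x + 1) x.
Proof.
(* The shift by x + 1 makes the induction close: with u = x / (k+1), the lower bound 1 - 1 / (1+u)
   of ln (1+u) is exactly x / (k + x + 1). *)
have H k : Rpower (INR k + (x + 1)) x <= Rpower (x + 1) x * risp x k.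
  elim: k => [|k IHk]; first by rewrite risp0 /= Rplus_0_l Rmult_1_r; right.
  have k1 := INR_S_gt0 k; have k0 := pos_INR k.
  rewrite rispS -Rmult_assoc; set u := x / _.
  have u0 : 0 < u by apply: Rdiv_lt_0_compat.
  apply: (Rle_trans _ (Rpower (INR k + (x + 1)) x * (1 + u))); last first.
    by apply: Rmult_le_compat_r => //; lra.
  rewrite /Rpower -[1 + u]exp_ln; last by lra.
  rewrite -exp_plus; apply: exp_le.
  set y := INR k + (x + 1); have y0 : 0 < y by rewrite /y; lra.
  have -> : INR k.+1 + (x + 1) = y + 1 by rewrite S_INR /y; ring.
  have h1 : x / y <= ln (1 + u).
    have := @ln_ge_1sub (1 + u); suff -> : 1 - / (1 + u) = x / y by apply; lra.
    by rewrite /u /y; move: k1; rewrite S_INR => k1; field; lra.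
  have h2 : ln (y + 1) - ln y <= / y.
    rewrite -ln_div; try lra; have := @ln_le_sub1 ((y + 1) / y).
    suff -> : (y + 1) / y - 1 = / y by apply; apply: Rdiv_lt_0_compat; lra.
    by field; lra.
  have : x * (ln (y + 1) - ln y) <= x * / y by apply: Rmult_le_compat_l => //; lra.
  by rewrite -/(x / _); lra.
rewrite /A; apply: (Rmult_le_reg_r (risp x m.+1)) => //.
have -> : Rpower (INR m.+1) x / risp x m.+1 * risp x m.+1 = Rpower (INR m.+1) x.
  by field; have := r_gt0 m.+1; lra.
apply: Rle_trans (H _); apply: Rle_Rpower_l; first by lra.
by have := INR_S_gt0 m; lra.
Qed.

Lemma Gamma_lim : is_lim_seq (gauss_seq x) (Gamma x).
Proof.
have [l Hl] : ex_finite_lim_seq (fun m => A m.+1).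
  by apply: (ex_finite_lim_seq_incr _ (Rpower (x + 1) x)); [exact: growth_incr|exact: growth_bound].
apply/is_lim_seq_Reals; rewrite /Gamma; apply: epsilon_spec; exists (l / x).
apply/is_lim_seq_Reals/is_lim_seq_incr_1.
apply: (is_lim_seq_ext (fun m => A m.+1 * / x)).
  by move=> m; rewrite gauss_seq_risp.
exact: (is_lim_seq_scal_r _ (/ x) l).
Qed.

Lemma growth_lim : is_lim_seq A (x * Gamma x).
Proof.
apply: (is_lim_seq_ext (fun m => x * gauss_seq x m)).
  by move=> m; rewrite gauss_seq_risp // /A; field; split; have := r_gt0 m; lra.
exact: (is_lim_seq_scal_l _ x (Gamma x) Gamma_lim).
Qed.

Lemma growth_le m : A m.+1 <= x * Gamma x.
Proof.
apply: (is_lim_seq_incr_compare (fun m => A m.+1)); last exact: growth_incr.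
exact: (proj1 (is_lim_seq_incr_1 _ _) growth_lim).
Qed.

Lemma Gamma_gt0 : 0 < Gamma x.
Proof.
apply: (Rmult_lt_reg_l x) => //; rewrite Rmult_0_r; apply: Rlt_le_trans (growth_le 0).
by apply: Rdiv_lt_0_compat => //; apply: exp_pos.
Qed.

End Growth.

(** The Gauss sequences at x + 1 and at x have quotient x m / (x + 1 + m), which tends to x;
    uniqueness of limits concludes. *)
Lemma Gamma_succ x : 0 < x -> Gamma (x + 1) = x * Gamma x.
Proof.
move=> x0; have x1 : 0 < x + 1 by lra.
have H := Gamma_lim x1.
have K : is_lim_seq (gauss_seq (x + 1)) (x * Gamma x * 1).
  apply/is_lim_seq_incr_1.
  apply: (is_lim_seq_ext (fun m => (Rpower (INR m.+1) x / risp x m.+1) *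
                                   (1 - (x + 1) * / (x + 1 + INR m.+1)))).
    move=> m; rewrite gauss_seq_risp // Rpower_plus Rpower_1; last exact: INR_S_gt0.
    have e k : risp (x + 1) k * (x + 1) = risp x k * (x + 1 + INR k).
      elim: k => [|k IHk]; first by rewrite !risp0; change (INR 0) with 0; ring.
      rewrite !rispS; have := INR_S_gt0 k => k0.
      have -> : risp (x + 1) k * (1 + (x + 1) / INR k.+1) * (x + 1) =
        (risp (x + 1) k * (x + 1)) * (1 + (x + 1) / INR k.+1) by ring.
      by rewrite IHk; move: k0; rewrite S_INR => k0; field; lra.
    have m0 := INR_S_gt0 m.
    have r0 : 0 < risp x m.+1 by apply: risp_gt0; lra.
    have r1 : 0 < risp (x + 1) m.+1 by apply: risp_gt0; lra.
    have -> : Rpower (INR m.+1) x * INR m.+1 / risp (x + 1) m.+1 / (x + 1) =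
      Rpower (INR m.+1) x * INR m.+1 / (risp (x + 1) m.+1 * (x + 1)) by field; lra.
    by rewrite e; field; lra.
  have L1 : is_lim_seq (fun m => Rpower (INR m.+1) x / risp x m.+1) (x * Gamma x).
    exact: (proj1 (is_lim_seq_incr_1 _ _) (growth_lim x0)).
  apply: (is_lim_seq_mult' _ _ _ _ L1).
  suff : is_lim_seq (fun m => 1 - (x + 1) * / (x + 1 + INR m.+1)) (1 - (x + 1) * 0).
    by rewrite Rmult_0_r Rminus_0_r.
  apply: is_lim_seq_minus'; first exact: is_lim_seq_const.
  apply: (is_lim_seq_scal_l _ (x + 1) 0).
  apply: (is_lim_seq_inv _ p_infty) => //.
  apply: (is_lim_seq_le_p_loc INR); last exact: is_lim_seq_INR.
  by exists 0%N => m _; rewrite S_INR; lra.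
have e := is_lim_seq_unique _ _ H; have := is_lim_seq_unique _ _ K.
by rewrite e => -[->]; rewrite Rmult_1_r.
Qed.

Lemma Gamma_add_nat x n : 0 < x -> Gamma (x + INR n) = Gamma x * (INR n`! * risp (x - 1) n).
Proof.
move=> x0; elim: n => [|n IHn].
  by rewrite risp0 fact0 INR_1; change (INR 0) with 0; rewrite Rplus_0_r; ring.
rewrite {1}S_INR -Rplus_assoc Gamma_succ; last by have := pos_INR n; lra.
rewrite IHn rispS factS mult_INR; have n0 := INR_S_gt0 n; move: n0; rewrite S_INR => n0.
by field; lra.
Qed.

(** The weights become binomial coefficients. At n = 0 this gives the constant term Gamma (g + 1) of
    the closed form, which has to be subtracted when only cycle lengths n >= 1 are summed. *)
Lemma theta_risp g n : 0 < g -> theta g n = Gamma (g + 1) * risp g n.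
Proof.
move=> g0; rewrite /theta.
have -> : INR n + g + 1 = (g + 1) + INR n by ring.
rewrite Gamma_add_nat; last by lra.
have -> : g + 1 - 1 = g by ring.
by have f0 := INR_fact_gt0 n; field; lra.
Qed.

(** The sequence n^g / [risp g n] increases to its limit g Gamma(g), so the asymptotic equivalent of
    theta is also a lower bound, without any loss in the constant. *)
Lemma theta_ge g n : 0 < g -> Rpower (INR n.+1) g <= theta g n.+1.
Proof.
move=> g0; rewrite theta_risp // Gamma_succ //.
have r0 : 0 < risp g n.+1 by apply: risp_gt0; lra.
apply: (Rmult_le_reg_r (/ risp g n.+1)); first exact: Rinv_0_lt_compat.
by rewrite Rmult_assoc Rinv_r ?Rmult_1_r; [exact: growth_le|lra].
Qed.

Lemma theta_equiv g : 0 < g -> is_lim_seq (fun n => theta g n / Rpower (INR n) g) 1.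
Proof.
move=> g0; have G0 := Gamma_gt0 g0.
have gG : 0 < g * Gamma g by apply: Rmult_lt_0_compat.
rewrite -(Rinv_r (g * Gamma g)); last by lra.
apply: (is_lim_seq_ext (fun n => (g * Gamma g) * / (Rpower (INR n) g / risp g n))).
  move=> n; rewrite theta_risp // Gamma_succ //.
  have r0 : 0 < risp g n by apply: risp_gt0; lra.
  have p0 : 0 < Rpower (INR n) g by apply: exp_pos.
  by field; lra.
apply: (is_lim_seq_scal_l _ (g * Gamma g) (Finite (/ (g * Gamma g)))).
apply: (is_lim_seq_inv _ (Finite (g * Gamma g))); first exact: growth_lim.
by case; lra.
Qed.

(** * Exponential recursions *)

Lemma sumR_le (I : Type) (r : seq I) (P : pred I) (F G : I -> R) :
  (forall i, P i -> F i <= G i) ->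
  \big[Rplus/R0]_(i <- r | P i) F i <= \big[Rplus/R0]_(i <- r | P i) G i.
Proof.
move=> FG; apply: (big_ind2 (fun x y => x <= y)) => //; first exact: Rle_refl.
by move=> x1 x2 y1 y2; apply: Rplus_le_compat.
Qed.

Lemma sumR_ge0 (I : Type) (r : seq I) (P : pred I) (F : I -> R) :
  (forall i, P i -> 0 <= F i) -> 0 <= \big[Rplus/R0]_(i <- r | P i) F i.
Proof.
move=> F0; apply: (big_ind (fun x => 0 <= x)) => //; first exact: Rle_refl.
by move=> x y; apply: Rplus_le_le_0_compat.
Qed.

(** [h] is the coefficient sequence of H(z) = exp (sum_j th_j z^j / j), encoded by comparing
    coefficients in z H'(z) = (sum_j th_j z^j) H(z). *)
Definition is_rec (th h : nat -> R) : Prop :=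
  h 0%N = 1 /\
  forall n, INR n.+1 * h n.+1 = \big[Rplus/R0]_(l < n.+1) (th l.+1 * h (n - l)%N).

Lemma is_rec_ext th th' h : (forall l, th l.+1 = th' l.+1) -> is_rec th h -> is_rec th' h.
Proof.
by move=> e [h0 hS]; split=> // n; rewrite hS; apply: eq_bigr => l _; rewrite e.
Qed.

Lemma is_rec_unique th h h' : is_rec th h -> is_rec th h' -> h =1 h'.
Proof.
move=> [h0 hS] [h0' hS'] n; elim/ltn_ind: n => -[|n] IH; first by rewrite h0 h0'.
apply: (Rmult_eq_reg_l (INR n.+1)); last by have := INR_S_gt0 n; lra.
by rewrite hS hS'; apply: eq_bigr => l _; rewrite IH // ltnS leq_subr.
Qed.

Lemma is_rec_ge0 th h : (forall l, 0 <= th l.+1) -> is_rec th h -> forall n, 0 <= h n.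
Proof.
move=> t0 [h0 hS] n; elim/ltn_ind: n => -[|n] IH; first by rewrite h0; lra.
apply: (Rmult_le_reg_l (INR n.+1)); first exact: INR_S_gt0.
rewrite hS Rmult_0_r; apply: sumR_ge0 => l _; apply: Rmult_le_pos => //.
by apply: IH; rewrite ltnS leq_subr.
Qed.

Lemma is_rec_gt0 th h : (forall l, 0 <= th l.+1) -> 0 < th 1%N ->
  is_rec th h -> forall n, 0 < h n.
Proof.
move=> t0 t1 hr n; have [h0 hS] := hr; elim: n => [|n IHn]; first by rewrite h0; lra.
apply: (Rmult_lt_reg_l (INR n.+1)); first exact: INR_S_gt0.
rewrite hS Rmult_0_r big_ord_recl /= subn0; apply: Rplus_lt_le_0_compat.
  exact: Rmult_lt_0_compat.
apply: sumR_ge0 => l _; apply: Rmult_le_pos; first exact: t0.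
exact: (is_rec_ge0 t0 hr).
Qed.

Section LogConcavity.

(** The bound M is there for the strong induction in [rec_log_concave], where log-concavity is known
    only below the current index. *)
Lemma log_concave_ratio (f : nat -> R) M : (forall n, 0 < f n) ->
  (forall n, (n < M)%N -> f n * f n.+2 <= f n.+1 * f n.+1) ->
  forall j k, (j <= k)%N -> (k <= M)%N -> f j * f k.+1 <= f j.+1 * f k.
Proof.
move=> f0 lc j k jk; rewrite -(subnKC jk); elim: (k - j)%N => [|d IH] dM.
  by rewrite addn0; right; ring.
have dM' : (j + d < M)%N by rewrite -addnS.
have h1 := IH (ltnW dM'); have h2 := lc _ dM'; rewrite !addnS in h1 h2 *.
apply: (Rmult_le_reg_r (f (j + d)%N)) => //.
have := Rmult_le_compat_l _ _ _ (Rlt_le _ _ (f0 j)) h2.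
have := Rmult_le_compat_r _ _ _ (Rlt_le _ _ (f0 (j + d).+1)) h1.
by lra.
Qed.

(** Twice the difference of the two sides is the double sum of the products of the 2 by 2 minors of
    (u, v) and (p, q), as in the Cauchy-Binet formula. *)
Lemma Chebyshev_sum m (u v p q : 'I_m -> R) :
  (forall j k, 0 <= (u j * v k - v j * u k) * (p j * q k - p k * q j)) ->
  (\big[Rplus/R0]_j (v j * p j)) * (\big[Rplus/R0]_j (u j * q j)) <=
  (\big[Rplus/R0]_j (u j * p j)) * (\big[Rplus/R0]_j (v j * q j)).
Proof.
move=> H.
pose D j k := (u j * p j) * (v k * q k) - (v j * p j) * (u k * q k).
have E1 : (\big[Rplus/R0]_j (u j * p j)) * (\big[Rplus/R0]_j (v j * q j)) =
  (\big[Rplus/R0]_j (v j * p j)) * (\big[Rplus/R0]_j (u j * q j)) +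
  \big[Rplus/R0]_j \big[Rplus/R0]_k D j k.
  rewrite !big_distrl -big_split; apply: eq_bigr => j _ /=.
  rewrite !big_distrr -big_split; apply: eq_bigr => k _ /=; rewrite /D; ring.
suff : 0 <= \big[Rplus/R0]_j \big[Rplus/R0]_k D j k by lra.
have E2 : \big[Rplus/R0]_j \big[Rplus/R0]_k D j k +
   \big[Rplus/R0]_j \big[Rplus/R0]_k D j k =
  \big[Rplus/R0]_j \big[Rplus/R0]_k ((u j * v k - v j * u k) * (p j * q k - p k * q j)).
  rewrite [X in _ + X]exchange_big -big_split; apply: eq_bigr => j _.
  rewrite -big_split; apply: eq_bigr => k _; rewrite /D /=; ring.
have : 0 <= \big[Rplus/R0]_j \big[Rplus/R0]_k
    ((u j * v k - v j * u k) * (p j * q k - p k * q j)).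
  by do 2!apply: sumR_ge0 => ? _.
by rewrite -E2; lra.
Qed.

Variables (t b : nat -> R).
Hypothesis t_gt0 : forall l, 0 < t l.+1.
Hypothesis t_lc0 : t 2%N <= t 1%N * t 1%N.
Hypothesis t_lc : forall l, t l.+1 * t l.+3 <= t l.+2 * t l.+2.
Hypothesis bt : is_rec t b.

Let b_gt0 n : 0 < b n.
Proof. by apply: (is_rec_gt0 _ (t_gt0 0) bt) => l; left. Qed.

Let t_ratio j k : (j <= k)%N -> t j.+1 * t k.+2 <= t j.+2 * t k.+1.
Proof.
move=> jk; apply: (@log_concave_ratio (fun j => t j.+1) k) => // n _; exact: t_lc.
Qed.

(** In the recursions for three consecutive indices, the terms with t_1 are split off; the remaining
    sums are compared by [Chebyshev_sum], where the minors of t have a sign by hypothesis and those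
    of b by induction. *)
Lemma rec_log_concave n : b n * b n.+2 <= b n.+1 * b n.+1.
Proof.
have [b0 bS] := bt; elim/ltn_ind: n => n IH.
have e2 : INR n.+2 * b n.+2 = t 1%N * b n.+1 +
    \big[Rplus/R0]_(l < n.+1) (t l.+2 * b (n - l)%N).
  by rewrite bS big_ord_recl /=.
have e1 : INR n.+1 * b n.+1 = t 1%N * b n + \big[Rplus/R0]_(l < n) (t l.+2 * b (n - l.+1)%N).
  by rewrite bS big_ord_recl /= subn0.
case: n => [|n] in IH e1 e2 *.
  move: e2 e1; rewrite big_ord_recl !big_ord0 /= b0 -[INR 2]/2 -[INR 1]/1.
  by move: t_lc0; set T1 := t 1%N; set T2 := t 2%N => ?; nra.
have n1 := INR_S_gt0 n.
set S := \big[Rplus/R0]_(l < n.+2) _ in e2; set S' := \big[Rplus/R0]_(l < n.+1) _ in e1.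
(* Termwise t_(l+2) <= t_1 t_(l+1), which is log-concavity started from the value 1 at index 0. It
   yields [ble] below. *)
have S'le : S' <= t 1%N * (INR n.+1 * b n.+1).
  rewrite /S' bS big_distrr /=; apply: sumR_le => l _; rewrite subSS.
  rewrite -Rmult_assoc; apply: Rmult_le_compat_r; first by left.
  case: (l : nat) => [|k]; first exact: t_lc0.
  have := t_ratio (leq0n k) => h.
  apply: (Rmult_le_reg_l (t 1%N)) => //.
  apply: (Rle_trans _ (t 2%N * t k.+2)); first exact: (t_ratio (leq0n k.+1)).
  rewrite -Rmult_assoc; apply: Rmult_le_compat_r => //; by left.
have C : S * (INR n.+1 * b n.+1) <= (INR n.+2 * b n.+2) * S'.
  (* Putting b = 0 at index -1 gives all four sums the same range and respects log-concavity. *)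
  pose q (l : 'I_n.+2) := if (l <= n)%N then b (n - l)%N else 0.
  have Eq w : \big[Rplus/R0]_(l < n.+1) (w l.+1 * b (n - l)%N) =
      \big[Rplus/R0]_(l < n.+2) (w l.+1 * q l).
    rewrite [RHS]big_ord_recr /= /q /= ltnn Rmult_0_r Rplus_0_r.
    by apply: eq_bigr => l _ /=; rewrite -ltnS ltn_ord.
  rewrite [INR n.+1 * _]bS [INR n.+2 * _]bS /S.
  have -> : S' = \big[Rplus/R0]_(l < n.+1) (t l.+2 * b (n - l)%N).
    by apply: eq_bigr => l _; rewrite subSS.
  rewrite (Eq (fun l => t l)) (Eq (fun l => t l.+1)).
  apply: (@Chebyshev_sum _ (fun l => t l.+1) (fun l => t l.+2)
                           (fun l => b (n.+1 - l)%N) q).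
  have qb (j k : 'I_n.+2) : (j <= k)%N ->
      b (n.+1 - j)%N * q k - b (n.+1 - k)%N * q j <= 0.
    move=> jk; rewrite /q; case: (leqP k n) => kn; last first.
      have -> : (n.+1 - k = 0)%N by apply/eqP; rewrite subn_eq0.
      case: leqP => _; last by lra.
      by have := Rmult_lt_0_compat _ _ (b_gt0 0) (b_gt0 (n - j)%N); lra.
    rewrite (leq_trans jk kn) !subSn // ?(leq_trans jk kn) //.
    have := @log_concave_ratio b n b_gt0 _ (n - k)%N (n - j)%N (leq_sub2l n jk) (leq_subr j n).
    move=> H; suff : b (n - k)%N * b (n - j).+1 <= b (n - k).+1 * b (n - j)%N by lra.
    by apply: H => i ii; apply: IH; rewrite ltnS ltnW.
  move=> j k; case: (leqP j k) => jk.
    by have := t_ratio jk; have := qb _ _ jk; nra.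
  by have := t_ratio (ltnW jk); have := qb _ _ (ltnW jk); nra.
have ble : b n.+2 <= t 1%N * b n.+1.
  apply: (Rmult_le_reg_l (INR n.+2)); first exact: INR_S_gt0.
  by rewrite e1 (S_INR n.+1); lra.
have p1 := b_gt0 n.+1; have p2 := b_gt0 n.+2; have p3 := b_gt0 n.+3.
have n2 := INR_S_gt0 n.+1.
(* With [m = n + 1]: [e1], [e2] and [C] give
   [m (m+2) b_m b_(m+2) <= (m+1)^2 b_(m+1)^2 - t_1 b_m b_(m+1)]. *)
apply: (Rmult_le_reg_l (INR n.+1 * INR n.+3)).
  by apply: Rmult_lt_0_compat => //; exact: INR_S_gt0.
have -> : INR n.+1 * INR n.+3 * (b n.+1 * b n.+3) =
   (INR n.+1 * b n.+1) * (INR n.+3 * b n.+3) by ring.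
rewrite e2.
have eS' : S' = INR n.+2 * b n.+2 - t 1%N * b n.+1 by lra.
rewrite eS' in C.
(* The subtracted term is at least b_(m+1)^2, and (m+1)^2 - 1 = m (m+2). *)
have := Rmult_le_compat_r _ _ _ (Rlt_le _ _ p2) ble.
move: C n1; rewrite (S_INR n.+2) (S_INR n.+1); set N := INR n.+1 => C n1 h.
by nra.
Qed.

End LogConcavity.

Section Perturbation.
Variables (th h : nat -> R) (p : nat) (y : R).
Hypothesis ht : is_rec th h.
Let x := y / INR p.+1.
Let e i := pow x i / INR i`!.

(** The Cauchy product of [h] with exp (y z^(p+1) / (p+1)); the test extends [h] by 0 to negative
    indices. *)
Definition perturb n := \big[Rplus/R0]_(i < n.+1) 
  (e i * (if (p.+1 * i <= n)%N then h (n - p.+1 * i)%N else 0)).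

Let ext n k := if (k <= n)%N then h (n - k)%N else 0.

Let perturbE n N : (n <= N)%N ->
  perturb n = \big[Rplus/R0]_(i < N.+1) (e i * ext n (p.+1 * i)).
Proof.
move=> nN; rewrite [LHS](big_ord_widen N.+1 (fun i => e i * ext n (p.+1 * i))) //.
rewrite big_mkcond; apply: eq_bigr => i _; case: ltnP => // ni.
rewrite /ext leqNgt (leq_trans ni) ?Rmult_0_r //.
by rewrite leq_pmull.
Qed.

(** The recursion for [h] at n - k in a form that holds for every k: if k >= n, both sides are zero.
    The common range N allows the sums to be exchanged later. *)
Let ext_rec n k N : (n <= N.+1)%N ->
  (INR n - INR k) * ext n k = \big[Rplus/R0]_(l < N.+1) (th l.+1 * ext n (k + l.+1)).
Proof.
move=> nN; rewrite /ext; case: leqP => kn; last first.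
  rewrite Rmult_0_r big1 // => l _.
  by rewrite leqNgt (leq_trans kn) ?Rmult_0_r // leq_addr.
rewrite -minus_INR; last exact/leP.
rewrite minusE; move dE: (n - k)%N => [|d].
  rewrite [INR 0]/= Rmult_0_l big1 // => l _.
  have /eqP nk := dE; rewrite subn_eq0 in nk.
  by rewrite leqNgt addnS ltnS (leq_trans nk) ?leq_addr // Rmult_0_r.
rewrite (proj2 ht) (big_ord_widen N.+1 (fun l => th l.+1 * h (d - l)%N)); last first.
  by rewrite -dE (leq_trans (leq_subr _ _)).
rewrite big_mkcond; apply: eq_bigr => l _.
have -> : (k + l.+1 <= n)%N = (l < d.+1)%N by rewrite -leq_subRL // dE.
case: ifP => _; last by rewrite Rmult_0_r.
by rewrite subnDA dE subSS.
Qed.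

Let e_rec i : INR (p.+1 * i.+1) * e i.+1 = y * e i.
Proof.
rewrite /e /x mult_INR factS mult_INR -tech_pow_Rmult.
have i0 := INR_S_gt0 i; have f0 := INR_fact_gt0 i; have p0 := INR_S_gt0 p.
by move: i0 f0 p0; generalize (INR i.+1) (INR i`!) (INR p.+1) => a b c a0 b0 c0; field; lra.
Qed.

Lemma perturb_rec : is_rec (fun j => th j + (if j == p.+1 then y else 0)) perturb.
Proof.
split.
  rewrite /perturb big_ord_recl big_ord0 /= muln0 leqnn subn0 (proj1 ht) /e fact0 INR_1 /=.
  by field.
move=> n.
have sumE l : (l <= n)%N -> perturb (n - l) =
    \big[Rplus/R0]_(i < n.+2) (e i * ext n.+1 (l.+1 + p.+1 * i)).
  move=> ln; rewrite (@perturbE _ n.+1) ?(leq_trans (leq_subr _ _)) //.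
  apply: eq_bigr => i _; congr (_ * _); rewrite /ext.
  by rewrite -[(l.+1 + _ <= _)%N]leq_subRL // subSS subnDA subSS.
have -> : \big[Rplus/R0]_(l < n.+1) ((th l.+1 + (if l.+1 == p.+1 then y else 0)) * perturb (n - l)) =
  \big[Rplus/R0]_(l < n.+1) (th l.+1 * perturb (n - l)) +
  y * \big[Rplus/R0]_(i < n.+2) (e i * ext n.+1 (p.+1 + p.+1 * i)).
  under eq_bigr => l _ do rewrite Rmult_plus_distr_r.
  rewrite big_split /=; congr (_ + _); case: (ltnP n p) => np.
    rewrite big1 => [|l _]; last first.
      rewrite eqSS ltn_eqF ?Rmult_0_l //; first by rewrite (leq_trans (ltn_ord l)).
    rewrite big1 ?Rmult_0_r // => i _.
    by rewrite /ext leqNgt ltnS (leq_trans np) ?Rmult_0_r // leq_addr.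
  rewrite -sumE // (bigD1 (Ordinal (np : (p < n.+1)%N))) //= eqxx big1 ?Rplus_0_r // => l lp.
  rewrite eqSS; case: eqP => [lpE|_]; last by rewrite Rmult_0_l.
  by case/eqP: lp; apply: val_inj.
rewrite (@perturbE n.+1 n.+1) // big_distrr /=.
(* Leibniz rule for z d/dz on the product: the degree n + 1 is split into the part from [h], treated
   by its recursion, and the part (p+1) i from the exponential, treated by [e_rec]. *)
have -> : \big[Rplus/R0]_(i < n.+2) (INR n.+1 * (e i * ext n.+1 (p.+1 * i))) =
  \big[Rplus/R0]_(i < n.+2) (e i * ((INR n.+1 - INR (p.+1 * i)) * ext n.+1 (p.+1 * i))) +
  \big[Rplus/R0]_(i < n.+2) (INR (p.+1 * i) * e i * ext n.+1 (p.+1 * i)).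
  by rewrite -big_split; apply: eq_bigr => i _ /=; ring.
congr (_ + _).
  transitivity (\big[Rplus/R0]_(i < n.+2) \big[Rplus/R0]_(l < n.+1)
      (e i * (th l.+1 * ext n.+1 (p.+1 * i + l.+1)))).
    by apply: eq_bigr => i _; rewrite (@ext_rec _ _ n) // big_distrr.
  rewrite exchange_big /=; apply: eq_bigr => l _; rewrite sumE; last by rewrite -ltnS.
  rewrite big_distrr /=; apply: eq_bigr => i _; rewrite addnC; ring.
rewrite big_ord_recl muln0 [INR 0]/= !Rmult_0_l Rplus_0_l.
rewrite [in RHS]big_ord_recr /=.
have -> : ext n.+1 (p.+1 + p.+1 * n.+1) = 0.
  by rewrite /ext leqNgt addSn ltnS (leq_trans _ (leq_addl _ _)) // leq_pmull.
rewrite Rmult_0_r Rplus_0_r.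
rewrite big_distrr /=; apply: eq_bigr => i _.
by rewrite /bump add1n e_rec mulnS; ring.
Qed.

End Perturbation.

(** * Limits of perturbed sequences *)

Lemma lim_seqP (u : nat -> R) (l : R) :
  is_lim_seq u l <->
  forall e, 0 < e -> exists N, forall n, (N <= n)%N -> Rabs (u n - l) < e.
Proof.
split.
  move=> /is_lim_seq_spec H e e0; have [N HN] := H (mkposreal e e0).
  by exists N => n /leP; apply: HN.
move=> H; apply/is_lim_seq_spec => -[e e0]; have [N HN] := H e e0.
by exists N => n /leP; apply: HN.
Qed.

Lemma lim_seq_eq (u : nat -> R) (l l' : R) : l = l' -> is_lim_seq u l -> is_lim_seq u l'.
Proof. by move=> ->. Qed.

Lemma lim_seq_shift (u v : nat -> R) k (l : R) : is_lim_seq u l ->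
  (forall n, v (n + k)%N = u n) -> is_lim_seq v l.
Proof.
by move=> ul uv; apply/(is_lim_seq_incr_n v k); apply: is_lim_seq_ext ul => n; rewrite -uv.
Qed.

Lemma lim_seq_bounded (u : nat -> R) (l : R) : is_lim_seq u l ->
  exists2 K, 0 < K & forall n, Rabs (u n) <= K.
Proof.
move=> /is_lim_seq_Reals ul; have [K [K0 HK]] := maj_by_pos u (exist _ l ul).
by exists K.
Qed.

Lemma lim_sumR m (u : nat -> nat -> R) (l : nat -> R) :
  (forall i, (i < m)%N -> is_lim_seq (fun n => u n i) (l i)) ->
  is_lim_seq (fun n => \big[Rplus/R0]_(i < m) u n i) (\big[Rplus/R0]_(i < m) l i).
Proof.
elim: m => [|m IHm] H.
  rewrite big_ord0; apply: (is_lim_seq_ext (fun=> 0)); last exact: is_lim_seq_const.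
  by move=> n; rewrite big_ord0.
rewrite big_ord_recr /=.
apply: (is_lim_seq_ext (fun n => \big[Rplus/R0]_(i < m) u n i + u n m)).
  by move=> n; rewrite big_ord_recr.
apply: is_lim_seq_plus'; last exact: H.
by apply: IHm => i im; apply: H; apply: ltnW.
Qed.

Lemma Rabs_sumR (I : Type) (r : seq I) (P : pred I) (F : I -> R) :
  Rabs (\big[Rplus/R0]_(i <- r | P i) F i) <= \big[Rplus/R0]_(i <- r | P i) Rabs (F i).
Proof.
apply: (big_ind2 (fun x y => Rabs x <= y)) => [|x1 x2 y1 y2 h1 h2|i _].
- by rewrite Rabs_R0; right.
- by apply: Rle_trans (Rabs_triang _ _) _; lra.
- by right.
Qed.

(** Dominated convergence for sums: beyond a fixed index the absolute series is small and the
    weights are bounded; before it only finitely many weights have to be close to L. *)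
Lemma Tannery (a : nat -> R) (w : nat -> nat -> R) (A B K L : R) :
  is_lim_seq (fun n => \big[Rplus/R0]_(i < n) Rabs (a i)) A ->
  is_lim_seq (fun n => \big[Rplus/R0]_(i < n) a i) B ->
  (forall n i, Rabs (w n i) <= K) ->
  (forall i, is_lim_seq (fun n => w n i) L) ->
  is_lim_seq (fun n => \big[Rplus/R0]_(i < n.+1) (a i * w n i)) (B * L).
Proof.
move=> HA HB wK wL.
have K0 : 0 <= K by apply: Rle_trans (wK 0%N 0%N); apply: Rabs_pos.
set D := K + Rabs L + 1; have D0 : 0 < D by rewrite /D; have := Rabs_pos L; lra.
have main : is_lim_seq (fun n => \big[Rplus/R0]_(i < n.+1) (a i * (w n i - L))) 0.
  apply/lim_seqP => e e0.
  (* The tail of the absolute series is a difference of two partial sums, each this close to A, so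
     it contributes at most 2 (e / 4 / D) D = e / 2. *)
  have e2 : 0 < e / 4 / D by do 2!apply: Rdiv_lt_0_compat => //; lra.
  have [I HI] := proj1 (lim_seqP _ _) HA _ e2.
  have F0 : is_lim_seq (fun n => \big[Rplus/R0]_(i < I) (Rabs (a i) * Rabs (w n i - L))) 0.
    have -> : 0 = \big[Rplus/R0]_(i < I) 0 by rewrite big1.
    apply: (@lim_sumR I (fun n i => Rabs (a i) * Rabs (w n i - L)) (fun=> 0)) => i _.
    rewrite -(Rmult_0_r (Rabs (a i))); apply: (is_lim_seq_scal_l _ (Rabs (a i)) 0).
    rewrite -(Rabs_R0); apply: (is_lim_seq_abs _ 0).
    rewrite -(Rminus_diag L); apply: is_lim_seq_minus'; first exact: wL.
    exact: is_lim_seq_const.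
  have e4 : 0 < e / 4 by lra.
  have [N HN] := proj1 (lim_seqP _ _) F0 _ e4.
  exists (maxn N I) => n; rewrite geq_max => /andP[Nn In].
  rewrite Rminus_0_r; apply: Rle_lt_trans (Rabs_sumR _ _ _) _.
  under eq_bigr => i _ do rewrite Rabs_mult.
  rewrite -(big_mkord predT (fun i => Rabs (a i) * Rabs (w n i - L))).
  rewrite (@big_cat_nat _ _ _ I) //=; last by rewrite (leq_trans In).
  rewrite big_mkord; have := HN n Nn; rewrite Rminus_0_r => h1.
  have h1' := Rle_lt_trans _ _ _ (Rle_abs _) h1.
  suff : \big[Rplus/R0]_(I <= i < n.+1) (Rabs (a i) * Rabs (w n i - L)) <= e / 2 by lra.
  apply: (Rle_trans _ (\big[Rplus/R0]_(I <= i < n.+1) (Rabs (a i) * D))).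
    apply: sumR_le => i _; apply: Rmult_le_compat_l; first exact: Rabs_pos.
    apply: Rle_trans (Rabs_triang _ _) _; rewrite Rabs_Ropp /D.
    by have := wK n i; lra.
  rewrite -big_distrl /=.
  have h2 := HI I (leqnn I).
  have h3 := HI n.+1 (leq_trans In (leqnSn n)).
  have : \big[Rplus/R0]_(I <= i < n.+1) Rabs (a i) <= 2 * (e / 4 / D).
    move: h3 h2; rewrite -!(big_mkord predT (fun i => Rabs (a i))).
    rewrite (@big_cat_nat _ _ _ I 0 n.+1) //=; last by rewrite (leq_trans In).
    by move=> /Rabs_def2[h3 h3'] /Rabs_def2[h2 h2']; lra.
  move=> /(Rmult_le_compat_r D _ _ (Rlt_le _ _ D0)).
  by have -> : 2 * (e / 4 / D) * D = e / 2 by field; lra.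
apply: (is_lim_seq_ext (fun n => \big[Rplus/R0]_(i < n.+1) (a i * (w n i - L)) +
                                 (\big[Rplus/R0]_(i < n.+1) a i) * L)).
  by move=> n; rewrite big_distrl -big_split; apply: eq_bigr => i _ /=; ring.
rewrite -[B * L]Rplus_0_l; apply: is_lim_seq_plus' => //.
apply: (is_lim_seq_scal_r _ L B).
exact: (proj1 (is_lim_seq_incr_1 (fun n => \big[Rplus/R0]_(i < n) a i) B)).
Qed.

Lemma lim_exp_series (x : R) :
  is_lim_seq (fun n => \big[Rplus/R0]_(i < n) (pow x i / INR i`!)) (exp x).
Proof.
apply/is_lim_seq_incr_1.
have fE n : n`! = Factorial.fact n.
  by elim: n => // n IHn; rewrite factS IHn.
apply: (is_lim_seq_ext (sum_n (fun k => scal (pow_n x k) (/ INR (Factorial.fact k))))).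
  elim=> [|n IHn].
    by rewrite sum_O big_ord_recl big_ord0 Rplus_0_r fE pow_n_pow.
  by rewrite sum_Sn IHn [RHS]big_ord_recr /= fE -pow_n_pow.
exact: (is_exp_Reals x).
Qed.

Section PerturbLimit.
Variable b : nat -> R.
Hypothesis b_gt0 : forall n, 0 < b n.
Hypothesis b_incr : forall n, b n <= b n.+1.
Hypothesis b_ratio : is_lim_seq (fun n => b n / b n.+1) 1.

Lemma ratio_shift k : is_lim_seq (fun n => b n / b (n + k)%N) 1.
Proof.
elim: k => [|k IHk].
  apply: (is_lim_seq_ext (fun=> 1)); last exact: is_lim_seq_const.
  by move=> n; rewrite addn0; field; have := b_gt0 n; lra.
rewrite -(Rmult_1_r 1).
apply: (is_lim_seq_ext (fun n => (b n / b (n + k)%N) * (b (n + k)%N / b (n + k).+1))).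
  move=> n; rewrite addnS; field.
  by have := b_gt0 (n + k); have := b_gt0 (n + k).+1; lra.
apply: is_lim_seq_mult' => //.
apply: (is_lim_seq_ext (fun n => (fun m => b m / b m.+1) (n + k)%coq_nat)) => //.
exact: (proj1 (is_lim_seq_incr_n _ k _) b_ratio).
Qed.

(** Tannery's theorem with the exponential series: each weight h_(n - (p+1) i) / b_n tends to L
    because finite shifts of b are asymptotically equal, and the weights are bounded because h / b
    is bounded and b is nondecreasing. *)
Lemma perturb_lim h p y (L : R) : is_lim_seq (fun n => h n / b n) L ->
  is_lim_seq (fun n => perturb h p y n / b n) (exp (y / INR p.+1) * L).
Proof.
move=> hL; have [K K0 HK] := lim_seq_bounded hL.
have b_mono m n : (m <= n)%N -> b m <= b n.
  move=> /subnKC <-; elim: (n - m)%N => [|d IH]; first by rewrite addn0; right.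
  by rewrite addnS; apply: Rle_trans IH _.
pose w n i := (if (p.+1 * i <= n)%N then h (n - p.+1 * i)%N else 0) / b n.
apply: (is_lim_seq_ext (fun n => \big[Rplus/R0]_(i < n.+1)
    (pow (y / INR p.+1) i / INR i`! * w n i))).
  by move=> n; rewrite /perturb /Rdiv big_distrl; apply: eq_bigr => i _ /=; rewrite /w /Rdiv; ring.
apply: (@Tannery (fun i => pow (y / INR p.+1) i / INR i`!) w
  (exp (Rabs (y / INR p.+1))) (exp (y / INR p.+1)) K).
- apply: is_lim_seq_ext (@lim_exp_series (Rabs (y / INR p.+1))) => n.
  apply: eq_bigr => i _.
  rewrite RPow_abs -[pow _ _ / _]/(_ * / _) Rabs_mult (Rabs_pos_eq (/ INR i`!)) //.
  exact/Rlt_le/Rinv_0_lt_compat/INR_fact_gt0.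
- exact: lim_exp_series.
- move=> n i; rewrite /w; case: leqP => _; last first.
    by rewrite /Rdiv Rmult_0_l Rabs_R0; lra.
  set m := (n - _)%N; have bm := b_gt0 m; have bn := b_gt0 n.
  have -> : h m / b n = (h m / b m) * (b m / b n) by field; lra.
  rewrite Rabs_mult (Rabs_pos_eq (b m / b n)); last by left; apply: Rdiv_lt_0_compat.
  rewrite -[K]Rmult_1_r; apply: Rmult_le_compat => //; first exact: Rabs_pos.
    by left; apply: Rdiv_lt_0_compat.
  by apply/Rle_div_l => //; rewrite Rmult_1_l; apply: b_mono; apply: leq_subr.
- move=> i; rewrite -(Rmult_1_r L).
  apply: (@lim_seq_shift (fun n => (h n / b n) * (b n / b (n + p.+1 * i)%N)) _ (p.+1 * i)%N).
    by apply: is_lim_seq_mult' => //; apply: ratio_shift.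
  move=> n; rewrite /w leq_addl addnK; field.
  by have := b_gt0 n; have := b_gt0 (n + p.+1 * i); lra.
Qed.

End PerturbLimit.

Lemma lim_Rpower (u : nat -> R) (l p : R) : 0 < l -> is_lim_seq u l ->
  is_lim_seq (fun n => Rpower (u n) p) (Rpower l p).
Proof.
move=> l0 ul; apply: (is_lim_seq_continuous (fun x => Rpower x p)) => //.
apply/continuity_pt_filterlim; apply: (ex_derive_continuous (fun x => Rpower x p)).
by rewrite /Rpower; auto_derive.
Qed.

Lemma Rpower_gt0 x p : 0 < Rpower x p.
Proof. exact: exp_pos. Qed.

Lemma lim_Rpower_infty p : 0 < p -> is_lim_seq (fun n => Rpower (INR n) p) p_infty.
Proof.
move=> p0; apply/is_lim_seq_spec => M.
have [N HN] := INR_unbounded (Rpower (Rabs M + 1) (/ p)).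
exists N => n /le_INR Nn.
have M1 : 0 < Rabs M + 1 by have := Rabs_pos M; lra.
apply: (Rlt_trans _ (Rabs M + 1)); first by have := Rle_abs M; lra.
have <- : Rpower (Rpower (Rabs M + 1) (/ p)) p = Rabs M + 1.
  by rewrite Rpower_mult Rinv_l ?Rpower_1 //; lra.
by apply: Rlt_Rpower_l => //; split; [exact: Rpower_gt0|lra].
Qed.

(** * The binomial series *)

Section BinomialSeries.
Variables (x : R) (x0 : -1 < x).

Let r_gt0 m : 0 < risp x m. Proof. exact: risp_gt0. Qed.

Lemma lim_inv_INR : is_lim_seq (fun n => / INR n.+1) 0.
Proof.
apply: (is_lim_seq_inv _ p_infty) => //.
exact: (proj1 (is_lim_seq_incr_1 INR p_infty) is_lim_seq_INR).
Qed.

Lemma CV_radius_risp : CV_radius (risp x) = 1.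
Proof.
rewrite -[in RHS]Rinv_1; apply: CV_radius_finite_DAlembert; last 1 first.
- apply: (is_lim_seq_ext (fun n => Rabs (1 + x * / INR n.+1))).
    move=> n; rewrite rispS; congr Rabs; have := INR_S_gt0 n; have := r_gt0 n => ? ?.
    by field; lra.
  apply: (lim_seq_eq Rabs_R1); apply: (is_lim_seq_abs _ 1).
  have e : 1 + x * 0 = 1 by ring.
  apply: (lim_seq_eq e); apply: is_lim_seq_plus'; first exact: is_lim_seq_const.
  by apply: (is_lim_seq_scal_l _ x 0); apply: lim_inv_INR.
- by move=> n; have := r_gt0 n; lra.
- by lra.
Qed.

Let in_disk z : -1 < z < 1 -> Rbar_lt (Finite (Rabs z)) (CV_radius (risp x)).
Proof. by move=> z1; rewrite CV_radius_risp /=; apply: Rabs_def1; lra. Qed.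

(** On coefficients this says (n+1) r_(n+1) - n r_n = (x+1) r_n, the defining recursion of
    [risp]. *)
Lemma PSeries_risp_ode z : -1 < z < 1 ->
  (1 - z) * PSeries (PS_derive (risp x)) z = (x + 1) * PSeries (risp x) z.
Proof.
move=> z1; have zd := in_disk z1.
have zd' : Rbar_lt (Finite (Rabs z)) (CV_radius (PS_derive (risp x))).
  by rewrite CV_radius_derive.
have E1 := CV_disk_correct _ _ (CV_disk_inside _ _ zd).
have E2 := CV_disk_correct _ _ (CV_disk_inside _ _ zd').
rewrite Rmult_minus_distr_r Rmult_1_l -PSeries_incr_1 -PSeries_minus //; last exact: ex_pseries_incr_1.
rewrite -PSeries_scal; apply: PSeries_ext => n.
rewrite /PS_minus /PS_plus /PS_opp /PS_incr_1 /PS_scal /PS_derive.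
rewrite /plus /opp /scal /= /mult /zero /= rispS.
case: n => [|n]; first by rewrite risp0 -[INR 1]/1; field.
have n1 := INR_S_gt0 n.+1.
by rewrite -/(INR n.+1); move: n1; rewrite (S_INR n.+1) => n1; field; lra.
Qed.

Lemma PSeries_risp z : 0 <= z < 1 -> PSeries (risp x) z = Rpower (1 - z) (- (x + 1)).
Proof.
(* The series times (1 - u)^(x+1): the differential equation makes it constant, equal to its value 1
   at 0. *)
move=> z01; pose G u := PSeries (risp x) u * exp ((x + 1) * ln (1 - u)).
have dG u : 0 <= u <= z -> is_derive G u zero.
  move=> uz; have u1 : -1 < u < 1 by lra.
  have d1 := is_derive_PSeries _ _ (in_disk u1).
  have d2 : is_derive (fun u => exp ((x + 1) * ln (1 - u))) u
     (- (x + 1) / (1 - u) * exp ((x + 1) * ln (1 - u))).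
    by auto_derive; [lra|rewrite /Rminus; field; lra].
  have := is_derive_mult _ _ _ _ _ d1 d2 (fun n m => Rmult_comm n m).
  rewrite /plus /mult /zero /=; set E := exp _; set F' := PSeries (PS_derive _) u.
  have -> : F' * E + PSeries (risp x) u * (- (x + 1) / (1 - u) * E) = 0 => //.
  have h := PSeries_risp_ode u1; rewrite -/F' in h.
  have -> : F' * E + PSeries (risp x) u * (- (x + 1) / (1 - u) * E) =
    ((1 - u) * F' - (x + 1) * PSeries (risp x) u) * (E / (1 - u)) by field; lra.
  by rewrite h Rminus_diag Rmult_0_l.
have G0 : G 0 = 1.
  by rewrite /G PSeries_0 risp0 Rminus_0_r ln_1 Rmult_0_r exp_0; ring.
have Gz : G z = 1.
  case: (Req_dec z 0) => [->//|z0]; rewrite -G0; symmetry.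
  by apply: eq_is_derive dG _; lra.
move: Gz; rewrite /G /Rpower => Gz.
have e0 := exp_pos ((x + 1) * ln (1 - z)).
apply: (Rmult_eq_reg_r (exp ((x + 1) * ln (1 - z)))); last by lra.
rewrite Gz -exp_plus; have -> : - (x + 1) * ln (1 - z) + (x + 1) * ln (1 - z) = 0 by ring.
by rewrite exp_0.
Qed.

Lemma sum_risp_lim z : 0 <= z < 1 ->
  is_lim_seq (fun n => \big[Rplus/R0]_(j < n) (risp x j * pow z j)) (Rpower (1 - z) (- (x + 1))).
Proof.
move=> z01; apply/is_lim_seq_incr_1.
rewrite -(PSeries_risp z01).
have z1 : -1 < z < 1 by lra.
apply: (is_lim_seq_ext (sum_n (fun k => scal (pow_n z k) (risp x k)))); last first.
  exact: (PSeries_correct _ _ (CV_disk_correct _ _ (CV_disk_inside _ _ (in_disk z1)))).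
elim=> [|n IHn].
  by rewrite sum_O big_ord_recl big_ord0 pow_n_pow /scal /= /mult /=; ring.
rewrite sum_Sn IHn [RHS]big_ord_recr pow_n_pow /plus /scal /= /mult /=.
by congr (_ + _); ring.
Qed.

Lemma sum_risp_le z n : 0 <= z < 1 ->
  \big[Rplus/R0]_(j < n) (risp x j * pow z j) <= Rpower (1 - z) (- (x + 1)).
Proof.
move=> z01.
apply: (is_lim_seq_incr_compare (fun n => \big[Rplus/R0]_(j < n) (risp x j * pow z j))).
  exact: sum_risp_lim.
move=> m; rewrite big_ord_recr /=.
have : 0 <= risp x m * z ^ m; last by lra.
by apply: Rmult_le_pos; [left|apply: pow_le; lra].
Qed.

End BinomialSeries.

(** * Consecutive quotients of a log-concave solution *)

#[local] Arguments pow _ _ : simpl never.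

Lemma sumR_ord_mono (F : nat -> R) m n : (forall i, 0 <= F i) -> (m <= n)%N ->
  \big[Rplus/R0]_(i < m) F i <= \big[Rplus/R0]_(i < n) F i.
Proof.
move=> F0 mn; rewrite -!(big_mkord predT) (@big_cat_nat _ _ _ m 0 n) //=.
have : 0 <= \big[Rplus/R0]_(m <= i < n) F i by apply: sumR_ge0.
lra.
Qed.

Lemma sumR_recl (F : nat -> R) n :
  \big[Rplus/R0]_(i < n.+1) F i = F 0%N + \big[Rplus/R0]_(i < n) F i.+1.
Proof. by rewrite big_ord_recl. Qed.

Lemma sumR_recr (F : nat -> R) n :
  \big[Rplus/R0]_(i < n.+1) F i = \big[Rplus/R0]_(i < n) F i + F n.
Proof. by rewrite big_ord_recr. Qed.

(** For j >= m + 1 one has 1 <= j / (m + 1), so the first moment controls the tail. *)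
Lemma sumR_tail (F : nat -> R) m p : (forall j, 0 <= F j) ->
  \big[Rplus/R0]_(j < p) F j <=
  \big[Rplus/R0]_(j < m.+1) F j + / INR m.+1 * \big[Rplus/R0]_(j < p) (INR j * F j).
Proof.
move=> F0; have m0 := INR_S_gt0 m; have im := Rinv_0_lt_compat _ m0.
elim: p => [|p IHp].
  by rewrite [X in X <= _]big_ord0 [X in _ * X]big_ord0 Rmult_0_r Rplus_0_r; apply: sumR_ge0.
case: (ltnP p m.+1) => pm.
  apply: (Rle_trans _ (\big[Rplus/R0]_(j < m.+1) F j)); first exact: sumR_ord_mono.
  suff : 0 <= / INR m.+1 * \big[Rplus/R0]_(j < p.+1) (INR j * F j) by lra.
  apply: Rmult_le_pos; first by left.
  by apply: sumR_ge0 => j _; apply: Rmult_le_pos => //; apply: pos_INR.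
rewrite (sumR_recr F p) (sumR_recr (fun j => INR j * F j)) Rmult_plus_distr_l.
suff : F p <= / INR m.+1 * (INR p * F p) by lra.
rewrite -Rmult_assoc -{1}(Rmult_1_l (F p)); apply: Rmult_le_compat_r => //.
rewrite Rmult_comm; apply/Rle_div_r => //; rewrite Rmult_1_l; exact: leq_INR.
Qed.

Lemma theta_gt0 g n : 0 < g -> 0 < theta g n.
Proof.
move=> g0; rewrite theta_risp //; apply: Rmult_lt_0_compat; first by apply: Gamma_gt0; lra.
by apply: risp_gt0; lra.
Qed.

Lemma nat_above y : 0 <= y -> exists M : nat, y < INR M <= y + 1.
Proof. by move=> /nfloor_ex[k hk]; exists k.+1; rewrite S_INR; lra. Qed.

Section Ratio.
Variables (g : R) (t b : nat -> R).
Hypothesis g0 : 0 < g.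
Hypothesis t_gt0 : forall l, 0 < t l.+1.
Hypothesis t_theta : forall l, t l.+2 = theta g l.+2.
Hypothesis bt : is_rec t b.
Hypothesis b_lc : forall n, b n * b n.+2 <= b n.+1 * b n.+1.

Let C := Rabs (t 1%N - theta g 1).
Let r n := b n / b n.+1.
Let G1 := Gamma (g + 1).
(** The full series sum_(j >= 0) theta_j r_n^j in closed form, meaningful once r_n < 1 is known; the
    asymptotics of 1 - r_n are equivalent to Y n ~ n. *)
Let Y n := G1 * Rpower (1 - r n) (- (g + 1)).

Let G1_gt0 : 0 < G1. Proof. by apply: Gamma_gt0; lra. Qed.

Let b_gt0 n : 0 < b n.
Proof. by apply: (is_rec_gt0 _ (t_gt0 0) bt) => l; left. Qed.

Let r_gt0 n : 0 < r n.
Proof. exact: Rdiv_lt_0_compat. Qed.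

Let rE n : r n * b n.+1 = b n.
Proof. by rewrite /r; field; have := b_gt0 n.+1; lra. Qed.

Lemma ratio_incr m n : (m <= n)%N -> r m <= r n.
Proof.
move=> mn; have := @log_concave_ratio b n b_gt0 (fun i _ => b_lc i) m n mn (leqnn n).
move=> H; apply: (Rmult_le_reg_r (b m.+1 * b n.+1)); first exact: Rmult_lt_0_compat.
have -> : r m * (b m.+1 * b n.+1) = (r m * b m.+1) * b n.+1 by ring.
have -> : r n * (b m.+1 * b n.+1) = (r n * b n.+1) * b m.+1 by ring.
by rewrite !rE; lra.
Qed.

(** b_m / b_(m+j) is the product of the quotients of indices m to m + j - 1, each at least r_m;
    [ratio_pow_ge] bounds the same product from above by the power of a later quotient. *)
Lemma ratio_pow_le m j : r m ^ j * b (m + j)%N <= b m.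
Proof.
elim: j => [|j IH]; first by rewrite addn0 /=; lra.
apply: Rle_trans IH; rewrite addnS -tech_pow_Rmult Rmult_comm -Rmult_assoc Rmult_comm.
apply: Rmult_le_compat_l; first by apply: pow_le; left.
rewrite -(rE (m + j)) Rmult_comm; apply: Rmult_le_compat_r; first by left.
by apply: ratio_incr; apply: leq_addr.
Qed.

Lemma ratio_pow_ge n m j : (m + j <= n.+1)%N -> b m <= r n ^ j * b (m + j)%N.
Proof.
elim: j => [|j IH] mjn; first by rewrite addn0 /=; lra.
apply: Rle_trans (IH _) _; first by rewrite ltnW // -addnS.
rewrite addnS -tech_pow_Rmult (Rmult_comm (r n)) Rmult_assoc.
apply: Rmult_le_compat_l; first by apply: pow_le; left.
rewrite -{1}(rE (m + j)); apply: Rmult_le_compat_r; first by left.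
by apply: ratio_incr; rewrite -ltnS -addnS.
Qed.

(** The only growth of the weights that is needed to force r_n < 1 and n (1 - r_n) to infinity. *)
Lemma sum_t_superlinear K :
  exists N, forall n, (N <= n)%N -> K * INR n <= \big[Rplus/R0]_(l < n) t l.+1.
Proof.
have /is_lim_seq_spec /(_ (2 * Rabs K)) [J HJ] := lim_Rpower_infty g0.
have K0 := Rabs_pos K.
have H n : 2 * Rabs K * (INR n - INR J.+1) <= \big[Rplus/R0]_(l < n) t l.+1.
  elim: n => [|n IHn].
    by rewrite big_ord0; have := INR_S_gt0 J; change (INR 0) with 0; nra.
  case: (ltnP n J.+1) => nJ.
    apply: (Rle_trans _ 0); last by apply: sumR_ge0 => l _; left.
    by have := leq_INR nJ; nra.
  rewrite big_ord_recr /= S_INR.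
  case: n nJ IHn => // n; rewrite ltnS => nJ IHn.
  rewrite t_theta; have := @theta_ge g n.+1 g0.
  have := HJ n.+2; have Jn : (J <= n.+2)%coq_nat by apply/leP; rewrite !leqW.
  move=> /(_ Jn) h1 h2.
  apply: (Rle_trans _ (2 * Rabs K * (INR n.+1 - INR J.+1) + theta g n.+2)); first by lra.
  exact: Rplus_le_compat_r.
(* From twice J + 1 on, n - (J + 1) >= n / 2; hence the factor 2 in [H]. *)
exists (J.+1 + J.+1)%N => n /leq_INR; rewrite plus_INR => nJ.
apply: Rle_trans (H n).
by have := Rle_abs K; have := pos_INR n; nra.
Qed.

(** The recursion at index n + m + 1, cut after m + 1 terms: only quotients of index at least n
    occur in them. In [sum_t_ratio_ge] the recursion is taken at n + 1, where all quotients have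
    index at most n. *)
Lemma sum_t_ratio_le n m :
  \big[Rplus/R0]_(l < m.+1) (t l.+1 * r n ^ l.+1) <= INR (n + m.+1).
Proof.
apply: (Rmult_le_reg_r (b (n + m.+1)%N)) => //; rewrite addnS (proj2 bt).
rewrite big_distrl /=.
apply: (Rle_trans _ (\big[Rplus/R0]_(l < m.+1) (t l.+1 * b (n + m - l)%N))).
  apply: sumR_le => l _; rewrite Rmult_assoc; apply: Rmult_le_compat_l; first by left.
  have lm : (l <= m)%N by rewrite -ltnS.
  apply: Rle_trans (ratio_pow_le (n + m - l) l.+1).
  rewrite addnS subnK; last by rewrite (leq_trans lm) ?leq_addl.
  apply: Rmult_le_compat_r; first by left.
  apply: (pow_incr _ _ l.+1); split; first by left.
  by apply: ratio_incr; rewrite -addnBA // leq_addr.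
apply: (@sumR_ord_mono (fun l => t l.+1 * b (n + m - l)%N)) => [l|].
  by left; apply: Rmult_lt_0_compat.
by rewrite ltnS leq_addl.
Qed.

Lemma sum_t_ratio_ge n :
  INR n.+1 <= \big[Rplus/R0]_(l < n.+1) (t l.+1 * r n ^ l.+1).
Proof.
apply: (Rmult_le_reg_r (b n.+1)) => //; rewrite (proj2 bt) big_distrl /=.
apply: sumR_le => l _; rewrite Rmult_assoc; apply: Rmult_le_compat_l; first by left.
have ln : (l <= n)%N by rewrite -ltnS.
have e : (n - l + l.+1)%N = n.+1 by rewrite addnS subnK.
by have := @ratio_pow_ge n (n - l) l.+1; rewrite e; apply.
Qed.

(** If r_n >= 1, the partial sums of t up to m + 1 would be at most n + m + 1 for every m, against
    superlinear growth. *)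
Lemma ratio_lt1 n : r n < 1.
Proof.
case: (Rlt_or_le (r n) 1) => // r1; exfalso.
have [N HN] := sum_t_superlinear 3.
set m := (N + n)%N.
have h1 := HN m.+1 (leq_trans (leq_addr _ _) (leqnSn _)).
have h2 := sum_t_ratio_le n m.
have h3 : \big[Rplus/R0]_(l < m.+1) t l.+1 <= \big[Rplus/R0]_(l < m.+1) (t l.+1 * r n ^ l.+1).
  apply: sumR_le => l _; rewrite -{1}[t l.+1]Rmult_1_r; apply: Rmult_le_compat_l; first by left.
  exact: pow_R1_Rle.
have h4 : INR n <= INR m.+1 by apply: leq_INR; rewrite /m leqW ?leq_addl.
by move: h2; rewrite plus_INR; have := INR_S_gt0 m; lra.
Qed.

Lemma sum_t_theta z m : 0 <= z <= 1 ->
  Rabs (\big[Rplus/R0]_(l < m) (t l.+1 * z ^ l.+1) -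
        \big[Rplus/R0]_(l < m) (theta g l.+1 * z ^ l.+1)) <= C.
Proof.
move=> z01; case: m => [|m].
  by rewrite !big_ord0 Rminus_diag Rabs_R0; apply: Rabs_pos.
rewrite !big_ord_recl /=.
have -> : \big[Rplus/R0]_(i < m) (t (bump 0 i).+1 * (z * z ^ bump 0 i)) =
   \big[Rplus/R0]_(i < m) (theta g (bump 0 i).+1 * (z * z ^ bump 0 i)).
  by apply: eq_bigr => i _; rewrite t_theta.
set S := bigop _ _ _.
have -> : t 1%N * (z * 1) + S - (theta g 1 * (z * 1) + S) = (t 1%N - theta g 1) * z by ring.
rewrite Rabs_mult (Rabs_pos_eq z); last by lra.
by rewrite -/C; have : 0 <= C by [exact: Rabs_pos]; nra.
Qed.

Lemma sum_theta_le z m : 0 <= z < 1 ->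
  \big[Rplus/R0]_(j < m) (theta g j * z ^ j) <= G1 * Rpower (1 - z) (- (g + 1)).
Proof.
move=> z01; under eq_bigr => j _ do rewrite theta_risp // Rmult_assoc.
rewrite -big_distrr /=; apply: Rmult_le_compat_l; first by left.
by apply: sum_risp_le => //; lra.
Qed.

Lemma Y_ge n : INR n.+1 <= Y n + C.
Proof.
have r01 : 0 <= r n < 1 by split; [left|exact: ratio_lt1].
apply: Rle_trans (sum_t_ratio_ge n) _.
have := @sum_t_theta (r n) n.+1 ltac:(lra) => /Rabs_le_between h.
have := @sum_theta_le (r n) n.+2 r01.
rewrite (sumR_recl (fun j => theta g j * r n ^ j)) pow_O -/(Y n) => h'.
by have : 0 < theta g 0 by [exact: theta_gt0]; lra.
Qed.

(** The right side equals (g + 1 + j) theta_j. It is a coefficient of a multiple of (1 - z)^(-g-2),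
    so the first moment of the series has a closed bound. *)
Lemma mul_theta_le j : INR j * theta g j <= (g + 1) * G1 * risp (g + 1) j.
Proof.
have e k : risp (g + 1) k * (g + 1) = risp g k * (g + 1 + INR k).
  elim: k => [|k IHk]; first by rewrite !risp0; change (INR 0) with 0; ring.
  rewrite !rispS; have := INR_S_gt0 k => k0.
  have -> : risp (g + 1) k * (1 + (g + 1) / INR k.+1) * (g + 1) =
    (risp (g + 1) k * (g + 1)) * (1 + (g + 1) / INR k.+1) by ring.
  by rewrite IHk; move: k0; rewrite S_INR => k0; field; lra.
rewrite theta_risp // -/G1.
have -> : (g + 1) * G1 * risp (g + 1) j = G1 * (risp (g + 1) j * (g + 1)) by ring.
rewrite e; have r0 : 0 < risp g j by apply: risp_gt0; lra.
by have := Rmult_lt_0_compat _ _ G1_gt0 r0; have := pos_INR j; nra.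
Qed.

(* Markov's inequality for the tail beyond [m + 1] of the series of [theta] at [r n]. *)
Lemma Y_le n m :
  Y n <= G1 + INR (n + m.+1) + C + (g + 1) / (INR m.+1 * (1 - r n)) * Y n.
Proof.
set z := r n; have r01 : 0 <= z < 1 by split; [left; exact: r_gt0|exact: ratio_lt1].
have m0 := INR_S_gt0 m.
pose S p := \big[Rplus/R0]_(j < p) (theta g j * z ^ j).
have pos j : 0 <= theta g j * z ^ j.
  by apply: Rmult_le_pos; [left; exact: theta_gt0|apply: pow_le; lra].
have tail p : S p <= S m.+1 + / INR m.+1 * \big[Rplus/R0]_(j < p) (INR j * theta g j * z ^ j).
  under [X in _ * X]eq_bigr => j _ do rewrite Rmult_assoc.
  exact: (@sumR_tail (fun j => theta g j * z ^ j)).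
have T p : \big[Rplus/R0]_(j < p) (INR j * theta g j * z ^ j) <= (g + 1) / (1 - z) * Y n.
  apply: (Rle_trans _ (\big[Rplus/R0]_(j < p) ((g + 1) * G1 * (risp (g + 1) j * z ^ j)))).
    apply: sumR_le => j _; rewrite -Rmult_assoc; apply: Rmult_le_compat_r.
      by apply: pow_le; lra.
    exact: mul_theta_le.
  rewrite -big_distrr /=.
  have := @sum_risp_le (g + 1) ltac:(lra) z p r01.
  have -> : Rpower (1 - z) (- (g + 1 + 1)) = Rpower (1 - z) (- (g + 1)) / (1 - z).
    have -> : - (g + 1 + 1) = - (g + 1) + - (1) by ring.
    by rewrite Rpower_plus (Rpower_Ropp _ 1) Rpower_1 //; lra.
  move=> h; rewrite /Y -/z.
  have -> : (g + 1) / (1 - z) * (G1 * Rpower (1 - z) (- (g + 1))) =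
    ((g + 1) * G1) * (Rpower (1 - z) (- (g + 1)) / (1 - z)) by field; lra.
  by apply: Rmult_le_compat_l => //; apply: Rmult_le_pos; lra.
have Sm : S m.+1 <= G1 + INR (n + m.+1) + C.
  apply: (Rle_trans _ (S m.+2)); first exact: (@sumR_ord_mono (fun j => theta g j * z ^ j)).
  rewrite /S (sumR_recl (fun j => theta g j * z ^ j)) pow_O Rmult_1_r.
  rewrite [theta g 0]theta_risp // risp0 -/G1 Rmult_1_r.
  have := sum_t_ratio_le n m.
  have := @sum_t_theta z m.+1 ltac:(lra) => /Rabs_le_between.
  by rewrite -/z; lra.
have L : is_lim_seq S (Y n).
  apply: (is_lim_seq_ext (fun p => G1 * \big[Rplus/R0]_(j < p) (risp g j * z ^ j))).
    move=> p; rewrite /S big_distrr /=; apply: eq_bigr => j _.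
    by rewrite theta_risp // Rmult_assoc.
  apply: (is_lim_seq_scal_l _ G1 (Rpower (1 - z) (- (g + 1)))).
  by apply: sum_risp_lim => //; lra.
have := is_lim_seq_le S (fun=> G1 + INR (n + m.+1) + C + (g + 1) / (INR m.+1 * (1 - z)) * Y n)
  (Y n) _ _ L (is_lim_seq_const _); apply => p.
apply: Rle_trans (tail p) _; apply: Rplus_le_compat => //.
have -> : (g + 1) / (INR m.+1 * (1 - z)) * Y n = / INR m.+1 * ((g + 1) / (1 - z) * Y n).
  by field; lra.
by apply: Rmult_le_compat_l (T p); left; apply: Rinv_0_lt_compat.
Qed.

(** If n (1 - r_n) < K, the powers r_n^l with l <= n stay above exp (-2 |K|), so [sum_t_ratio_le]
    would bound t_1 + ... + t_n by a multiple of n. *)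
Lemma mul_gap_infty K : exists N, forall n, (N <= n)%N -> K <= INR n * (1 - r n).
Proof.
have [N HN] := sum_t_superlinear (3 * exp (2 * Rabs K)).
have [N' HN'] := INR_unbounded (2 * Rabs K).
exists (maxn N N').+1 => -[//|n]; rewrite ltnS geq_max => /andP[Nn N'n].
have n0 := INR_S_gt0 n.
case: (Rle_or_lt K (INR n.+1 * (1 - r n.+1))) => // lt; exfalso.
set x := 1 - r n.+1 in lt.
have x0 : 0 < x by have := ratio_lt1 n.+1; rewrite /x; lra.
have Kn : INR n.+1 * x < Rabs K by have := Rle_abs K; lra.
have K2 : 2 * Rabs K <= INR n.+1 by have := leq_INR (leqW N'n); lra.
(* Below 1/2 one has 1 - x >= exp (-2 x), which is the source of the factor 2 in the exponents. *)
have xh : x <= / 2 by nra.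
have ex : exp (- (2 * x)) <= 1 - x.
  rewrite -[1 - x]exp_ln; last by lra.
  apply: exp_le; have := @ln_ge_1sub (1 - x) ltac:(lra).
  suff : - (2 * x) <= 1 - / (1 - x) by lra.
  have -> : 1 - / (1 - x) = - (x / (1 - x)) by field; lra.
  suff : x / (1 - x) <= 2 * x by lra.
  by apply/Rle_div_l; [lra|nra].
have E0 := exp_pos (2 * Rabs K).
have rj (l : nat) : (l <= n)%N -> exp (- (2 * Rabs K)) <= r n.+1 ^ l.+1.
  move=> ln; apply: (Rle_trans _ (exp (- (2 * x)) ^ l.+1)).
    have -> : exp (- (2 * x)) ^ l.+1 = exp (- (2 * x) * INR l.+1).
      elim: (l.+1) => [|k IHk]; first by change (INR 0) with 0; rewrite Rmult_0_r exp_0.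
      by rewrite -tech_pow_Rmult IHk -exp_plus S_INR; congr exp; ring.
    apply: exp_le; have : INR l.+1 <= INR n.+1 by apply: leq_INR.
    by nra.
  apply: pow_incr; split; first by left; apply: exp_pos.
  by move: ex; rewrite {2}/x; lra.
have h1 := sum_t_ratio_le n.+1 n.
have h2 : exp (- (2 * Rabs K)) * \big[Rplus/R0]_(l < n.+1) t l.+1 <= 
    \big[Rplus/R0]_(l < n.+1) (t l.+1 * r n.+1 ^ l.+1).
  rewrite big_distrr /=; apply: sumR_le => l _; rewrite Rmult_comm.
  apply: Rmult_le_compat_l; first by left.
  by apply: rj; rewrite -ltnS.
have h3 := HN n.+1 (leqW Nn).
have h4 := Rmult_le_compat_l _ _ _ (Rlt_le _ _ (exp_pos (- (2 * Rabs K)))) h3.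
have e1 : exp (- (2 * Rabs K)) * (3 * exp (2 * Rabs K) * INR n.+1) = 3 * INR n.+1.
  by rewrite exp_Ropp; field; lra.
rewrite e1 in h4; have h5 := Rle_trans _ _ _ h4 (Rle_trans _ _ _ h2 h1).
by move: h5; rewrite plus_INR; lra.
Qed.

Lemma Y_gt0 n : 0 < Y n.
Proof. by apply: Rmult_lt_0_compat => //; apply: Rpower_gt0. Qed.

Lemma lim_Y : is_lim_seq (fun n => Y n / INR n) 1.
Proof.
apply/lim_seqP => e0 e00.
pose e := Rmin e0 1; have e1 : 0 < e <= 1 by rewrite /e; split; [apply: Rmin_pos; lra|exact: Rmin_r].
have ee0 : e <= e0 by apply: Rmin_l.
pose d := e / 8.
(* One factor 1 / d pays for the cut m + 1 > d n, the other makes the Markov coefficient at most d.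
   Then (1 - d) Y <= (1 + 2 d) n, and d <= 1/8 leaves room for Y <= (1 + 7 d) n. *)
have [N1 H1] := mul_gap_infty ((g + 1) / d / d).
have [N2 H2] := INR_unbounded ((G1 + 1 + C) / d).
exists (maxn N1 N2).+1 => -[//|n]; rewrite ltnS geq_max => /andP[N1n N2n].
have n0 := INR_S_gt0 n.
have d0 : 0 < d <= / 8 by rewrite /d; lra.
have C0 : 0 <= C by apply: Rabs_pos.
have hn : (G1 + 1 + C) <= d * INR n.+1.
  have := leq_INR (leqW N2n) => h; have : (G1 + 1 + C) / d <= INR n.+1 by lra.
  by move=> /Rle_div_l; rewrite Rmult_comm; apply; lra.
have x0 : 0 < 1 - r n.+1 by have := ratio_lt1 n.+1; lra.
have Yp := Y_gt0 n.+1.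
have up : Y n.+1 <= (1 + e) * INR n.+1 - d * INR n.+1.
  have [[|m] Hm] := @nat_above (d * INR n.+1) ltac:(nra).
    by move: Hm; change (INR 0) with 0; nra.
  have m0 := INR_S_gt0 m.
  have := Y_le n.+1 m; rewrite plus_INR.
  have : (g + 1) / (INR m.+1 * (1 - r n.+1)) <= d.
    apply/Rle_div_l; first exact: Rmult_lt_0_compat.
    have := H1 n.+1 (leqW N1n) => h.
    have : g + 1 <= d * (d * (INR n.+1 * (1 - r n.+1))).
      have -> : g + 1 = d * (d * ((g + 1) / d / d)) by field; lra.
      by do 2!(apply: Rmult_le_compat_l; first by lra).
    by nra.
  move=> /(Rmult_le_compat_r (Y n.+1) _ _ (Rlt_le _ _ Yp)) h1 h2.
  have h3 : Y n.+1 * (1 - d) <= INR n.+1 * (1 + 2 * d) by lra.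
  have e8 : e = 8 * d by rewrite /d; field.
  rewrite e8; apply: (Rmult_le_reg_r (1 - d)); first by lra.
  by nra.
have lo := Y_ge n.+1; rewrite S_INR in lo.
apply: (Rlt_le_trans _ e) => //.
have -> : Y n.+1 / INR n.+1 - 1 = (Y n.+1 - INR n.+1) / INR n.+1 by field; lra.
rewrite Rabs_div; last by lra.
rewrite (Rabs_pos_eq (INR n.+1)); last by lra.
have dn : 0 < d * INR n.+1 by apply: Rmult_lt_0_compat; lra.
have e8 : e = 8 * d by rewrite /d; field.
by apply/Rlt_div_l => //; rewrite e8 in up *; apply: Rabs_def1; lra.
Qed.

Lemma lim_gap : is_lim_seq (fun n => (1 - r n) * Rpower (INR n) (/ (1 + g)))
  (Rpower G1 (/ (g + 1))).
Proof.
have L : is_lim_seq (fun n => Rpower (G1 * / (Y n / INR n)) (/ (g + 1)))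
   (Rpower (G1 * / 1) (/ (g + 1))).
  apply: lim_Rpower; first by rewrite Rinv_1; lra.
  apply: (is_lim_seq_scal_l _ G1 (Finite (/ 1))).
  by apply: (is_lim_seq_inv _ 1 lim_Y) => -[]; lra.
rewrite Rinv_1 Rmult_1_r in L.
apply: is_lim_seq_ext_loc L; exists 1%N => -[|n] hn; first by inversion hn.
have x0 : 0 < 1 - r n.+1 by have := ratio_lt1 n.+1; lra.
have n0 := INR_S_gt0 n.
have -> : G1 * / (Y n.+1 / INR n.+1) = Rpower (1 - r n.+1) (g + 1) * INR n.+1.
  rewrite /Y Rpower_Ropp; have := Rpower_gt0 (1 - r n.+1) (g + 1).
  by move=> p0; field; lra.
rewrite Rplus_comm -Rpower_mult_distr //; last exact: Rpower_gt0.
by rewrite Rpower_mult Rinv_r ?Rpower_1 //; lra.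
Qed.

Lemma lim_ratio : is_lim_seq r 1.
Proof.
have g1 : 0 < / (1 + g) by apply: Rinv_0_lt_compat; lra.
apply: (is_lim_seq_ext (fun n => 1 - ((1 - r n) * Rpower (INR n) (/ (1 + g))) *
                                     / Rpower (INR n) (/ (1 + g)))).
  by move=> n; field; have := Rpower_gt0 (INR n) (/ (1 + g)); lra.
apply: (@lim_seq_eq _ (1 - Rpower G1 (/ (g + 1)) * 0)); first by ring.
apply: is_lim_seq_minus'; first exact: is_lim_seq_const.
apply: is_lim_seq_mult'; first exact: lim_gap.
by apply: (is_lim_seq_inv _ p_infty) => //; apply: lim_Rpower_infty.
Qed.

End Ratio.

(** * Riemann sums *)

Section RiemannSum.
Variable f : R -> R.
Hypothesis fc : forall x, continuity_pt f x.
Let F (y : R) : R := RInt f 0 y.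

Let F_derive y : is_derive F y (f y).
Proof.
apply: (is_derive_RInt f F 0 y); last exact/continuity_pt_filterlim/fc.
apply: filter_forall => u; apply: RInt_correct; apply: ex_RInt_continuous => v _.
exact/continuity_pt_filterlim/fc.
Qed.

(** By the mean value theorem each cell has integral f(c) / N, and uniform continuity compares f(c)
    with the value at the right end, at a cost of e / N per cell. *)
Lemma RInt_sum_right N e d M s : 0 < N -> / N < d ->
  (forall x y, 0 <= x <= s -> 0 <= y <= s -> Rabs (x - y) < d -> Rabs (f x - f y) < e) ->
  INR M <= s * N ->
  Rabs (/ N * \big[Rplus/R0]_(l < M) f (INR l.+1 / N) - F (INR M / N)) <= INR M * (e / N).
Proof.
move=> N0 Nd fd; elim: M => [|M IHM] Ms.
  rewrite big_ord0 Rmult_0_r /F /Rdiv Rmult_0_l RInt_point Rmult_0_l.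
  by rewrite /zero /= Rminus_diag Rabs_R0; right.
have M0 := pos_INR M; have iN := Rinv_0_lt_compat _ N0.
move: Ms; rewrite S_INR => Ms.
have {IHM} := IHM ltac:(lra).
rewrite (sumR_recr (fun l => f (INR l.+1 / N))) S_INR; set S := bigop _ _ _ => IHM.
have lt1 : INR M / N < (INR M + 1) / N by apply: Rmult_lt_compat_r => //; lra.
have [c [hc Ec]] := MVT_gen F (INR M / N) ((INR M + 1) / N) f
  (fun x _ => F_derive x)
  (fun x _ => ltac:(apply/continuity_pt_filterlim; apply: ex_derive_continuous; exists (f x); exact: F_derive)).
rewrite Rmin_left ?Rmax_right in hc; try lra.
have le1 : (INR M + 1) / N <= s by apply/Rle_div_l.
have ge0 : 0 <= INR M / N by apply: Rmult_le_pos => //; left.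
have dE : (INR M + 1) / N - INR M / N = / N by field; lra.
have := fd c ((INR M + 1) / N) ltac:(lra) ltac:(lra) ltac:(apply: Rabs_def1; lra) => hf.
have -> : / N * (S + f ((INR M + 1) / N)) - F ((INR M + 1) / N) =
  (/ N * S - F (INR M / N)) + - ((f c - f ((INR M + 1) / N)) * / N).
  have -> : F ((INR M + 1) / N) = F (INR M / N) + f c * / N by rewrite -dE; move: Ec => /= Ec; lra.
  by ring.
apply: Rle_trans (Rabs_triang _ _) _; rewrite Rabs_Ropp Rabs_mult (Rabs_pos_eq (/ N)); last by lra.
have := Rmult_le_compat_r (/ N) _ _ (Rlt_le _ _ iN) (Rlt_le _ _ hf).
rewrite /Rdiv; rewrite /Rdiv in IHM *; lra.
Qed.

(** M counts the positive grid points strictly below s, matching the strict inequality in the event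
    for L_1; the incomplete last cell is absorbed by continuity of the integral at s. *)
Lemma riemann_right (N : nat -> R) s : 0 < s -> (forall n, 0 < N n) ->
  is_lim_seq N p_infty ->
  forall e, 0 < e -> exists n0, forall n, (n0 <= n)%N -> forall M,
    INR M < s * N n <= INR M + 1 ->
    Rabs (/ N n * \big[Rplus/R0]_(l < M) f (INR l.+1 / N n) - RInt f 0 s) < e.
Proof.
move=> s0 N0 Ninf e e0.
have e1 : 0 < e / 2 / s by do 2!apply: Rdiv_lt_0_compat => //; lra.
have [[d d0] /= Hd] := Heine_cor2 (fun x (_ : 0 <= x <= s) => fc x) (mkposreal _ e1).
have Fc : continuity_pt F s.
  apply/continuity_pt_filterlim; apply: ex_derive_continuous; exists (f s); exact: F_derive.
have e2 : e / 2 > 0 by lra.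
have [d' [d'0 Hd']] := Fc _ e2.
have /is_lim_seq_spec /(_ (/ Rmin d d')) [n0 Hn0] := Ninf.
have m0 : 0 < Rmin d d' by apply: Rmin_pos.
exists n0 => n /leP /Hn0 Nn M [M1 M2].
have Np := N0 n; have iN := Rinv_0_lt_compat _ Np.
have Nm : / N n < Rmin d d'.
  rewrite -[Rmin d d']Rinv_inv; apply: Rinv_lt_contravar => //.
  by apply: Rmult_lt_0_compat => //; apply: Rinv_0_lt_compat.
have Nd : / N n < d by have := Rmin_l d d'; lra.
have Nd' : / N n < d' by have := Rmin_r d d'; lra.
have h1 := RInt_sum_right Np Nd Hd (Rlt_le _ _ M1).
have le1 : INR M / N n < s by apply/Rlt_div_l.
have ge1 : s <= INR M / N n + / N n.
  have -> : INR M / N n + / N n = (INR M + 1) / N n by field; lra.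
  exact/Rle_div_r.
have h2 : Rabs (F (INR M / N n) - F s) < e / 2.
  apply: Hd'; split; first by split=> //; lra.
  by rewrite /= /R_dist; apply: Rabs_def1; lra.
have h3 : INR M * (e / 2 / s / N n) <= e / 2.
  have -> : INR M * (e / 2 / s / N n) = (INR M / N n) * (e / 2 / s) by field; lra.
  apply: (Rle_trans _ (s * (e / 2 / s))); first by apply: Rmult_le_compat_r; lra.
  by right; field; lra.
rewrite -/(F s).
have -> : / N n * \big[Rplus/R0]_(l < M) f (INR l.+1 / N n) - F s =
  (/ N n * \big[Rplus/R0]_(l < M) f (INR l.+1 / N n) - F (INR M / N n)) +
  (F (INR M / N n) - F s) by ring.
apply: Rle_lt_trans (Rabs_triang _ _) _; lra.
Qed.

End RiemannSum.

Lemma gamma_dens_continuous g a x : 0 < g -> 0 < a -> continuity_pt (gamma_dens g a) x.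
Proof.
move=> g0 a0.
have pos y : 0 < y -> gamma_dens g a y = Rpower y g * exp (- (a * y)).
  by rewrite /gamma_dens; case: Rlt_dec.
have neg y : y <= 0 -> gamma_dens g a y = 0.
  by move=> y0; rewrite /gamma_dens; case: Rlt_dec => // y1; lra.
case: (total_order_T x 0) => [[x0|->]|x0].
- apply/continuity_pt_filterlim.
  apply: (continuous_ext_loc _ (fun=> 0)); last exact: continuous_const.
  have d0 : 0 < - x by lra.
  exists (mkposreal _ d0) => y /= hy; rewrite neg //.
  by move: hy; rewrite /ball /= /AbsRing_ball /abs /minus /plus /opp /= => /Rabs_def2; lra.
(* For 0 < y < e^(1/g) one has y^g < e, and the exponential factor is at most 1. *)
- move=> e e0; exists (Rpower e (/ g)); split; first exact: exp_pos.
  move=> y [_]; rewrite /= /R_dist Rminus_0_r => hy; rewrite (neg 0); last by lra.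
  rewrite Rminus_0_r; case: (Rle_or_lt y 0) => y0; first by rewrite neg // Rabs_R0.
  rewrite pos // Rabs_pos_eq; last first.
    by left; apply: Rmult_lt_0_compat; apply: exp_pos.
  rewrite Rabs_pos_eq in hy; last by lra.
  have h1 : Rpower y g < e.
    have <- : Rpower (Rpower e (/ g)) g = e by rewrite Rpower_mult Rinv_l ?Rpower_1 //; lra.
    by apply: Rlt_Rpower_l.
  have h2 : exp (- (a * y)) <= 1.
    by rewrite -exp_0; apply: exp_le; nra.
  have h3 : 0 < Rpower y g by apply: exp_pos.
  have h4 := exp_pos (- (a * y)).
  by nra.
- apply/continuity_pt_filterlim.
  apply: (continuous_ext_loc _ (fun y => Rpower y g * exp (- (a * y)))); last first.
    apply: (ex_derive_continuous (fun y => Rpower y g * exp (- (a * y)))).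
    by rewrite /Rpower; auto_derive.
  exists (mkposreal _ x0) => y /= hy; rewrite pos //.
  by move: hy; rewrite /ball /= /AbsRing_ball /abs /minus /plus /opp /= => /Rabs_def2; lra.
Qed.

(** * The log-concave comparison sequence *)

Lemma hn_is_rec th : is_rec th (hn th).
Proof. by split; [exact: hn_0|exact: hn_rec]. Qed.

Lemma hn_ext th th' : (forall l, th l.+1 = th' l.+1) -> hn th =1 hn th'.
Proof. by move=> e; apply: (is_rec_unique _ (hn_is_rec th')); apply: is_rec_ext (hn_is_rec th). Qed.

Lemma hn_perturb th p y :
  hn (fun j => th j + (if j == p.+1 then y else 0)) =1 perturb (hn th) p y.
Proof. exact: is_rec_unique (hn_is_rec _) (perturb_rec p y (hn_is_rec th)). Qed.

(** exp (1/24) <= 1 / (1 - 1/24) = 24/23, and (24/23)^16 <= 2. The constant 2/3 is what [base_lc0]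
    requires. *)
Lemma ln2_ge : 2 / 3 <= ln 2.
Proof.
have e1 : exp (1 / 24) <= 24 / 23.
  have := exp_ineq1_le (- (1 / 24)); rewrite exp_Ropp => h.
  have e0 := exp_pos (1 / 24).
  apply: (Rmult_le_reg_r (/ exp (1 / 24))); first exact: Rinv_0_lt_compat.
  by rewrite Rinv_r; lra.
rewrite -[2 / 3]ln_exp; apply: ln_le; first exact: exp_pos.
have -> : exp (2 / 3) = pow (exp (1 / 24)) 16.
  rewrite -Rpower_pow; last exact: exp_pos.
  by rewrite /Rpower ln_exp; congr exp; rewrite INR_IZR_INZ /=; field.
apply: (Rle_trans _ (pow (24 / 23) 16)); last by rewrite /pow; lra.
by apply: pow_incr; split=> //; left; apply: exp_pos.
Qed.

Section Base.
Variable g : R.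
Hypothesis g0 : 0 < g.

(* The sequence [1, theta_1, theta_2, ...] is not log-concave for small [g], hence the change at [1]. *)
Definition base_theta (j : nat) : R :=
  if j == 1%N then 3 * theta g 2 / (g + 3) else theta g j.

Let b := hn base_theta.
Let th_gt0 n : 0 < theta g n. Proof. exact: theta_gt0. Qed.

Lemma theta_succ n : theta g n.+1 = theta g n * (1 + g / INR n.+1).
Proof. by rewrite !theta_risp // rispS Rmult_assoc. Qed.

Lemma base_gt0 l : 0 < base_theta l.+1.
Proof.
rewrite /base_theta; case: eqP => // _.
by have := th_gt0 2 => h; apply: Rdiv_lt_0_compat; lra.
Qed.

(** As [base_theta 1] is theta_2 / (1 + g/3), the claim is (1 + g/3)^2 <= theta_2, and (1 + g/3)^2
    <= exp (2 g / 3) <= 2^g <= theta_2. *)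
Lemma base_lc0 : base_theta 2 <= base_theta 1 * base_theta 1.
Proof.
rewrite /base_theta /=; have t2 := th_gt0 2.
have h : (1 + g / 3) * (1 + g / 3) <= theta g 2.
  apply: Rle_trans (@theta_ge g 1 g0).
  have h1 : 1 + g / 3 <= exp (g / 3) by apply: exp_ineq1_le.
  apply: (Rle_trans _ (exp (g / 3) * exp (g / 3))); first by nra.
  rewrite -exp_plus /Rpower; apply: exp_le.
  have -> : INR 2 = 2 by rewrite INR_IZR_INZ.
  by have := ln2_ge; nra.
apply: (Rmult_le_reg_r ((1 + g / 3) * (1 + g / 3) * / theta g 2)).
  by do !apply: Rmult_lt_0_compat; try (apply: Rinv_0_lt_compat); lra.
have -> : theta g 2 * ((1 + g / 3) * (1 + g / 3) * / theta g 2) =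
  (1 + g / 3) * (1 + g / 3) by field; lra.
have -> : 3 * theta g 2 / (g + 3) * (3 * theta g 2 / (g + 3)) *
  ((1 + g / 3) * (1 + g / 3) * / theta g 2) = theta g 2 by field; lra.
by [].
Qed.

(** The value of [base_theta 1] is chosen to give equality at l = 0, since theta_3 = theta_2 (1 +
    g/3). For later l the growth factors 1 + g / j decrease in j. *)
Lemma base_lc l : base_theta l.+1 * base_theta l.+3 <= base_theta l.+2 * base_theta l.+2.
Proof.
rewrite /base_theta; case: l => [|l] /=.
  rewrite (theta_succ 2); have t2 := th_gt0 2.
  have -> : INR 3 = 3 by rewrite INR_IZR_INZ.
  by right; field; lra.
rewrite (theta_succ l.+3) (theta_succ l.+2).
have t0 := th_gt0 l.+2; set u := theta g _ in t0 *.
have l3 := INR_S_gt0 l.+2; have l4 := INR_S_gt0 l.+3.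
have h : g / INR l.+4 <= g / INR l.+3.
  apply: Rmult_le_compat_l; first by lra.
  by apply: Rinv_le_contravar => //; apply: leq_INR.
have h0 : 0 < g / INR l.+3 by apply: Rdiv_lt_0_compat.
have -> : u * (u * (1 + g / INR l.+3) * (1 + g / INR l.+4)) =
  (u * u * (1 + g / INR l.+3)) * (1 + g / INR l.+4) by ring.
have -> : u * (1 + g / INR l.+3) * (u * (1 + g / INR l.+3)) =
  (u * u * (1 + g / INR l.+3)) * (1 + g / INR l.+3) by ring.
apply: Rmult_le_compat_l; last by lra.
have uu := Rmult_lt_0_compat _ _ t0 t0.
by left; apply: Rmult_lt_0_compat => //; lra.
Qed.

Lemma base_log_concave n : b n * b n.+2 <= b n.+1 * b n.+1.
Proof.
exact: (rec_log_concave base_gt0 base_lc0 base_lc (hn_is_rec base_theta)).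
Qed.

Lemma base_theta_theta l : base_theta l.+2 = theta g l.+2.
Proof. by []. Qed.

Lemma hn_base_gt0 n : 0 < b n.
Proof.
by apply: (is_rec_gt0 _ (base_gt0 0) (hn_is_rec base_theta)) => l; left; apply: base_gt0.
Qed.

Lemma hn_theta_gt0 n : 0 < hn (theta g) n.
Proof. by apply: (is_rec_gt0 _ (th_gt0 1) (hn_is_rec (theta g))) => l; left. Qed.

Lemma hn_base_ratio : is_lim_seq (fun n => b n / b n.+1) 1.
Proof.
exact: (lim_ratio g0 base_gt0 base_theta_theta (hn_is_rec base_theta) base_log_concave).
Qed.

Lemma hn_base_incr n : b n <= b n.+1.
Proof.
have := ratio_lt1 g0 base_gt0 base_theta_theta (hn_is_rec base_theta) base_log_concave n.
have bp := hn_base_gt0 n.+1; move=> /(Rmult_lt_compat_r _ _ _ bp).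
by rewrite -/b; have -> : b n / b n.+1 * b n.+1 = b n by [field; rewrite -/b in bp; lra]; lra.
Qed.

Definition base_const : R := exp (theta g 1 - base_theta 1).

Lemma lim_hn_base : is_lim_seq (fun n => hn (theta g) n / b n) base_const.
Proof.
have e n : hn (theta g) n = perturb b 0 (theta g 1 - base_theta 1) n.
  rewrite -hn_perturb; apply: hn_ext => l; rewrite eqSS /base_theta eqSS.
  by case: eqP => [->|_] /=; ring.
apply: (is_lim_seq_ext (fun n => perturb b 0 (theta g 1 - base_theta 1) n / b n)).
  by move=> n; rewrite e.
apply: (@lim_seq_eq _ (exp ((theta g 1 - base_theta 1) / INR 1) * 1)).
  by rewrite INR_1 Rdiv_1_r Rmult_1_r.
apply: (perturb_lim hn_base_gt0 hn_base_incr hn_base_ratio).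
apply: (is_lim_seq_ext (fun=> 1)); last exact: is_lim_seq_const.
by move=> n; field; have := hn_base_gt0 n; rewrite -/b; lra.
Qed.

(** The weights are removed one at a time, theta_(m+1) by a perturbation with y = - theta_(m+1). *)
Lemma lim_hn_zeroed m :
  is_lim_seq (fun n => hn (fun j => if (j <= m)%N then 0 else theta g j) n / b n)
    (base_const * exp (- \big[Rplus/R0]_(l < m) (theta g l.+1 / INR l.+1))).
Proof.
elim: m => [|m IHm].
  rewrite big_ord0 Ropp_0 exp_0 Rmult_1_r.
  by apply: is_lim_seq_ext lim_hn_base => n; congr (_ / _); apply: hn_ext.
have := perturb_lim hn_base_gt0 hn_base_incr hn_base_ratio (p := m)
  (y := - theta g m.+1) IHm.
set l1 := _ * _; move=> H.
apply: (@lim_seq_eq _ l1).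
  rewrite /l1 big_ord_recr /= Ropp_plus_distr exp_plus /Rdiv -Ropp_mult_distr_l; ring.
apply: is_lim_seq_ext H => n; rewrite -hn_perturb; congr (_ / _); apply: hn_ext => l.
rewrite (leq_eqVlt l.+1 m.+1) eqSS ltnS; case: eqP => [->|lm] /=; first by rewrite ltnn; ring.
by case: ifP => _; ring.
Qed.

Lemma lim_Prob_Rcyc m k :
  is_lim_seq (fun n => Prob (theta g) (fun sg : {perm 'I_n} =>
                [forall j : 'I_m, Rcyc j.+1 sg == k j.+1]))
     (\big[Rmult/R1]_(1 <= j < m.+1) poisson (theta g j / INR j) (k j)).
Proof.
set S := (\sum_(1 <= j < m.+1) j * k j)%N.
set P := \big[Rmult/R1]_(1 <= j < m.+1)
  Rdiv (pow (Rdiv (theta g j) (INR j)) (k j)) (INR (k j)`!).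
set Z := fun j => if (j <= m)%N then 0 else theta g j.
have K0 : 0 < base_const by apply: exp_pos.
have bp := hn_base_gt0; have hp := hn_theta_gt0.
have E : \big[Rmult/R1]_(1 <= j < m.+1) poisson (theta g j / INR j) (k j) =
  P * exp (- \big[Rplus/R0]_(l < m) (theta g l.+1 / INR l.+1)).
  rewrite /P {P S Z}; elim: m => [|m IHm].
    by rewrite !big_nil big_ord0 Ropp_0 exp_0; ring.
  rewrite !(@big_nat_recr _ _ _ m.+1) //= IHm big_ord_recr /= Ropp_plus_distr exp_plus.
  by rewrite /poisson /Rdiv; ring.
rewrite E.
(* The prescribed cycles occupy S points. Starting at n + S makes the truncated subtraction in
   [hfix_full] exact, and each of the three quotients by the yardstick has a known limit. *)
apply: (@lim_seq_shift (fun n => P * ((hn Z n / b n) * (b n / b (n + S)%N) *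
    / (hn (theta g) (n + S)%N / b (n + S)%N))) _ S).
  set e := exp _; apply: (@lim_seq_eq _ (P * ((base_const * e) * 1 * / base_const))).
    by field; lra.
  apply: (is_lim_seq_scal_l _ P (Finite ((base_const * e) * 1 * / base_const))).
  apply: is_lim_seq_mult'.
    apply: is_lim_seq_mult'; first exact: lim_hn_zeroed.
    exact: (ratio_shift hn_base_gt0 hn_base_ratio).
  apply: (is_lim_seq_inv _ (Finite base_const)); last by case; lra.
  apply: (is_lim_seq_ext (fun n => hn (theta g) (n + S)%coq_nat / b (n + S)%coq_nat)) => //.
  exact: (proj1 (is_lim_seq_incr_n _ S _) lim_hn_base).
move=> n; rewrite Prob_hfix hfix_full ?leq_addl // addnK -/Z -/P.
have := bp n; have := bp (n + S)%N; have := hp (n + S)%N => h1 h2 h3.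
by rewrite -/b in h2 h3 *; rewrite -/S; field; lra.
Qed.

End Base.

(** * Uniform estimates *)

Lemma lim_infty_ge (u : nat -> R) K : is_lim_seq u p_infty ->
  exists n0, forall n, (n0 <= n)%N -> K < u n.
Proof. by move=> /is_lim_seq_spec /(_ K) [n0 H]; exists n0 => n /leP; apply: H. Qed.

Lemma exp_pow x j : pow (exp x) j = exp (x * INR j).
Proof.
elim: j => [|j IHj]; first by rewrite pow_O; change (INR 0) with 0; rewrite Rmult_0_r exp_0.
by rewrite -tech_pow_Rmult IHj -exp_plus S_INR; congr exp; ring.
Qed.

Section Scale.
Variable g : R.
Hypothesis g0 : 0 < g.

Definition scale (n : nat) : R := Rpower (INR n) (/ (1 + g)).

Lemma scale_gt0 n : 0 < scale n. Proof. exact: exp_pos. Qed.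

Let p_gt0 : 0 < / (1 + g). Proof. by apply: Rinv_0_lt_compat; lra. Qed.

Lemma scale_infty : is_lim_seq scale p_infty.
Proof. exact: lim_Rpower_infty. Qed.

Lemma scale_pow n : (0 < n)%N -> Rpower (scale n) g * scale n = INR n.
Proof.
move=> n0; rewrite -{2}[scale n]Rpower_1; last exact: scale_gt0.
rewrite -Rpower_plus Rpower_mult (Rplus_comm g) Rinv_l ?Rpower_1 //; last by lra.
exact: INR_gt0.
Qed.

Lemma lim_scale_pow : is_lim_seq (fun n => Rpower (scale n) g) p_infty.
Proof.
apply: (is_lim_seq_ext (fun n => Rpower (INR n) (/ (1 + g) * g))).
  by move=> n; rewrite Rpower_mult.
by apply: lim_Rpower_infty; apply: Rmult_lt_0_compat.
Qed.

Lemma lim_scale_powN : is_lim_seq (fun n => Rpower (scale n) (- g)) 0.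
Proof.
apply: (is_lim_seq_ext (fun n => / Rpower (scale n) g)); first by move=> n; rewrite Rpower_Ropp.
exact: (is_lim_seq_inv _ p_infty lim_scale_pow).
Qed.

Lemma lim_scale_over : is_lim_seq (fun n => scale n / INR n) 0.
Proof.
apply: is_lim_seq_ext_loc lim_scale_powN; exists 1%N => -[|n] hn; first by inversion hn.
rewrite -(@scale_pow n.+1) // Rpower_Ropp.
by field; split; apply: Rgt_not_eq; [exact: scale_gt0|exact: exp_pos].
Qed.

(** Since [scale n] is o(n), n - j stays large uniformly over the whole window of j. *)
Lemma scale_far T n1 : exists n0, forall n, (n0 <= n)%N ->
  forall j : nat, INR j <= T * scale n -> (j + n1 <= n)%N.
Proof.
have L : is_lim_seq (fun n => Rabs T * (scale n / INR n)) 0.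
  by apply: (@lim_seq_eq _ (Rabs T * 0)); [ring|apply: (is_lim_seq_scal_l _ (Rabs T) 0 lim_scale_over)].
have [n2 H2] := proj1 (lim_seqP _ _) L (/ 2) ltac:(lra).
exists (maxn n2 (n1 + n1)).+1 => -[//|n]; rewrite ltnS geq_max => /andP[n2n n1n] j jT.
have n0 := INR_S_gt0 n.
have := H2 n.+1 (leqW n2n); rewrite Rminus_0_r => /Rabs_def2[h _].
have h1 : Rabs T * scale n.+1 < / 2 * INR n.+1.
  by apply/Rlt_div_l => //; rewrite /Rdiv Rmult_assoc.
have h2 := leq_INR (leqW n1n); rewrite plus_INR in h2.
have h3 : T * scale n.+1 <= Rabs T * scale n.+1.
  by apply: Rmult_le_compat_r (Rle_abs T); left; exact: scale_gt0.
apply/leP; apply: INR_le; rewrite plus_INR; lra.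
Qed.

End Scale.

Section Uniform.
Variable g : R.
Hypothesis g0 : 0 < g.
Let N := scale g.
Let b := hn (base_theta g).
Let h := hn (theta g).
Let r n := b n / b n.+1.
Let a := Rpower (Gamma (g + 1)) (/ (g + 1)).

Let a_gt0 : 0 < a. Proof. exact: exp_pos. Qed.
Let N_gt0 n : 0 < N n. Proof. exact: scale_gt0. Qed.
Let b_gt0 n : 0 < b n. Proof. exact: hn_base_gt0. Qed.
Let r_gt0 n : 0 < r n. Proof. exact: Rdiv_lt_0_compat. Qed.
Let r_lt1 n : r n < 1.
Proof.
exact: (ratio_lt1 g0 (base_gt0 g0) (@base_theta_theta g) (hn_is_rec (base_theta g))
  (base_log_concave g0)).
Qed.

(** The limit of the gap is used at n - j; replacing N (n - j) by N n costs a factor between 1 and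
    (1 - T N / n)^(-1/(1+g)), which tends to 1. *)
Lemma gap_uniform T e : 0 < T -> 0 < e -> exists n0, forall n, (n0 <= n)%N ->
  forall j : nat, INR j <= T * N n -> (j <= n)%N /\ Rabs ((1 - r (n - j)) * N n - a) < e.
Proof.
move=> T0 e0.
pose eta := Rmin 1 (e / 4 / a).
have eta0 : 0 < eta by apply: Rmin_pos; [lra|do 2!apply: Rdiv_lt_0_compat => //; lra].
have L1 : is_lim_seq (fun n => Rpower (/ (1 - T * (N n / INR n))) (/ (1 + g))) 1.
  apply: (@lim_seq_eq _ (Rpower (/ (1 - T * 0)) (/ (1 + g)))).
    by rewrite Rmult_0_r Rminus_0_r Rinv_1 /Rpower ln_1 Rmult_0_r exp_0.
  apply: lim_Rpower; first by rewrite Rmult_0_r Rminus_0_r Rinv_1; lra.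
  apply: (is_lim_seq_inv _ (Finite (1 - T * 0))); last by case; lra.
  apply: is_lim_seq_minus'; first exact: is_lim_seq_const.
  by apply: (is_lim_seq_scal_l _ T 0); apply: lim_scale_over.
have [n1 H1] := proj1 (lim_seqP _ _) L1 _ eta0.
have e4 : 0 < e / 4 by lra.
have := lim_gap g0 (base_gt0 g0) (@base_theta_theta g) (hn_is_rec (base_theta g))
  (base_log_concave g0).
move=> /lim_seqP /(_ _ e4) [n2 H2].
have [n3 H3] := scale_far g0 T (n2 + 1).
have L0 : is_lim_seq (fun n => T * (N n / INR n)) 0.
  by apply: (@lim_seq_eq _ (T * 0)); [ring|apply: (is_lim_seq_scal_l _ T 0); apply: lim_scale_over].
have [n4 H4] := proj1 (lim_seqP _ _) L0 (/ 2) ltac:(lra).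
exists (maxn (maxn n1 n3) n4).+1 => -[//|n]; rewrite ltnS !geq_max => /andP[/andP[n1n n3n] n4n] j jT.
have nj := H3 n.+1 (leqW n3n) j jT.
have jn : (j <= n.+1)%N by apply: leq_trans nj; rewrite leq_addr.
split=> //; set m := (n.+1 - j)%N.
have mE : (n2 + 1 <= m)%N by rewrite leq_subRL.
have m0 : (0 < m)%N by apply: leq_trans mE; rewrite addn1.
have m0' := INR_gt0 m0; have n0 := INR_S_gt0 n.
have mn : INR m = INR n.+1 - INR j by rewrite /m minus_INR //; exact/leP.
have hm := H2 m (leq_trans (leq_addr _ _) mE).
have h4 := H4 n.+1 (leqW n4n); rewrite Rminus_0_r in h4; have [h4' _] := Rabs_def2 _ _ h4.
have jTn : INR j / INR n.+1 <= T * (N n.+1 / INR n.+1).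
  by rewrite /Rdiv -Rmult_assoc; apply: Rmult_le_compat_r => //; left; apply: Rinv_0_lt_compat.
have j0 := pos_INR j.
have q1 : 1 <= N n.+1 / N m.
  apply/Rle_div_r => //; rewrite Rmult_1_l; apply: Rle_Rpower_l; last by lra.
  by left; apply: Rinv_0_lt_compat; lra.
have q2 : N n.+1 / N m <= 1 + eta.
  have := H1 n.+1 (leqW n1n) => /Rabs_def2[hq _].
  suff : N n.+1 / N m <= Rpower (/ (1 - T * (N n.+1 / INR n.+1))) (/ (1 + g)) by lra.
  have -> : N n.+1 / N m = Rpower (INR n.+1 / INR m) (/ (1 + g)).
    by rewrite /N /scale /Rpower /Rdiv -exp_Ropp -exp_plus ln_mult ?ln_Rinv //;
      [congr exp; ring|apply: Rinv_0_lt_compat].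
  apply: Rle_Rpower_l; first by left; apply: Rinv_0_lt_compat; lra.
  split; first exact: Rdiv_lt_0_compat.
  have -> : INR n.+1 / INR m = / (1 - INR j / INR n.+1).
    by rewrite mn; field; rewrite mn in m0'; lra.
  by apply: Rinv_le_contravar; lra.
have -> : (1 - r m) * N n.+1 - a =
  ((1 - r m) * N m - a) * (N n.+1 / N m) + a * (N n.+1 / N m - 1).
  by field; have := N_gt0 m; lra.
have eta1 : eta <= 1 by apply: Rmin_l.
have etae : a * eta <= e / 4.
  have : eta <= e / 4 / a by apply: Rmin_r.
  by move=> /(Rmult_le_compat_l a _ _ (Rlt_le _ _ a_gt0)); have -> : a * (e / 4 / a) = e / 4 by field; lra.
set q := N _ / N _ in q1 q2 *.
apply: Rle_lt_trans (Rabs_triang _ _) _; rewrite !(Rabs_mult _ q) (Rabs_mult a).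
rewrite (Rabs_pos_eq q); last by lra.
rewrite (Rabs_pos_eq a); last by lra.
rewrite (Rabs_pos_eq (q - 1)); last by lra.
have hm' : Rabs ((1 - r m) * N m - a) < e / 4 := hm.
have := Rabs_pos ((1 - r m) * N m - a).
set A := Rabs _ in hm' *.
by nra.
Qed.

Lemma ratio_uniform T e : 0 < T -> 0 < e -> exists n0, forall n, (n0 <= n)%N ->
  forall j : nat, INR j <= T * N n -> (j <= n)%N /\
    exp (- ((a + e) * (INR j / N n))) <= b (n - j)%N / b n <= exp (- ((a - e) * (INR j / N n))).
Proof.
move=> T0 e0.
have e2 : 0 < e / 2 by lra.
(* The window T + 1 also contains j = 1: the lower bound uses r_(n-j)^j, the upper one r_(n-1)^j. *)
have [n1 H1] := gap_uniform (Rplus_lt_0_compat _ _ T0 Rlt_0_1) e2.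
(* This makes (a + e) x <= e / 2 for x = 1 - r_(n-j), so that x N < a + e / 2 improves to x N / (1 -
   x) <= a + e. *)
have [n2 H2] := lim_infty_ge (2 * (a + e) * (a + e) / e) (scale_infty g0).
have [n3 H3] := lim_infty_ge 1 (scale_infty g0).
exists (maxn (maxn n1 n2) n3).+1 => -[//|n]; rewrite ltnS !geq_max => /andP[/andP[n1n n2n] n3n] j jT.
have Np := N_gt0 n.+1; have j0 := pos_INR j.
have Nbig := H2 n.+1 (leqW n2n); have N1 := H3 n.+1 (leqW n3n); rewrite -/N in Nbig N1.
have jT' : INR j <= (T + 1) * N n.+1 by nra.
have [jn hj] := H1 n.+1 (leqW n1n) j jT'; split=> //.
have jN0 : 0 <= INR j / N n.+1 by apply: Rmult_le_pos => //; left; apply: Rinv_0_lt_compat.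
split.
  have := ratio_pow_le (base_gt0 g0) (hn_is_rec (base_theta g)) (base_log_concave g0) (n.+1 - j) j.
  rewrite subnK // -/b -/(r (n.+1 - j)) => hb.
  apply: (Rle_trans _ (r (n.+1 - j) ^ j)); last by apply/Rle_div_r.
  set x := 1 - r (n.+1 - j) in hj.
  have rE : r (n.+1 - j) = 1 - x by rewrite /x; ring.
  have x0 : 0 < x by rewrite /x; have := r_lt1 (n.+1 - j); lra.
  have [hj1 hj2] := Rabs_def2 _ _ hj.
  have xs : (a + e) * x <= e / 2.
    have h1 : x * N n.+1 < a + e by lra.
    have h2 : 2 * (a + e) * (a + e) < N n.+1 * e by apply/Rlt_div_l.
    apply: (Rmult_le_reg_r (N n.+1)) => //.
    by nra.
  have x1 : x < 1 by have := r_gt0 (n.+1 - j); rewrite rE; lra.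
  have hx : exp (- (x / (1 - x))) <= 1 - x.
    rewrite -[X in _ <= X]exp_ln; last by lra.
    apply: exp_le; have := @ln_ge_1sub (1 - x) ltac:(lra).
    suff -> : 1 - / (1 - x) = - (x / (1 - x)) by [].
    by field; lra.
  rewrite rE; apply: (Rle_trans _ (exp (- (x / (1 - x))) ^ j)); last first.
    by apply: pow_incr; split=> //; left; apply: exp_pos.
  rewrite exp_pow; apply: exp_le.
  have : x / (1 - x) * INR j <= (a + e) * (INR j / N n.+1); last by lra.
  have -> : x / (1 - x) * INR j = (x * N n.+1 / (1 - x)) * (INR j / N n.+1) by field; lra.
  by apply: Rmult_le_compat_r => //; apply/Rle_div_l; [lra|nra].
case: (posnP j) => [->|jp].
  rewrite subn0; change (INR 0) with 0; rewrite /Rdiv Rmult_0_l Rmult_0_r Ropp_0 exp_0.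
  by right; field; have := b_gt0 n.+1; lra.
have one : INR 1 <= (T + 1) * N n.+1 by rewrite INR_1; nra.
have [_] := H1 n.+1 (leqW n1n) 1%N one; rewrite subn1 /= => /Rabs_def2[h1 h2].
have := ratio_pow_ge (base_gt0 g0) (hn_is_rec (base_theta g)) (base_log_concave g0)
  (n := n) (m := (n.+1 - j)%N) (j := j).
rewrite subnK // leqnn -/b -/(r n) => /(_ isT) hb.
apply: (Rle_trans _ (r n ^ j)); first by apply/Rle_div_l.
apply: (Rle_trans _ (exp (- (1 - r n)) ^ j)).
  apply: pow_incr; split; first by left.
  by have := exp_ineq1_le (- (1 - r n)); lra.
rewrite exp_pow; apply: exp_le.
have -> : - (1 - r n) * INR j = - (((1 - r n) * N n.+1) * (INR j / N n.+1)) by field; lra.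
by apply: Ropp_le_contravar; apply: Rmult_le_compat_r => //; lra.
Qed.

Lemma quotient_uniform T e : 0 < T -> 0 < e -> exists n0, forall n, (n0 <= n)%N ->
  forall j : nat, INR j <= T * N n -> (j <= n)%N /\
    (1 - e) * exp (- ((a + e) * (INR j / N n))) <= h (n - j)%N / h n
      <= (1 + e) * exp (- ((a - e) * (INR j / N n))).
Proof.
move=> T0 e0; have [n1 H1] := ratio_uniform T0 e0.
have K0 : 0 < base_const g by apply: exp_pos.
pose e' := Rmin 1 e; have e'0 : 0 < e' by apply: Rmin_pos; lra.
have e'e : e' <= e by apply: Rmin_r.
have e'1 : e' <= 1 by apply: Rmin_l.
have ke : 0 < base_const g * (e' / 4) by apply: Rmult_lt_0_compat; lra.
have := lim_hn_base g0; move=> /lim_seqP /(_ _ ke) [n2 H2]; rewrite -/b -/h in H2.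
have [n3 H3] := scale_far g0 T n2.
exists (maxn (maxn n1 n2) n3) => n; rewrite !geq_max => /andP[/andP[n1n n2n] n3n] j jT.
have [jn [lo up]] := H1 n n1n j jT; split=> //.
have nj : (n2 <= n - j)%N by rewrite leq_subRL // H3.
have c1 := H2 _ nj; have c2 := H2 _ n2n.
have hp := hn_theta_gt0 g0 n; rewrite -/h in hp.
have bp := b_gt0 n; have bjp := b_gt0 (n - j)%N.
have -> : h (n - j)%N / h n = ((h (n - j)%N / b (n - j)%N) / (h n / b n)) * (b (n - j)%N / b n).
  by field; lra.
set c := h (n - j)%N / _ in c1 *; set d := h n / b n in c2 *.
set K := base_const g in K0 ke c1 c2.
have [c11 c12] := Rabs_def2 _ _ c1; have [c21 c22] := Rabs_def2 _ _ c2.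
have d0 : 0 < d by nra.
have lo' : 1 - e <= c / d.
  apply: (Rle_trans _ (1 - e')); first by lra.
  by apply/Rle_div_r => //; nra.
have up' : c / d <= 1 + e.
  apply: (Rle_trans _ (1 + e')); last by lra.
  by apply/Rle_div_l => //; nra.
have cd0 : 0 < c / d by apply: Rdiv_lt_0_compat => //; nra.
have E1 := exp_pos (- ((a + e) * (INR j / N n))).
have E2 := exp_pos (- ((a - e) * (INR j / N n))).
split.
  apply: (Rle_trans _ (c / d * exp (- ((a + e) * (INR j / N n))))).
    by apply: Rmult_le_compat_r => //; left.
  by apply: Rmult_le_compat_l => //; left.
apply: Rmult_le_compat => //; first by left.
by left; apply: Rdiv_lt_0_compat.
Qed.

End Uniform.

(** * Abelian estimates *)

Section Abel.
Variable g : R.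
Hypothesis g0 : 0 < g.
Let N := scale g.
Let G := Gamma g.
Let d j := G * risp (g - 1) j.

Let G_gt0 : 0 < G. Proof. exact: Gamma_gt0. Qed.
Let N_gt0 n : 0 < N n. Proof. exact: scale_gt0. Qed.
Let d_gt0 j : 0 < d j.
Proof. by apply: Rmult_lt_0_compat => //; apply: risp_gt0; lra. Qed.

(** Thus theta_j / j = d_j + g d_j / j, where the d_j are the coefficients of Gamma(g) (1 - z)^(-g)
    and the second term is of lower order. *)
Lemma theta_split j : theta g j = d j * (g + INR j).
Proof.
rewrite theta_risp // Gamma_succ // /d -/G.
have e k : risp g k * g = risp (g - 1) k * (g + INR k).
  elim: k => [|k IHk]; first by rewrite !risp0; change (INR 0) with 0; ring.
  rewrite !rispS; have := INR_S_gt0 k => k0.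
  have -> : risp g k * (1 + g / INR k.+1) * g = (risp g k * g) * (1 + g / INR k.+1) by ring.
  by rewrite IHk; move: k0; rewrite S_INR => k0; field; lra.
have -> : g * G * risp g j = G * (risp g j * g) by ring.
by rewrite e; ring.
Qed.

Let z c n := exp (- (c / N n)).

Let z_lt1 c n : 0 < c -> 0 <= z c n < 1.
Proof.
move=> c0; split; first by left; apply: exp_pos.
rewrite -exp_0; apply: exp_increasing.
by have := Rdiv_lt_0_compat _ _ c0 (N_gt0 n); lra.
Qed.

Lemma lim_scale_gap c : 0 < c -> is_lim_seq (fun n => N n * (1 - z c n)) c.
Proof.
move=> c0.
have L : is_lim_seq (fun n => c / (1 + c * / N n)) c.
  apply: (@lim_seq_eq _ (c * / (1 + c * 0))); first by field.
  apply: (is_lim_seq_scal_l _ c (Finite (/ (1 + c * 0)))).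
  apply: (is_lim_seq_inv _ (Finite (1 + c * 0))); last by case; lra.
  apply: is_lim_seq_plus'; first exact: is_lim_seq_const.
  apply: (is_lim_seq_scal_l _ c 0).
  exact: (is_lim_seq_inv _ p_infty (scale_infty g0)).
apply: (is_lim_seq_le_le _ _ _ _ _ L (is_lim_seq_const c)) => n.
have Np := N_gt0 n; have u0 := Rdiv_lt_0_compat _ _ c0 Np.
have h1 : 1 - c / N n <= z c n by have := exp_ineq1_le (- (c / N n)); rewrite /z; lra.
have h2 : z c n <= / (1 + c / N n).
  rewrite /z exp_Ropp; apply: Rinv_le_contravar; first by lra.
  exact: exp_ineq1_le.
split.
  have -> : c / (1 + c * / N n) = N n * (1 - / (1 + c / N n)) by field; lra.
  by apply: Rmult_le_compat_l; lra.
have {2}-> : c = N n * (c / N n) by field; lra.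
by apply: Rmult_le_compat_l; lra.
Qed.

Let scaled_power (p c : R) n : 0 < c ->
  Rpower (N n) p * Rpower (1 - z c n) p = Rpower (N n * (1 - z c n)) p.
Proof. by move=> c0; rewrite Rpower_mult_distr //; have := z_lt1 n c0; lra. Qed.

Let exp_z c n (l : nat) : exp (- (c * (INR l / N n))) = z c n ^ l.
Proof. by rewrite /z exp_pow; congr exp; rewrite /Rdiv; ring. Qed.

Let V c n := Rpower (N n) (- g) * (G * Rpower (1 - z c n) (- g)).

Let lim_V c : 0 < c -> is_lim_seq (V c) (G * Rpower c (- g)).
Proof.
move=> c0; apply: (is_lim_seq_ext (fun n => G * Rpower (N n * (1 - z c n)) (- g))).
  by move=> n; rewrite /V -scaled_power //; ring.
apply: (is_lim_seq_scal_l _ G (Rpower c (- g))).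
by apply: lim_Rpower => //; apply: lim_scale_gap.
Qed.

Let sum_d_le c n p : 0 < c ->
  \big[Rplus/R0]_(j < p) (d j * z c n ^ j) <= G * Rpower (1 - z c n) (- g).
Proof.
move=> c0; have := @sum_risp_le (g - 1) ltac:(lra) (z c n) p (z_lt1 n c0).
have -> : g - 1 + 1 = g by ring.
move=> /(Rmult_le_compat_l G _ _ (Rlt_le _ _ G_gt0)).
rewrite big_distrr /=; set S := bigop _ _ _; set S' := bigop _ _ _.
suff -> : S = S' by [].
by apply: eq_bigr => j _; rewrite /d Rmult_assoc.
Qed.

(** Beyond J the correction g d_j / j is at most dl d_j; the first J corrections add up to at most
    the constant A, which the factor N^(-g) kills. The bound is uniform in M because all terms are
    positive. *)
Lemma Abel_upper c e : 0 < c -> 0 < e -> exists n0, forall n, (n0 <= n)%N -> forall M,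
  Rpower (N n) (- g) * \big[Rplus/R0]_(l < M)
     (theta g l.+1 / INR l.+1 * exp (- (c * (INR l.+1 / N n)))) <= G * Rpower c (- g) + e.
Proof.
move=> c0 e0; set L := G * Rpower c (- g).
have L0 : 0 < L by apply: Rmult_lt_0_compat => //; apply: exp_pos.
pose dl := e / 2 / (L + 1).
have dl0 : 0 < dl by apply: Rdiv_lt_0_compat; lra.
have [J HJ] := INR_unbounded (g / dl).
pose A := g * \big[Rplus/R0]_(l < J) d l.+1.
have Lim : is_lim_seq (fun n => (1 + dl) * V c n + A * Rpower (N n) (- g)) ((1 + dl) * L + A * 0).
  apply: is_lim_seq_plus'.
    by apply: (is_lim_seq_scal_l _ (1 + dl) L); apply: lim_V.
  by apply: (is_lim_seq_scal_l _ A 0); apply: lim_scale_powN.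
have [n0 H0] := proj1 (lim_seqP _ _) Lim (e / 2) ltac:(lra).
exists n0 => n n0n M; have [h _] := Rabs_def2 _ _ (H0 n n0n).
have dlL : dl * L <= e / 2.
  rewrite /dl; have -> : e / 2 / (L + 1) * L = (e / 2) * (L / (L + 1)) by field; lra.
  rewrite -[X in _ <= X]Rmult_1_r; apply: Rmult_le_compat_l; first by lra.
  by apply/Rle_div_l; lra.
have zn := z_lt1 n c0; set x := z c n in zn.
have xp j : 0 <= x ^ j <= 1.
  split; first by apply: pow_le; lra.
  by rewrite -(pow1 j); apply: pow_incr; lra.
have key m : \big[Rplus/R0]_(l < m) (theta g l.+1 / INR l.+1 * x ^ l.+1) <=
    (1 + dl) * \big[Rplus/R0]_(l < m) (d l.+1 * x ^ l.+1) + g * \big[Rplus/R0]_(l < minn m J) d l.+1.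
  elim: m => [|m IHm]; first by rewrite min0n !big_ord0; lra.
  rewrite (sumR_recr (fun l => theta g l.+1 / INR l.+1 * x ^ l.+1)).
  rewrite (sumR_recr (fun l => d l.+1 * x ^ l.+1)).
  have m0 := INR_S_gt0 m; have dm := d_gt0 m.+1; have [xm0 xm1] := xp m.+1.
  have tE : theta g m.+1 / INR m.+1 * x ^ m.+1 = d m.+1 * x ^ m.+1 + g / INR m.+1 * (d m.+1 * x ^ m.+1).
    by rewrite theta_split; field; lra.
  have dx0 : 0 <= d m.+1 * x ^ m.+1 by apply: Rmult_le_pos; lra.
  case: (leqP J m) => mJ.
    move: IHm; rewrite !(minn_idPr _) ?leqW // => IHm.
    have : g / INR m.+1 <= dl.
      apply/Rle_div_l => //; have := leq_INR (leqW mJ).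
      by move: HJ => /Rlt_div_l; nra.
    by move=> /(Rmult_le_compat_r _ _ _ dx0); lra.
  move: IHm; rewrite !(minn_idPl _) ?(ltnW mJ) // => IHm.
  rewrite (sumR_recr (fun l => d l.+1)).
  have h1 : g / INR m.+1 * (d m.+1 * x ^ m.+1) <= g * d m.+1.
    have m1 : 1 <= INR m.+1 by rewrite -INR_1; apply: leq_INR.
    have -> : g / INR m.+1 * (d m.+1 * x ^ m.+1) = (g * d m.+1) * (x ^ m.+1 / INR m.+1) by field; lra.
    rewrite -[X in _ <= X]Rmult_1_r; apply: Rmult_le_compat_l.
      by apply: Rmult_le_pos; lra.
    by apply/Rle_div_l; lra.
  by have := Rmult_le_pos _ _ (Rlt_le _ _ dl0) dx0; lra.
have keyM := key M.
have s1 : \big[Rplus/R0]_(l < M) (d l.+1 * x ^ l.+1) <= G * Rpower (1 - x) (- g).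
  have := @sum_d_le c n M.+1 c0; rewrite -/x (sumR_recl (fun j => d j * x ^ j)) pow_O.
  by have := d_gt0 0; lra.
have s2 : g * \big[Rplus/R0]_(l < minn M J) d l.+1 <= A.
  apply: Rmult_le_compat_l; first by lra.
  by apply: (@sumR_ord_mono (fun l => d l.+1)) => [i|]; [left|exact: geq_minr].
have P0 : 0 < Rpower (N n) (- g) by exact: exp_pos.
under eq_bigr => l _ do rewrite exp_z -/x.
set S := bigop _ _ _ in keyM *; set S' := bigop _ _ _ in keyM s1.
have : S <= (1 + dl) * (G * Rpower (1 - x) (- g)) + A by nra.
move=> /(Rmult_le_compat_l _ _ _ (Rlt_le _ _ P0)).
by rewrite /V -/x in h; lra.
Qed.

(** The correction g d_j / j is positive and is dropped. The part of the d-series beyond M is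
    bounded by its first moment, and j d_j <= theta_j yields the loss proportional to 1 / T. *)
Lemma Abel_lower c T e : 0 < c -> 0 < T -> 0 < e ->
  exists n0, forall n, (n0 <= n)%N -> forall M, T * N n < INR M.+1 ->
  G * Rpower c (- g) - Gamma (g + 1) * Rpower c (- (g + 1)) / T - e <=
  Rpower (N n) (- g) * \big[Rplus/R0]_(l < M)
     (theta g l.+1 / INR l.+1 * exp (- (c * (INR l.+1 / N n)))).
Proof.
move=> c0 T0 e0; set L := G * Rpower c (- g).
set G1 := Gamma (g + 1).
have G10 : 0 < G1 by apply: Gamma_gt0; lra.
pose B n := V c n - d 0 * Rpower (N n) (- g) -
  G1 / T * Rpower (N n * (1 - z c n)) (- (g + 1)).
have Lim : is_lim_seq B (L - d 0 * 0 - G1 / T * Rpower c (- (g + 1))).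
  apply: is_lim_seq_minus'.
    apply: is_lim_seq_minus'; first exact: lim_V.
    by apply: (is_lim_seq_scal_l _ (d 0) 0); apply: lim_scale_powN.
  apply: (is_lim_seq_scal_l _ (G1 / T) (Rpower c (- (g + 1)))).
  by apply: lim_Rpower => //; apply: lim_scale_gap.
have [n0 H0] := proj1 (lim_seqP _ _) Lim e e0.
exists n0 => n n0n M TM; have [_ h] := Rabs_def2 _ _ (H0 n n0n).
have zn := z_lt1 n c0; under eq_bigr => l _ do rewrite exp_z.
have Np := N_gt0 n; have iM := INR_S_gt0 M.
set x := z c n in zn *.
have xp j : 0 <= x ^ j by apply: pow_le; lra.
set S := bigop _ _ _.
pose X := \big[Rplus/R0]_(l < M) (d l.+1 * x ^ l.+1).
have XS : X <= S.
  apply: sumR_le => l _; apply: Rmult_le_compat_r => //.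
  have l0 := INR_S_gt0 l; have dl := d_gt0 l.+1.
  have -> : theta g l.+1 / INR l.+1 = d l.+1 + d l.+1 * (g / INR l.+1).
    by rewrite theta_split; field; lra.
  by have := Rmult_lt_0_compat _ _ dl (Rdiv_lt_0_compat _ _ g0 l0); lra.
have up p : \big[Rplus/R0]_(j < p) (d j * x ^ j) <=
    d 0 + X + / INR M.+1 * (G1 * Rpower (1 - x) (- (g + 1))).
  apply: Rle_trans (@sumR_tail (fun j => d j * x ^ j) M p _) _.
    by move=> j; apply: Rmult_le_pos; [left|].
  rewrite (sumR_recl (fun j => d j * x ^ j)) pow_O Rmult_1_r -/X.
  apply: Rplus_le_compat_l; apply: Rmult_le_compat_l; first by left; apply: Rinv_0_lt_compat.
  apply: Rle_trans (sum_theta_le g0 p zn); apply: sumR_le => j _.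
  rewrite -Rmult_assoc; apply: Rmult_le_compat_r => //.
  by rewrite theta_split; have := d_gt0 j; nra.
have Lx : is_lim_seq (fun p => \big[Rplus/R0]_(j < p) (d j * x ^ j)) (G * Rpower (1 - x) (- g)).
  apply: (is_lim_seq_ext (fun p => G * \big[Rplus/R0]_(j < p) (risp (g - 1) j * x ^ j))).
    by move=> p; rewrite big_distrr /=; apply: eq_bigr => j _; rewrite /d Rmult_assoc.
  have := @sum_risp_lim (g - 1) ltac:(lra) x zn; have -> : g - 1 + 1 = g by ring.
  exact: (is_lim_seq_scal_l _ G (Finite (Rpower (1 - x) (- g)))).
have := is_lim_seq_le _ _ _ _ up Lx (is_lim_seq_const _) => /= {}up.
set P := Rpower (N n) (- g) in h *; have P0 : 0 < P by exact: exp_pos.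
have t1 : P * (/ INR M.+1 * (G1 * Rpower (1 - x) (- (g + 1)))) <=
   G1 / T * Rpower (N n * (1 - x)) (- (g + 1)).
  rewrite -scaled_power //.
  have -> : Rpower (N n) (- (g + 1)) = P / N n.
    have -> : - (g + 1) = - g + - (1) by ring.
    by rewrite Rpower_plus (Rpower_Ropp _ 1) Rpower_1.
  rewrite -/x; set W := Rpower (1 - x) _.
  have -> : G1 / T * (P / N n * W) = P * (/ (T * N n) * (G1 * W)) by field; lra.
  apply: Rmult_le_compat_l; first by left.
  apply: Rmult_le_compat_r; first by left; apply: Rmult_lt_0_compat => //; apply: exp_pos.
  apply: Rinv_le_contravar; last by lra.
  exact: Rmult_lt_0_compat.
move: up => /(Rmult_le_compat_l _ _ _ (Rlt_le _ _ P0)) up.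
have := Rmult_le_compat_l _ _ _ (Rlt_le _ _ P0) XS.
rewrite /B /V -/x -/P in h; rewrite /Rdiv in h t1 *; lra.
Qed.

End Abel.

(** * The expected number of cycles *)

Section Limits.
Variable g : R.
Hypothesis g0 : 0 < g.
Let N := scale g.
Let h := hn (theta g).
Let a := Rpower (Gamma (g + 1)) (/ (g + 1)).

Let a_gt0 : 0 < a. Proof. exact: exp_pos. Qed.
Let N_gt0 n : 0 < N n. Proof. exact: scale_gt0. Qed.
Let h_gt0 n : 0 < h n. Proof. exact: hn_theta_gt0. Qed.
Let th_gt0 n : 0 < theta g n. Proof. exact: theta_gt0. Qed.

(** Total mass of the law of L_1 multiplied by n; it controls the contribution of long cycles to
    E(K), since 1 / l <= 1 / (M + 1) for l > M. *)
Lemma sum_theta_quotient n :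
  \big[Rplus/R0]_(l < n) (theta g l.+1 * (h (n - l.+1)%N / h n)) = INR n.
Proof.
have hp := h_gt0 n; case: n hp => [|n] hp; first by rewrite big_ord0.
apply: (Rmult_eq_reg_r (h n.+1)); last by lra.
rewrite /h hn_rec big_distrl /=; apply: eq_bigr => l _; rewrite subSS.
by rewrite -/h; field; lra.
Qed.

Lemma lim_Expect_Kcyc :
  is_lim_seq (fun n => Rpower (INR n) (- (g / (g + 1))) *
     Expect (theta g) (fun sg : {perm 'I_n} => INR (Kcyc sg)))
   (Rpower (Gamma g / Rpower g g) (/ (g + 1))).
Proof.
have G0 := Gamma_gt0 g0.
have G10 : 0 < Gamma (g + 1) by apply: Gamma_gt0; lra.
set Lim := Rpower _ _.
have LE : Lim = Gamma g * Rpower a (- g).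
  rewrite /Lim /a Gamma_succ // Rpower_mult /Rpower.
  rewrite -{2}(exp_ln _ G0) -exp_plus; congr exp.
  rewrite ln_div //; last by apply: exp_pos.
  by rewrite ln_exp ln_mult //; field; lra.
(* The bounds produced by the uniform and Abelian estimates with error dl depend continuously on dl
   and equal the limit at dl = 0; dl is found among the numbers 1 / (n + 1). *)
have phi e : 0 < e -> exists dl, 0 < dl < a / 2 /\ dl < 1 /\ 
   (1 + dl) * (Gamma g * Rpower (a - dl) (- g) + dl) <= Lim + e /\ 
   Lim - e <= (1 - dl) * (Gamma g * Rpower (a + dl) (- g) - dl).
  move=> e0.
  have c0 : is_lim_seq (fun n => / INR n.+1) 0 by exact: lim_inv_INR.
  have U : is_lim_seq (fun n => (1 + / INR n.+1) * (Gamma g * Rpower (a - / INR n.+1) (- g) + / INR n.+1)) Lim.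
    apply: (@lim_seq_eq _ ((1 + 0) * (Gamma g * Rpower (a - 0) (- g) + 0))).
      by rewrite LE Rminus_0_r; ring.
    apply: is_lim_seq_mult'; first by apply: is_lim_seq_plus' => //; apply: is_lim_seq_const.
    apply: is_lim_seq_plus' => //; apply: (is_lim_seq_scal_l _ (Gamma g) (Rpower (a - 0) (- g))).
    apply: lim_Rpower; first by lra.
    by apply: is_lim_seq_minus' => //; apply: is_lim_seq_const.
  have D : is_lim_seq (fun n => (1 - / INR n.+1) * (Gamma g * Rpower (a + / INR n.+1) (- g) - / INR n.+1)) Lim.
    apply: (@lim_seq_eq _ ((1 - 0) * (Gamma g * Rpower (a + 0) (- g) - 0))).
      by rewrite LE Rplus_0_r; ring.
    apply: is_lim_seq_mult'; first by apply: is_lim_seq_minus' => //; apply: is_lim_seq_const.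
    apply: is_lim_seq_minus' => //; apply: (is_lim_seq_scal_l _ (Gamma g) (Rpower (a + 0) (- g))).
    apply: lim_Rpower; first by lra.
    by apply: is_lim_seq_plus' => //; apply: is_lim_seq_const.
  have [n1 H1] := proj1 (lim_seqP _ _) U e e0.
  have [n2 H2] := proj1 (lim_seqP _ _) D e e0.
  have m0 : 0 < Rmin (a / 2) 1 by apply: Rmin_pos; lra.
  have [n3 H3] := proj1 (lim_seqP _ _) c0 _ m0.
  set n := maxn (maxn n1 n2) n3.
  have [h1 _] := Rabs_def2 _ _ (H1 n (leq_trans (leq_maxl _ _) (leq_maxl _ _))).
  have [_ h2] := Rabs_def2 _ _ (H2 n (leq_trans (leq_maxr _ _) (leq_maxl _ _))).
  have [h3 _] := Rabs_def2 _ _ (H3 n (leq_maxr _ _)).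
  exists (/ INR n.+1); have := Rmin_l (a / 2) 1; have := Rmin_r (a / 2) 1.
  by have := Rinv_0_lt_compat _ (INR_S_gt0 n); lra.
apply/lim_seqP => e e0.
have e4 : 0 < e / 4 by lra.
have [dl [[dl0 dla] [dl1 [up lo]]]] := phi _ e4.
pose K := Gamma (g + 1) * Rpower a (- (g + 1)).
have K0 : 0 < K by apply: Rmult_lt_0_compat => //; apply: exp_pos.
(* Both losses due to the cut at T N are at most e / 4: the long cycles cost 1 / T, the truncated
   Abelian sum at most K / T. *)
pose T := (1 + K) / (e / 4).
have T0 : 0 < T by apply: Rdiv_lt_0_compat; lra.
have KT : (1 + K) / T = e / 4 by rewrite /T; field; lra.
have c1 : 0 < a - dl by lra.
have c2 : 0 < a + dl by lra.
have [n1 H1] := quotient_uniform g0 T0 dl0.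
have [n2 H2] := Abel_upper g0 c1 dl0.
have [n3 H3] := Abel_lower g0 c2 T0 dl0.
exists (maxn (maxn n1 n2) n3).+1 => -[//|n]; rewrite ltnS !geq_max => /andP[/andP[n1n n2n] n3n].
have Np := N_gt0 n.+1; have np := INR_S_gt0 n; have hp := h_gt0 n.+1.
have [M HM] := nfloor_ex (T * N n.+1) (Rlt_le _ _ (Rmult_lt_0_compat _ _ T0 Np)).
have M1 : T * N n.+1 < INR M.+1 by rewrite S_INR; lra.
have [MN _] := H1 n.+1 (leqW n1n) M (proj1 HM).
set P := Rpower (N n.+1) (- g); have P0 : 0 < P by exact: exp_pos.
have -> : Rpower (INR n.+1) (- (g / (g + 1))) = P.
  by rewrite /P /N /scale Rpower_mult; congr Rpower; field; lra.
rewrite Expect_K -/h; last by lra.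
pose Q l := theta g l.+1 / INR l.+1 * (h (n.+1 - l.+1)%N / h n.+1).
have Q0 l : 0 <= Q l.
  by left; apply: Rmult_lt_0_compat; apply: Rdiv_lt_0_compat => //; apply: INR_S_gt0.
have -> : \big[Rplus/R0]_(l < n.+1) (theta g l.+1 / INR l.+1 * h (n.+1 - l.+1)%N) / h n.+1 =
   \big[Rplus/R0]_(l < n.+1) Q l.
  by rewrite /Rdiv big_distrl; apply: eq_bigr => l _ /=; rewrite /Q /Rdiv; ring.
have headle : \big[Rplus/R0]_(l < M) Q l <= \big[Rplus/R0]_(l < n.+1) Q l by apply: sumR_ord_mono.
have tail : \big[Rplus/R0]_(l < n.+1) Q l <= \big[Rplus/R0]_(l < M) Q l + / INR M.+1 * INR n.+1.
  rewrite -(sum_theta_quotient n.+1) -!(big_mkord predT Q).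
  rewrite -(big_mkord predT (fun l => theta g l.+1 * (h (n.+1 - l.+1)%N / h n.+1))).
  rewrite (@big_cat_nat _ _ _ M 0 n.+1) //=.
  apply: Rplus_le_compat_l; rewrite [X in _ * X](@big_cat_nat _ _ _ M 0 n.+1) //= Rmult_plus_distr_l.
  have iM := Rinv_0_lt_compat _ (INR_S_gt0 M).
  set S1 := \big[Rplus/R0]_(0 <= i < M) _; set S2 := \big[Rplus/R0]_(M <= i < n.+1) (theta _ _ * _).
  have : 0 <= S1.
    apply: sumR_ge0 => i _; left; apply: Rmult_lt_0_compat => //; exact: Rdiv_lt_0_compat.
  have : \big[Rplus/R0]_(M <= i < n.+1) Q i <= / INR M.+1 * S2; last by nra.
  rewrite /S2 big_distrr /= !big_nat; apply: sumR_le => i /andP[Mi _].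
  rewrite /Q; set q := h _ / h _; rewrite -Rmult_assoc (Rmult_comm (/ INR M.+1)).
  apply: Rmult_le_compat_r; first by left; apply: Rdiv_lt_0_compat.
  apply: Rmult_le_compat_l; first by left.
  apply: Rinv_le_contravar; first exact: INR_S_gt0.
  exact: leq_INR.
have tP : P * (/ INR M.+1 * INR n.+1) <= / T.
  rewrite -(@scale_pow g g0 n.+1) // -/N /P Rpower_Ropp.
  have p0 : 0 < Rpower (N n.+1) g by exact: exp_pos.
  have -> : / Rpower (N n.+1) g * (/ INR M.+1 * (Rpower (N n.+1) g * N n.+1)) = N n.+1 / INR M.+1.
    by field; split; apply: Rgt_not_eq => //; apply: INR_S_gt0.
  apply/Rle_div_l; first exact: INR_S_gt0.
  apply: (Rmult_le_reg_l T) => //; rewrite -Rmult_assoc Rinv_r; lra.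
have lM (l : 'I_M) : INR l.+1 <= T * N n.+1.
  by apply: Rle_trans (proj1 HM); apply: leq_INR.
have upM : P * \big[Rplus/R0]_(l < M) Q l <= Lim + e / 4.
  apply: Rle_trans up; apply: (Rle_trans _ ((1 + dl) * (P * \big[Rplus/R0]_(l < M)
     (theta g l.+1 / INR l.+1 * exp (- ((a - dl) * (INR l.+1 / N n.+1))))))).
    rewrite -Rmult_assoc (Rmult_comm _ P) Rmult_assoc; apply: Rmult_le_compat_l; first by left.
    rewrite big_distrr /=; apply: sumR_le => l _.
    have [_ [_ hq]] := H1 n.+1 (leqW n1n) l.+1 (lM l).
    rewrite /Q -Rmult_assoc (Rmult_comm (1 + dl)) Rmult_assoc.
    by apply: Rmult_le_compat_l => //; left; apply: Rdiv_lt_0_compat => //; apply: INR_S_gt0.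
  by apply: Rmult_le_compat_l (H2 n.+1 (leqW n2n) M); lra.
have loM : Lim - e / 4 - e / 4 <= P * \big[Rplus/R0]_(l < M) Q l.
  have KK : Gamma (g + 1) * Rpower (a + dl) (- (g + 1)) / T <= e / 4.
    rewrite -KT; apply: Rmult_le_compat_r; first by left; apply: Rinv_0_lt_compat.
    suff : Rpower (a + dl) (- (g + 1)) <= Rpower a (- (g + 1)).
      by move=> /(Rmult_le_compat_l _ _ _ (Rlt_le _ _ G10)); rewrite -/K; lra.
    rewrite !Rpower_Ropp; apply: Rinv_le_contravar; first exact: exp_pos.
    by apply: Rle_Rpower_l; lra.
  have KK0 : 0 < Gamma (g + 1) * Rpower (a + dl) (- (g + 1)) / T.
    by apply: Rdiv_lt_0_compat => //; apply: Rmult_lt_0_compat => //; apply: exp_pos.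
  have := H3 n.+1 (leqW n3n) M M1; rewrite -/N -/P => h3.
  apply: (Rle_trans _ ((1 - dl) * (P * \big[Rplus/R0]_(l < M)
     (theta g l.+1 / INR l.+1 * exp (- ((a + dl) * (INR l.+1 / N n.+1))))))); last first.
    rewrite -Rmult_assoc (Rmult_comm _ P) Rmult_assoc; apply: Rmult_le_compat_l; first by left.
    rewrite big_distrr /=; apply: sumR_le => l _.
    have [_ [hq _]] := H1 n.+1 (leqW n1n) l.+1 (lM l).
    rewrite /Q -Rmult_assoc (Rmult_comm (1 - dl)) Rmult_assoc.
    by apply: Rmult_le_compat_l => //; left; apply: Rdiv_lt_0_compat => //; apply: INR_S_gt0.
  have := Rmult_le_compat_l (1 - dl) _ _ ltac:(lra) h3.
  by nra.
have iT : / T <= e / 4.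
  by rewrite -KT -[/ T]Rmult_1_l; apply: Rmult_le_compat_r; [left; apply: Rinv_0_lt_compat|lra].
have t1 := Rmult_le_compat_l _ _ _ (Rlt_le _ _ P0) tail.
have t2 := Rmult_le_compat_l _ _ _ (Rlt_le _ _ P0) headle.
by apply: Rabs_def1; lra.
Qed.

End Limits.

(** * The length of the cycle containing the first point *)

Lemma nat_below y : 0 < y -> exists M : nat, INR M < y <= INR M + 1.
Proof.
move=> y0; have [k [k1 k2]] := nfloor_ex y (Rlt_le _ _ y0).
case: (Req_dec (INR k) y) => ky; last by exists k; lra.
case: k ky k1 k2 => [|k] ky k1 k2; first by move: ky; change (INR 0) with 0; lra.
by exists k; move: ky; rewrite S_INR; lra.
Qed.

Section FirstCycle.
Variable g : R.
Hypothesis g0 : 0 < g.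
Let N := scale g.
Let h := hn (theta g).
Let a := Rpower (Gamma (g + 1)) (/ (g + 1)).

Let a_gt0 : 0 < a. Proof. exact: exp_pos. Qed.
Let N_gt0 n : 0 < N n. Proof. exact: scale_gt0. Qed.
Let h_gt0 n : 0 < h n. Proof. exact: hn_theta_gt0. Qed.
Let th_gt0 n : 0 < theta g n. Proof. exact: theta_gt0. Qed.

Lemma quotient_close T e : 0 < T -> 0 < e -> exists n0, forall n, (n0 <= n)%N ->
  forall j : nat, INR j <= T * N n -> (j <= n)%N /\
    Rabs (h (n - j)%N / h n - exp (- (a * (INR j / N n)))) <= e.
Proof.
move=> T0 e0.
(* dl T <= 1/2 gives exp (dl u) <= 1 + 2 dl u on the window, and then (1 + dl) (1 + 2 dl T) <= 1 +
   dl (1 + 4 T) <= 1 + e. *)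
pose dl := Rmin (Rmin 1 (/ (2 * T))) (e / (1 + 4 * T)).
have iT : 0 < / (2 * T) by apply: Rinv_0_lt_compat; lra.
have dl0 : 0 < dl by do 2?apply: Rmin_pos => //; [lra|apply: Rdiv_lt_0_compat; lra].
have dl1 : dl <= 1 by apply: Rle_trans (Rmin_l _ _) (Rmin_l _ _).
have dlT : dl * T <= / 2.
  have : dl <= / (2 * T) by apply: Rle_trans (Rmin_l _ _) (Rmin_r _ _).
  move=> /(Rmult_le_compat_r T _ _ (Rlt_le _ _ T0)).
  by have -> : / (2 * T) * T = / 2 by field; lra.
have dle : dl * (1 + 4 * T) <= e.
  have : dl <= e / (1 + 4 * T) by apply: Rmin_r.
  move=> /(Rmult_le_compat_r (1 + 4 * T) _ _ ltac:(lra)).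
  by have -> : e / (1 + 4 * T) * (1 + 4 * T) = e by field; lra.
have [n1 H1] := quotient_uniform g0 T0 dl0.
exists n1 => n n1n j jT; have [jn [lo up]] := H1 n n1n j jT; split=> //.
have Np := N_gt0 n.
rewrite -/N -/h -/a in lo up; set u := INR j / N n in lo up *.
have u0 : 0 <= u.
  by apply: Rmult_le_pos; [exact: pos_INR|left; apply: Rinv_0_lt_compat].
have uT : u <= T by apply/Rle_div_l.
set E := exp (- (a * u)).
have E0 : 0 < E by exact: exp_pos.
have E1 : E <= 1 by rewrite -exp_0; apply: exp_le; nra.
have eu : exp (- ((a - dl) * u)) = E * exp (dl * u) by rewrite -exp_plus; congr exp; ring.
have el : exp (- ((a + dl) * u)) = E * exp (- (dl * u)) by rewrite -exp_plus; congr exp; ring.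
rewrite eu in up; rewrite el in lo.
have du0 : 0 <= dl * u by nra.
have duT : dl * u <= dl * T by nra.
have low : 1 - dl * u <= exp (- (dl * u)) by have := exp_ineq1_le (- (dl * u)); lra.
have x0 := exp_pos (dl * u).
have upp : exp (dl * u) <= 1 + 2 * (dl * u).
  have e1 : exp (dl * u) * exp (- (dl * u)) = 1 by rewrite -exp_plus Rplus_opp_r exp_0.
  by nra.
apply: Rabs_le; split.
  have : E - e <= (1 - dl) * (E * exp (- (dl * u))); last by lra.
  have h1 : (1 - dl) * (1 - dl * u) <= (1 - dl) * exp (- (dl * u)).
    by apply: Rmult_le_compat_l; lra.
  have h2 : 1 - e <= (1 - dl) * exp (- (dl * u)) by nra.
  by nra.
have : (1 + dl) * (E * exp (dl * u)) <= E + e; last by lra.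
have h1 : (1 + dl) * exp (dl * u) <= (1 + dl) * (1 + 2 * (dl * u)).
  by apply: Rmult_le_compat_l; lra.
have h2 : (1 + dl) * exp (dl * u) <= 1 + e by nra.
by nra.
Qed.

(** The constant A covers the finitely many j where theta_j is not yet close to j^g; it disappears
    after division by N^g. *)
Lemma theta_near e : 0 < e -> exists A, 0 <= A /\ forall j,
  Rabs (theta g j.+1 - Rpower (INR j.+1) g) <= e * Rpower (INR j.+1) g + A.
Proof.
move=> e0; have [J HJ] := proj1 (lim_seqP _ _) (theta_equiv g0) e e0.
exists (\big[Rplus/R0]_(i < J) theta g i); split; first by apply: sumR_ge0 => i _; left.
move=> j; have p0 := Rpower_gt0 (INR j.+1) g.
have A0 : 0 <= \big[Rplus/R0]_(i < J) theta g i by apply: sumR_ge0 => i _; left.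
have ge := theta_ge j g0.
case: (leqP J j.+1) => jJ.
  have hj := Rabs_def2 _ _ (HJ _ jJ).
  have : Rabs (theta g j.+1 - Rpower (INR j.+1) g) <= e * Rpower (INR j.+1) g; last by lra.
  have -> : theta g j.+1 - Rpower (INR j.+1) g =
    (theta g j.+1 / Rpower (INR j.+1) g - 1) * Rpower (INR j.+1) g by field; lra.
  rewrite Rabs_mult (Rabs_pos_eq (Rpower _ _)); last by lra.
  by apply: Rmult_le_compat_r; [lra|apply: Rabs_le; lra].
have : theta g j.+1 <= \big[Rplus/R0]_(i < J) theta g i.
  rewrite (bigD1 (Ordinal jJ)) //=.
  rewrite -[X in X <= _]Rplus_0_r; apply: Rplus_le_compat_l.
  by apply: sumR_ge0 => i _; left.
have := Rmult_lt_0_compat _ _ e0 p0.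
by rewrite Rabs_pos_eq; lra.
Qed.

Lemma theta_uniform T e : 0 < T -> 0 < e -> exists n0, forall n, (n0 <= n)%N ->
  forall j : nat, INR j.+1 <= T * N n ->
    Rabs (theta g j.+1 / Rpower (N n) g - Rpower (INR j.+1 / N n) g) <= e.
Proof.
move=> T0 e0; have T1 : 0 < Rpower T g by exact: exp_pos.
have e1 : 0 < e / 2 / Rpower T g by do 2!apply: Rdiv_lt_0_compat => //; lra.
have [A [A0 HA]] := theta_near e1.
have [n0 H0] := lim_infty_ge (A / (e / 2)) (lim_scale_pow g0).
exists n0 => n n0n j jT; have Np := N_gt0 n; have P0 : 0 < Rpower (N n) g by exact: exp_pos.
have j0 := INR_S_gt0 j.
have E : Rpower (INR j.+1 / N n) g = Rpower (INR j.+1) g / Rpower (N n) g.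
  rewrite /Rpower /Rdiv -exp_Ropp -exp_plus ln_mult ?ln_Rinv //; first by congr exp; ring.
  exact: Rinv_0_lt_compat.
have ET : Rpower (INR j.+1 / N n) g <= Rpower T g.
  apply: Rle_Rpower_l; first by lra.
  by split; [exact: Rdiv_lt_0_compat|apply/Rle_div_l].
have -> : theta g j.+1 / Rpower (N n) g - Rpower (INR j.+1 / N n) g =
  (theta g j.+1 - Rpower (INR j.+1) g) * / Rpower (N n) g by rewrite E; field; lra.
have iP := Rinv_0_lt_compat _ P0.
rewrite Rabs_mult (Rabs_pos_eq (/ _)); last by lra.
apply: Rle_trans (Rmult_le_compat_r _ _ _ (Rlt_le _ _ iP) (HA j)) _.
rewrite Rmult_plus_distr_r Rmult_assoc -/(Rpower (INR j.+1) g / Rpower (N n) g) -E.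
have : e / 2 / Rpower T g * Rpower (INR j.+1 / N n) g <= e / 2.
  apply: (Rle_trans _ (e / 2 / Rpower T g * Rpower T g)); last by right; field; lra.
  by apply: Rmult_le_compat_l => //; left.
suff : A * / Rpower (N n) g <= e / 2 by lra.
apply/Rle_div_l => //.
by have := H0 n n0n; rewrite -/N => /Rlt_div_l; lra.
Qed.

(** A local limit theorem: since n = N^g N, the quantity compared with the density is N P(L_1 = j +
    1). *)
Lemma local_density T e : 0 < T -> 0 < e -> exists n0, forall n, (n0 <= n)%N ->
  forall j : nat, INR j.+1 <= T * N n -> (j.+1 <= n)%N /\
    Rabs (theta g j.+1 / Rpower (N n) g * (h (n - j.+1)%N / h n) -
          gamma_dens g a (INR j.+1 / N n)) <= e.
Proof.
move=> T0 e0; set S := Rpower T g; have S0 : 0 < S by exact: exp_pos.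
(* The error is at most e1 q + u^g e1, with h-quotient q <= 2 and u^g <= S. *)
pose e1 := Rmin 1 (e / (2 + S)).
have e10 : 0 < e1 by apply: Rmin_pos; [lra|apply: Rdiv_lt_0_compat; lra].
have e11 : e1 <= 1 by apply: Rmin_l.
have e1e : e1 * (2 + S) <= e.
  have : e1 <= e / (2 + S) by apply: Rmin_r.
  move=> /(Rmult_le_compat_r (2 + S) _ _ ltac:(lra)).
  by have -> : e / (2 + S) * (2 + S) = e by field; lra.
have [n1 H1] := quotient_close T0 e10; have [n2 H2] := theta_uniform T0 e10.
exists (maxn n1 n2) => n; rewrite geq_max => /andP[n1n n2n] j jT.
have [jn hq] := H1 n n1n _ jT; split=> //; have ht := H2 n n2n _ jT.
have Np := N_gt0 n; have j0 := INR_S_gt0 j.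
have u0 : 0 < INR j.+1 / N n by exact: Rdiv_lt_0_compat.
rewrite /gamma_dens; case: Rlt_dec => [? /=|//].
set u := INR j.+1 / N n in u0 hq ht *.
have BS : Rpower u g <= S.
  by apply: Rle_Rpower_l; [lra|split=> //; apply/Rle_div_l].
have B0 : 0 < Rpower u g by exact: exp_pos.
have E0 := exp_pos (- (a * u)).
have E1 : exp (- (a * u)) <= 1 by rewrite -exp_0; apply: exp_le; nra.
move: E0 E1 hq ht; set q := h _ / h n; set A := theta g _ / _; set E := exp _ => E0 E1 hq ht.
have q0 : 0 < q by exact: Rdiv_lt_0_compat.
have q2 : q <= 2 by have /Rabs_le_between := hq; lra.
have -> : A * q - Rpower u g * E = (A - Rpower u g) * q + Rpower u g * (q - E) by ring.
apply: Rle_trans (Rabs_triang _ _) _; rewrite (Rabs_mult _ q) (Rabs_mult (Rpower u g)) (Rabs_pos_eq q); last by lra.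
rewrite (Rabs_pos_eq (Rpower u g)); last by lra.
have := Rabs_pos (A - Rpower u g); have := Rabs_pos (q - E).
by set X := Rabs _ in hq *; set W := Rabs _ in ht *; nra.
Qed.

Lemma lim_Prob_L1 s : 0 < s ->
  is_lim_seq (fun m => Prob (theta g) (fun sg : {perm 'I_m.+1} =>
      Rlt_dec (INR (L1 sg) / N m.+1) s))
    (RInt (gamma_dens g a) 0 s).
Proof.
move=> s0; apply/lim_seqP => e e0.
have fc x : continuity_pt (gamma_dens g a) x by exact: gamma_dens_continuous.
have e2 : 0 < e / 2 by lra.
have [n1 H1] := riemann_right fc s0 N_gt0 (scale_infty g0) e2.
have es : 0 < e / 2 / s by apply: Rdiv_lt_0_compat.
have [n2 H2] := local_density s0 es.
exists (maxn n1 n2) => m; rewrite geq_max => /andP[n1m n2m].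
have Np := N_gt0 m.+1; have np := INR_S_gt0 m; have hp := h_gt0 m.+1.
have [M HM] := nat_below (Rmult_lt_0_compat _ _ s0 Np).
have h1 := H1 m.+1 (leqW n1m) M HM.
have lM l : (l < M)%N -> INR l.+1 <= s * N m.+1.
  by move=> /leq_INR; lra.
have Mm : (M <= m.+1)%N.
  case: M lM {h1 HM} => // M lM; exact: (proj1 (H2 m.+1 (leqW n2m) M (lM M (ltnSn M)))).
(* The event L_1 < s N is the initial segment l < M, so only lengths within the window occur and no
   estimate of long cycles enters. *)
have sel l : is_left (Rlt_dec (INR l.+1 / N m.+1) s) = (l < M)%N.
  case: Rlt_dec => /= hl; symmetry.
    have {}hl : INR l.+1 < s * N m.+1 by apply/Rlt_div_l.
    rewrite ltnNge; apply/negP => /leq_INR Ml; rewrite S_INR in hl; lra.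
  apply/negbTE/negP => /leq_INR Ml; apply: hl; apply/Rlt_div_l => //; lra.
rewrite (Prob_L1 (fun j => Rlt_dec (INR j / N m.+1) s)); last by rewrite -/h; lra.
have -> : \big[Rplus/R0]_(l < m.+1 | Rlt_dec (INR l.+1 / N m.+1) s)
    (theta g l.+1 * hn (theta g) (m - l)) =
  \big[Rplus/R0]_(l < M) (theta g l.+1 * h (m - l)%N).
  by rewrite (big_ord_widen m.+1 (fun l => theta g l.+1 * h (m - l)%N) Mm); apply: eq_bigl.
have -> : \big[Rplus/R0]_(l < M) (theta g l.+1 * h (m - l)%N) / (INR m.+1 * hn (theta g) m.+1) =
  / N m.+1 * \big[Rplus/R0]_(l < M)
     (theta g l.+1 / Rpower (N m.+1) g * (h (m.+1 - l.+1)%N / h m.+1)).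
  rewrite /Rdiv big_distrl big_distrr; apply: eq_bigr => l _ /=; rewrite subSS -/h.
  rewrite -(@scale_pow g g0 m.+1) // -/N.
  by have p0 : 0 < Rpower (N m.+1) g by [exact: exp_pos]; field; lra.
set S := bigop _ _ _; set S' := bigop _ _ _ in h1.
have SS : Rabs (S - S') <= INR M * (e / 2 / s).
  have -> : S - S' = \big[Rplus/R0]_(l < M) (theta g l.+1 / Rpower (N m.+1) g *
     (h (m.+1 - l.+1)%N / h m.+1) - gamma_dens g a (INR l.+1 / N m.+1)).
    rewrite /S /S'; apply: (Rplus_eq_reg_r S'); rewrite /S' -big_split /=.
    rewrite Rplus_assoc Rplus_opp_l Rplus_0_r.
    by apply: eq_bigr => l _ /=; ring.
  apply: Rle_trans (Rabs_sumR _ _ _) _.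
  rewrite -[M in INR M]card_ord -sumR_const; apply: sumR_le => l _.
  exact: (proj2 (H2 m.+1 (leqW n2m) l (lM l (ltn_ord l)))).
have iN := Rinv_0_lt_compat _ Np.
have -> : / N m.+1 * S - RInt (gamma_dens g a) 0 s =
  / N m.+1 * (S - S') + (/ N m.+1 * S' - RInt (gamma_dens g a) 0 s) by ring.
apply: Rle_lt_trans (Rabs_triang _ _) _.
rewrite Rabs_mult (Rabs_pos_eq (/ N m.+1)); last by lra.
have : / N m.+1 * Rabs (S - S') <= e / 2; last by lra.
apply: (Rle_trans _ (/ N m.+1 * (INR M * (e / 2 / s)))).
  by apply: Rmult_le_compat_l => //; left.
have -> : / N m.+1 * (INR M * (e / 2 / s)) = (INR M / (s * N m.+1)) * (e / 2) by field; lra.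
rewrite -[X in _ <= X]Rmult_1_l; apply: Rmult_le_compat_r; first by lra.
apply/Rle_div_l; first exact: Rmult_lt_0_compat.
by lra.
Qed.

End FirstCycle.

Theorem theorem5p1 (g : R) (hg : Rlt 0 g) :
  let th := theta g in
  let a := Rpower (Gamma (Rplus g R1)) (Rinv (Rplus g R1)) in
  (* (a) weak convergence of L_1 / n^{1/(1+g)} to Gamma(g+1, rate a); n = m+1 *)
  (forall s : R, Rlt 0 s ->
     exists pr : Riemann_integrable (gamma_dens g a) 0 s,
       Un_cv (fun m : nat =>
                Prob th (fun sg : {perm 'I_m.+1} =>
                  Rlt_dec (Rdiv (INR (L1 sg)) (Rpower (INR m.+1) (Rinv (Rplus R1 g)))) s))
             (RiemannInt pr)) /\
  (* (b) *)
  Un_cv (fun n : nat =>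
           Rmult (Rpower (INR n) (Ropp (Rdiv g (Rplus g R1))))
                 (Expect th (fun sg : {perm 'I_n} => INR (Kcyc sg))))
        (Rpower (Rdiv (Gamma g) (Rpower g g)) (Rinv (Rplus g R1))) /\
  (* (c) finite-dimensional convergence of (R_1,...,R_m) to independent Poissons *)
  (forall (m : nat) (k : nat -> nat),
     Un_cv (fun n : nat =>
              Prob th (fun sg : {perm 'I_n} =>
                [forall j : 'I_m, Rcyc j.+1 sg == k j.+1]))
           (\big[Rmult/R1]_(1 <= j < m.+1) poisson (Rdiv (th j) (INR j)) (k j))).
Proof.
move=> th a; have a0 : 0 < a by exact: exp_pos.
split; last by split=> [|m k]; apply/is_lim_seq_Reals; [exact: lim_Expect_Kcyc|exact: lim_Prob_Rcyc].
move=> s s0.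
have pr := continuity_implies_RiemannInt (Rlt_le _ _ s0)
  (fun x _ => @gamma_dens_continuous g a x hg a0).
by exists pr; apply/is_lim_seq_Reals; rewrite -RInt_Reals; apply: lim_Prob_L1.
Qed.
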